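(* Let $f:\mathbb{R}^n\to\mathbb{R}$ and $c:\mathbb{R}^n\to\mathbb{R}^m$ be twice continuously differentiable, such that the problem $\min\{f(x):c(x)=0\}$ has at least one optimal solution, and let $\epsilon_1,\epsilon_2\in(0,1)$. Assume: (a) a point $z_{\epsilon_1}$ with $\|c(z_{\epsilon_1})\|\le\epsilon_1/2$ is known; (b) there exist constants $f_{\rm hi},f_{\rm low}$ and $\gamma>0$, independent of $\epsilon_1$ and $\epsilon_2$, such that $f(z_{\epsilon_1})\le f_{\rm hi}$ and $f(x)+\gamma\|c(x)\|^2/2\ge f_{\rm low}$ for all $x\in\mathbb{R}^n$; (c) there exist $\delta_f,\delta_c>0$ such that the set $\mathcal{S}(\delta_f,\delta_c):=\{x:f(x)\le f_{\rm hi}+\delta_f,\ \|c(x)\|\le1+\delta_c\}$ is compact, and $\nabla^2f$ and $\nabla^2c_i$, $i=1,\ldots,m$, are Lipschitz continuous in a convex open neighborhood $\Omega(\delta_f,\delta_c)$ of $\mathcal{S}(\delta_f,\delta_c)$. Consider the Newton-CG based AL method (defined in the context) with inputs $\epsilon_1,\epsilon_2$, $\Lambda>0$, $x^0\in\mathbb{R}^n$, $\lambda^0\in\mathcal{B}_\Lambda$, $\rho_0>2\gamma$, $\alpha\in(0,1)$, $r>1$, $\delta\in(0,1)$, $z_{\epsilon_1}$. Suppose that $\rho_0$ is sufficiently large such that $\delta_{f,1}\le\delta_f$ and $\delta_{c,1}\le\delta_c$, where $$\delta_{f,1}:=\frac{\Lambda^2}{2\rho_0},\qquad \delta_{c,1}:=\sqrt{\frac{2(f_{\rm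 hi}-f_{\rm low}+\gamma)}{\rho_0-2\gamma}+\frac{\Lambda^2}{(\rho_0-2\gamma)^2}}+\frac{\Lambda}{\rho_0-2\gamma}.$$ Then the following statements hold. (i) The total number of iterations of the Newton-CG method performed in the AL method is at most $\widetilde{\mathcal{O}}(\epsilon_1^{-4}\max\{\epsilon_1^{-2}\epsilon_2,\epsilon_2^{-3}\})$. If $c$ is further assumed to be affine, then it is at most $\widetilde{\mathcal{O}}(\max\{\epsilon_1^{-2}\epsilon_2,\epsilon_2^{-3}\})$. (ii) The total number of matrix-vector products performed by the Newton-CG method in the AL method is at most $\widetilde{\mathcal{O}}(\epsilon_1^{-4}\max\{\epsilon_1^{-2}\epsilon_2,\epsilon_2^{-3}\}\min\{n,\epsilon_1^{-1}\epsilon_2^{-1/2}\})$. If $c$ is further assumed to be affine, then it is at most $\widetilde{\mathcal{O}}(\max\{\epsilon_1^{-2}\epsilon_2,\epsilon_2^{-3}\}\min\{n,\epsilon_1^{-1}\epsilon_2^{-1/2}\})$.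
   Context: Notation. $\|\cdot\|$ is the Euclidean norm of a vector or the spectral norm of a matrix; $\lambda_{\min}(H)$ is the minimum eigenvalue of a real symmetric matrix; $\mathcal{B}_R=\{x:\|x\|\le R\}$ and $\Pi_{\mathcal{B}_R}$ is Euclidean projection onto it; ${\rm sgn}(s)=1$ if $s\ge0$ and $-1$ otherwise. $\widetilde{\mathcal{O}}(\cdot)$ is $\mathcal{O}(\cdot)$ with logarithmic terms omitted; the order notation records the dependence on $\epsilon_1,\epsilon_2$ (and $n$ where displayed), with $f$, $c$, $f_{\rm hi},f_{\rm low},\gamma,\delta_f,\delta_c$ and the algorithm parameters $\Lambda,\rho_0,\alpha,r,\delta,\theta,\zeta,\eta$ treated as fixed. Capped CG method. Inputs: symmetric $H\in\mathbb{R}^{n\times n}$, vector $g\ne0$, damping parameter $\varepsilon\in(0,1)$, accuracy $\zeta\in(0,1)$, scalar $U\ge0$ (default $0$). Outputs: a type d_type in {SOL, NC} and a vector $d$. Set $\bar H=H+2\varepsilon I$ and, as functions of the current $U$, $\kappa=(U+2\varepsilon)/\varepsilon$, $\widehat\zeta=\zeta/(3\kappa)$, $\tau=\sqrt\kappa/(\sqrt\kappa+1)$, $T=4\kappa^4/(1-\sqrt\tau)^2$. ''Update $U$ with $v$'' means: if $\|Hv\|>U\|v\|$, set $U=\|Hv\|/\|v\|$ and recompute $\kappa,\widehat\zeta,\tau,T$. Start with $y^0=0$, $r^0=g$, $p^0=-g$, $j=0$. If $(p^0)^T\bar Hp^0<\varepsilon\|p^0\|^2$, return $d=p^0$ with type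 NC; otherwise update $U$ with $p^0$. Then loop: set $\alpha_j=(r^j)^Tr^j/((p^j)^T\bar Hp^j)$, $y^{j+1}=y^j+\alpha_jp^j$, $r^{j+1}=r^j+\alpha_j\bar Hp^j$, $\beta_{j+1}=\|r^{j+1}\|^2/\|r^j\|^2$, $p^{j+1}=-r^{j+1}+\beta_{j+1}p^j$, $j\leftarrow j+1$; update $U$ with $p^j$, then $y^j$, then $r^j$; then apply the first of the following that is applicable (if none is, continue the loop): if $(y^j)^T\bar Hy^j<\varepsilon\|y^j\|^2$, return $d=y^j$, type NC; else if $\|r^j\|\le\widehat\zeta\|r^0\|$, return $d=y^j$, type SOL; else if $(p^j)^T\bar Hp^j<\varepsilon\|p^j\|^2$, return $d=p^j$, type NC; else if $\|r^j\|>\sqrt T\tau^{j/2}\|r^0\|$, compute $\alpha_j,y^{j+1}$ as in the loop, find $i\in\{0,\ldots,j-1\}$ with $(y^{j+1}-y^i)^T\bar H(y^{j+1}-y^i)<\varepsilon\|y^{j+1}-y^i\|^2$, and return $d=y^{j+1}-y^i$, type NC. Minimum eigenvalue oracle. Inputs: symmetric $H\in\mathbb{R}^{n\times n}$, $\varepsilon>0$, $\delta\in(0,1)$. Apply the Lanczos method to estimate $\lambda_{\min}(H)$ starting with a random vector uniformly generated on the unit sphere, for at most $N(\varepsilon,\delta):=\min\{n,1+\lceil\frac{\ln(2.75n/\delta^2)}{2}\sqrt{\|H\|/\varepsilon}\rceil\}$ iterations. If a unit vector $v$ with $v^THv\le-\varepsilon/2$ is found at some iteration, terminate and return $v$; otherwise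 certify that $\lambda_{\min}(H)\ge-\varepsilon$ (a certificate valid with probability at least $1-\delta$). Newton-CG method for $\min F$. Inputs: $\epsilon_g,\epsilon_H\in(0,1)$ (or the tolerances given), backtracking ratio $\theta\in(0,1)$, starting point $u^0$, CG accuracy $\zeta\in(0,1)$, line-search parameter $\eta\in(0,1)$, probability parameter $\delta\in(0,1)$. Set $x^0=u^0$. For $t=0,1,2,\ldots$: - If $\|\nabla F(x^t)\|>\epsilon_g$: call the capped CG method with $H=\nabla^2F(x^t)$, $\varepsilon=\epsilon_H$, $g=\nabla F(x^t)$, accuracy $\zeta$, $U=0$, obtaining $d$ and d_type. If d_type = NC, set $d^t=-{\rm sgn}(d^T\nabla F(x^t))\frac{|d^T\nabla^2F(x^t)d|}{\|d\|^3}d$; if d_type = SOL, set $d^t=d$. - Otherwise: call the minimum eigenvalue oracle with $H=\nabla^2F(x^t)$, $\varepsilon=\epsilon_H$ and $\delta$. If it certifies $\lambda_{\min}(\nabla^2F(x^t))\ge-\epsilon_H$, output $x^t$ and terminate. Otherwise it returns $v$; set d_type = NC and $d^t=-{\rm sgn}(v^T\nabla F(x^t))|v^T\nabla^2F(x^t)v|v$. - Line search: $\alpha_t=\theta^{j_t}$, where $j_t$ is the smallest nonnegative integer $j$ such that $F(x^t+\theta^jd^t)<F(x^t)-\eta\epsilon_H\theta^{2j}\|d^t\|^2$ if d_type = SOL, or $F(x^t+\theta^jd^t)<F(x^t)-\eta\theta^{2j}\|d^t\|^3/2$ if d_type = NC. Set $x^{t+1}=x^t+\alpha_td^t$. Newton-CG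 based AL method. Let $\tilde c(x):=c(x)-c(z_{\epsilon_1})$ and $\widetilde{\mathcal{L}}(x,\lambda;\rho):=f(x)+\lambda^T\tilde c(x)+\rho\|\tilde c(x)\|^2/2$. Starting with $k=0$, repeat: 1. Set $\tau_k^g=\max\{\epsilon_1,r^{k\log\epsilon_1/\log2}\}$ and $\tau_k^H=\max\{\epsilon_2,r^{k\log\epsilon_2/\log2}\}$. 2. Set $x^k_{\rm init}=z_{\epsilon_1}$ if $\widetilde{\mathcal{L}}(x^k,\lambda^k;\rho_k)>f(z_{\epsilon_1})$ and $x^k_{\rm init}=x^k$ otherwise. Call the Newton-CG method with $F=\widetilde{\mathcal{L}}(\cdot,\lambda^k;\rho_k)$, $\epsilon_g=\tau_k^g$, $\epsilon_H=\tau_k^H$, $u^0=x^k_{\rm init}$, probability parameter $\delta$ (and fixed $\theta,\zeta,\eta\in(0,1)$) to find $x^{k+1}$ such that $\widetilde{\mathcal{L}}(x^{k+1},\lambda^k;\rho_k)\le f(z_{\epsilon_1})$, $\|\nabla_x\widetilde{\mathcal{L}}(x^{k+1},\lambda^k;\rho_k)\|\le\tau_k^g$, and $\lambda_{\min}(\nabla^2_{xx}\widetilde{\mathcal{L}}(x^{k+1},\lambda^k;\rho_k))\ge-\tau_k^H$ with probability at least $1-\delta$. 3. Set $\tilde\lambda^{k+1}=\lambda^k+\rho_k\tilde c(x^{k+1})$. 4. If $\tau_k^g\le\epsilon_1$, $\tau_k^H\le\epsilon_2$ and $\|c(x^{k+1})\|\le\epsilon_1$, output $(x^{k+1},\tilde\lambda^{k+1})$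 and terminate. 5. Set $\lambda^{k+1}=\Pi_{\mathcal{B}_\Lambda}(\tilde\lambda^{k+1})$. 6. If $k=0$ or $\|\tilde c(x^{k+1})\|>\alpha\|\tilde c(x^k)\|$, set $\rho_{k+1}=r\rho_k$; otherwise $\rho_{k+1}=\rho_k$. Set $k\leftarrow k+1$. ''Total number of iterations'' and ''total number of matrix-vector products'' are summed over all calls of the Newton-CG method until the AL method terminates; matrix-vector products are those involving Hessians of $\widetilde{\mathcal{L}}(\cdot,\lambda^k;\rho_k)$. *)

(* Defs.v *)
From HB Require Import structures.
From mathcomp Require Import all_boot all_order all_algebra.
From mathcomp Require Import all_classical all_reals all_analysis.

Set Implicit Arguments.
Unset Strict Implicit.
Unset Printing Implicit Defensive.

Import Order.TTheory GRing.Theory Num.Theory.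
Import numFieldNormedType.Exports.

Local Open Scope classical_set_scope.
Local Open Scope ring_scope.

(* The norm that the library puts on 'cV[R]_n and 'M[R]_n is the max norm. It
   is used below only for the topology (continuity, differentiability,
   compactness, openness); the Euclidean and spectral norms, on which the
   constants depend, are [enorm] and [snorm]. *)

Section Euclidean.
Context {R : realType}.

Definition dotp n (u v : 'cV[R]_n) : R := \sum_(i < n) u i 0 * v i 0.

Definition enorm n (u : 'cV[R]_n) : R := Num.sqrt (dotp u u).

Definition snorm n (A : 'M[R]_n) : R :=
  sup [set enorm (A *m v) | v in [set v : 'cV[R]_n | enorm v = 1]].

Definition quad n (A : 'M[R]_n) (v : 'cV[R]_n) : R := dotp v (A *m v).

Definition sgn (s : R) : R := if 0 <= s then 1 else -1.

Definition is_proj n (B : set 'cV[R]_n) (x y : 'cV[R]_n) : Prop :=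
  B y /\ forall w, B w -> enorm (x - y) <= enorm (x - w).

Definition eball n (r : R) : set 'cV[R]_n := [set x | enorm x <= r].

Definition grad n (F : 'cV[R]_n -> R) (x : 'cV[R]_n) : 'cV[R]_n :=
  \col_i 'D_(delta_mx i 0) F x.

Definition hess n (F : 'cV[R]_n -> R) (x : 'cV[R]_n) : 'M[R]_n :=
  \matrix_(i, j) 'D_(delta_mx j 0) (fun y => grad F y i 0) x.

Definition C2 n (F : 'cV[R]_n -> R) : Prop :=
  [/\ forall x, differentiable F x,
      forall x, differentiable (grad F) x
    & continuous (hess F)].

Definition comp_fun n m (c : 'cV[R]_n -> 'cV[R]_m) (i : 'I_m) : 'cV[R]_n -> R :=
  fun x => c x i 0.

Definition affine_map n m (c : 'cV[R]_n -> 'cV[R]_m) : Prop :=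
  exists (A : 'M[R]_(m, n)) (b : 'cV[R]_m), forall x, c x = A *m x + b.

Definition convex_in n (A : set 'cV[R]_n) : Prop :=
  forall x y t, A x -> A y -> 0 <= t <= 1 -> A (t *: x + (1 - t) *: y).

Definition hess_lipschitz n (F : 'cV[R]_n -> R) (A : set 'cV[R]_n) (L : R) :=
  forall x y, A x -> A y -> snorm (hess F x - hess F y) <= L * enorm (x - y).

End Euclidean.

Section CappedCG.
Context {R : realType}.
Variables (n : nat) (H : 'M[R]_n) (g : 'cV[R]_n) (eps zeta U0 : R).

Let Hbar : 'M[R]_n := H + (2 * eps)%:M.

Definition kappa (U : R) : R := (U + 2 * eps) / eps.
Definition zetahat (U : R) : R := zeta / (3 * kappa U).
Definition cg_tau (U : R) : R :=
  Num.sqrt (kappa U) / (Num.sqrt (kappa U) + 1).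
Definition cg_T (U : R) : R :=
  4 * kappa U ^+ 4 / (1 - Num.sqrt (cg_tau U)) ^+ 2.

Definition update_U (U : R) (v : 'cV[R]_n) : R :=
  if U * enorm v < enorm (H *m v) then enorm (H *m v) / enorm v else U.

Fixpoint cg_yrp (j : nat) : 'cV[R]_n * 'cV[R]_n * 'cV[R]_n :=
  if j is j'.+1 then
    let: (y, r, p) := cg_yrp j' in
    let a := dotp r r / quad Hbar p in
    let y' := y + a *: p in
    let r' := r + a *: (Hbar *m p) in
    let b := enorm r' ^+ 2 / enorm r ^+ 2 in
    (y', r', - r' + b *: p)
  else (0, g, - g).

Definition cg_y j : 'cV[R]_n := (cg_yrp j).1.1.
Definition cg_r j : 'cV[R]_n := (cg_yrp j).1.2.
Definition cg_p j : 'cV[R]_n := (cg_yrp j).2.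

Fixpoint cg_U (j : nat) : R :=
  if j is j'.+1 then
    update_U (update_U (update_U (cg_U j') (cg_p j)) (cg_y j)) (cg_r j)
  else update_U U0 (cg_p 0).

Definition low_curv (v : 'cV[R]_n) : bool := quad Hbar v < eps * enorm v ^+ 2.

(* At j = 0 the method only tests the curvature along p^0. *)
Definition test_y j : bool := (0 < j)%N && low_curv (cg_y j).
Definition test_sol j : bool :=
  (0 < j)%N && (enorm (cg_r j) <= zetahat (cg_U j) * enorm (cg_r 0)).
Definition test_p j : bool := low_curv (cg_p j).
Definition test_slow j : bool :=
  (0 < j)%N &&
  (Num.sqrt (cg_T (cg_U j)) * cg_tau (cg_U j) `^ (j%:R / 2) * enorm (cg_r 0)
     < enorm (cg_r j)).

Definition cg_running (j : nat) : Prop :=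
  forall i, (i < j)%N ->
    ~~ [|| test_y i, test_sol i, test_p i | test_slow i].

(* Products with H needed up to the tests at j: H p^0, then H p^i, H y^i and
   H r^i for 1 <= i <= j. Computing some of these by recurrences only lowers
   the count. *)
Definition cg_products (j : nat) : nat := (3 * j + 1)%N.

Inductive dtype := SOL | NC.

(* [capped_cg t d M]: the method returns d with type t after M products. The
   last case charges one product per candidate index 0, ..., j - 1. *)
Inductive capped_cg : dtype -> 'cV[R]_n -> nat -> Prop :=
| CGy j of cg_running j & test_y j :
    capped_cg NC (cg_y j) (cg_products j)
| CGsol j of cg_running j & ~~ test_y j & test_sol j :
    capped_cg SOL (cg_y j) (cg_products j)
| CGp j of cg_running j & ~~ test_y j & ~~ test_sol j & test_p j :
    capped_cg NC (cg_p j) (cg_products j)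
| CGslow j i of cg_running j & ~~ test_y j & ~~ test_sol j & ~~ test_p j
    & test_slow j & (i < j)%N & low_curv (cg_y j.+1 - cg_y i) :
    capped_cg NC (cg_y j.+1 - cg_y i) (cg_products j + j).

End CappedCG.

Section EigenvalueOracle.
Context {R : realType}.
Variables (n : nat) (H : 'M[R]_n) (eps delta : R) (b : 'cV[R]_n).

Definition lanczos_max : nat :=
  minn n (1 + `|Num.ceil (ln (11 / 4 * n%:R / delta ^+ 2) / 2
                          * Num.sqrt (snorm H / eps))|)%N.

(* (q_(k-1), q_k, beta_(k-1)), with the convention q_(-1) = 0, beta_(-1) = 0 *)
Fixpoint lanczos (k : nat) : 'cV[R]_n * 'cV[R]_n * R :=
  if k is k'.+1 then
    let: (q0, q1, be) := lanczos k' in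
    let w := H *m q1 - quad H q1 *: q1 - be *: q0 in
    (q1, (enorm w)^-1 *: w, enorm w)
  else (0, b, 0).

Definition lz_q k : 'cV[R]_n := (lanczos k).1.2.
Definition lz_alpha k : R := quad H (lz_q k).
Definition lz_beta k : R := (lanczos k.+1).2.

Definition lz_mx (k : nat) : 'M[R]_k :=
  \matrix_(i, j) (if i == j then lz_alpha i
                  else if j == i.+1 :> nat then lz_beta i
                  else if i == j.+1 :> nat then lz_beta j else 0).

Definition ritz_vector (k : nat) (v : 'cV[R]_n) : Prop :=
  exists (s : 'cV[R]_k) (a : R),
    [/\ enorm s = 1, lz_mx k *m s = a *: s,
        forall a', eigenvalue (lz_mx k) a' -> a <= a'
      & v = \sum_(i < k) s i 0 *: lz_q i].

Definition lz_found (k : nat) (v : 'cV[R]_n) : Prop :=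
  [/\ ritz_vector k v, enorm v = 1 & quad H v <= - eps / 2].

(* Iteration k >= 1 uses q_0, ..., q_(k-1) and is reached only if there was
   neither a breakdown (beta_i = 0) nor a success before. *)
Definition lz_reached (k : nat) : Prop :=
  [/\ (0 < k <= lanczos_max)%N,
      forall i, (i.+1 < k)%N -> lz_beta i != 0
    & forall k' v, (k' < k)%N -> ~ lz_found k' v].

(* [eig_oracle o M]: started at the unit vector b, the oracle returns o ([None]
   is the certificate) after M products with H. *)
Inductive eig_oracle : option 'cV[R]_n -> nat -> Prop :=
| OracleNC k v of lz_reached k & lz_found k v : eig_oracle (Some v) k
| OracleCert k of lz_reached k & (forall v, ~ lz_found k v)
    & k = lanczos_max \/ lz_beta k.-1 = 0 : eig_oracle None k.

End EigenvalueOracle.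

Section NewtonCG.
Context {R : realType}.
Variables (n : nat) (F : 'cV[R]_n -> R).
Variables (eg eH theta zeta eta delta : R).

Definition nc_direction (x d : 'cV[R]_n) : 'cV[R]_n :=
  - (sgn (dotp d (grad F x)) * (`|quad (hess F x) d| / enorm d ^+ 3)) *: d.

Inductive call_result :=
| Running                               (* interrupted before its end *)
| Certified
| Direction of dtype & 'cV[R]_n.

(* [ncg_call x M o]: the subroutine call made at the iterate x, with M products
   of Hessian and vector and outcome o. The starting vector of the oracle is an
   arbitrary unit vector, so that whatever is proved of all executions holds
   for every realization of the random vectors. *)
Inductive ncg_call (x : 'cV[R]_n) : nat -> call_result -> Prop :=
| CallCGRunning j of eg < enorm (grad F x)
    & cg_running (hess F x) (grad F x) eH zeta 0 j :
    ncg_call x (cg_products j) Running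
| CallCGSol d M of eg < enorm (grad F x)
    & capped_cg (hess F x) (grad F x) eH zeta 0 SOL d M :
    ncg_call x M (Direction SOL d)
| CallCGNC d M of eg < enorm (grad F x)
    & capped_cg (hess F x) (grad F x) eH zeta 0 NC d M :
    ncg_call x M (Direction NC (nc_direction x d))
| CallOracleRunning b k of enorm (grad F x) <= eg
    & enorm b = 1 & lz_reached (hess F x) eH delta b k :
    ncg_call x k Running
| CallOracleNC b v M of enorm (grad F x) <= eg
    & enorm b = 1 & eig_oracle (hess F x) eH delta b (Some v) M :
    ncg_call x M (Direction NC
      (- (sgn (dotp v (grad F x)) * `|quad (hess F x) v|) *: v))
| CallOracleCert b M of enorm (grad F x) <= eg
    & enorm b = 1 & eig_oracle (hess F x) eH delta b None M :
    ncg_call x M Certified.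

Definition suff_decrease (x : 'cV[R]_n) (t : dtype) (d : 'cV[R]_n) (j : nat) :=
  match t with
  | SOL => F (x + theta ^+ j *: d)
             < F x - eta * eH * theta ^+ (2 * j) * enorm d ^+ 2
  | NC => F (x + theta ^+ j *: d)
             < F x - eta * theta ^+ (2 * j) * enorm d ^+ 3 / 2
  end.

Definition line_search (x : 'cV[R]_n) t d (j : nat) : Prop :=
  suff_decrease x t d j /\ forall i, (i < j)%N -> ~~ suff_decrease x t d i.

(* [newton_cg x N M o]: an execution from x, possibly interrupted, that has
   begun N iterations and made M products; o = Some y if it has terminated with
   output y, and o = None if it has been interrupted. Since interrupted
   executions are included, a bound on N valid for all executions also says
   that none of them goes on forever. *)
Inductive newton_cg : 'cV[R]_n -> nat -> nat -> option 'cV[R]_n -> Prop :=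
| NewtonInterrupt x M o of ncg_call x M o : newton_cg x 1 M None
| NewtonStop x M of ncg_call x M Certified : newton_cg x 1 M (Some x)
| NewtonStep x M t d j N' M' o of ncg_call x M (Direction t d)
    & line_search x t d j & newton_cg (x + theta ^+ j *: d) N' M' o :
    newton_cg x N'.+1 (M + M') o.

End NewtonCG.

Record al_params (R : realType) := ALParams {
  al_Lambda : R; al_rho0 : R; al_alpha : R; al_ratio : R; al_delta : R;
  al_theta : R; al_zeta : R; al_eta : R }.

Section AugmentedLagrangian.
Context {R : realType}.
Variables (n m : nat) (f : 'cV[R]_n -> R) (c : 'cV[R]_n -> 'cV[R]_m).
Variables (P : al_params R) (eps1 eps2 : R) (z : 'cV[R]_n).

Definition ctilde (x : 'cV[R]_n) : 'cV[R]_m := c x - c z.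

Definition auglag (lam : 'cV[R]_m) (rho : R) (x : 'cV[R]_n) : R :=
  f x + dotp lam (ctilde x) + rho * enorm (ctilde x) ^+ 2 / 2.

Definition tolerance (e : R) (k : nat) : R :=
  Num.max e (al_ratio P `^ (k%:R * ln e / ln 2)).

Definition x_init (x : 'cV[R]_n) (lam : 'cV[R]_m) (rho : R) : 'cV[R]_n :=
  if f z < auglag lam rho x then z else x.

Definition inner_run (k : nat) (x : 'cV[R]_n) (lam : 'cV[R]_m) (rho : R) :=
  newton_cg (auglag lam rho) (tolerance eps1 k) (tolerance eps2 k)
    (al_theta P) (al_zeta P) (al_eta P) (al_delta P) (x_init x lam rho).

Definition al_stop (k : nat) (x' : 'cV[R]_n) : bool :=
  [&& tolerance eps1 k <= eps1, tolerance eps2 k <= eps2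
    & enorm (c x') <= eps1].

Definition rho_next (k : nat) (x x' : 'cV[R]_n) (rho : R) : R :=
  if (k == 0%N) || (al_alpha P * enorm (ctilde x) < enorm (ctilde x'))
  then al_ratio P * rho else rho.

(* [al_run k x lam rho N M]: an execution, possibly interrupted, of the AL
   method from outer iteration k, with x^k = x, lambda^k = lam, rho_k = rho, in
   which the calls of the Newton-CG method begin N iterations and make M
   Hessian-vector products in total. *)
Inductive al_run (k : nat) (x : 'cV[R]_n) (lam : 'cV[R]_m) (rho : R) :
  nat -> nat -> Prop :=
| ALInterrupt N M of inner_run k x lam rho N M None :
    al_run k x lam rho N M
| ALStop N M x' of inner_run k x lam rho N M (Some x') & al_stop k x' :
    al_run k x lam rho N M
| ALStep N M x' lam' N' M' of inner_run k x lam rho N M (Some x')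
    & ~~ al_stop k x'
    & is_proj (eball (al_Lambda P)) (lam + rho *: ctilde x') lam'
    & al_run k.+1 x' lam' (rho_next k x x' rho) N' M' :
    al_run k x lam rho (N + N') (M + M').

End AugmentedLagrangian.

Section Complexity.
Context {R : realType}.
Variables (n m : nat) (f : 'cV[R]_n -> R) (c : 'cV[R]_n -> 'cV[R]_m).

Definition Sset (fhi df dc : R) : set 'cV[R]_n :=
  [set x | f x <= fhi + df /\ enorm (c x) <= 1 + dc].

(* K bounds the first and second derivatives of f and the c_i on S and the
   Lipschitz constants of their Hessians on Omega. *)
Definition derivative_bound (S Omega : set 'cV[R]_n) (K : R) : Prop :=
  [/\ 0 <= K,
      forall x, S x -> enorm (grad f x) <= K /\ snorm (hess f x) <= K,
      forall i x, S x -> enorm (grad (comp_fun c i) x) <= K /\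
                         snorm (hess (comp_fun c i) x) <= K,
      hess_lipschitz f Omega K
    & forall i, hess_lipschitz (comp_fun c i) Omega K].

(* Finite for the problems considered here. The constants hidden in the order
   notation will depend on f and c only through this number and m: were they
   allowed to depend on f in an unrestricted way, they could depend on n, and
   the factor min {n, .} in the bounds would be void. *)
Definition regularity_const (S Omega : set 'cV[R]_n) : R :=
  inf [set K | derivative_bound S Omega K].

End Complexity.

Section Orders.
Context {R : realType}.

Definition iter_bound (e1 e2 : R) : R :=
  Num.max (e1 ^- 2 * e2) (e2 ^- 3).

Definition mv_factor (n : nat) (e1 e2 : R) : R :=
  Num.min n%:R (e1^-1 * (Num.sqrt e2)^-1).

(* The logarithmic terms omitted by the soft order notation are bounded by a
   power of one of these. *)
Definition log_eps (e1 e2 : R) : R := 1 + ln e1^-1 + ln e2^-1.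
Definition log_eps_dim (n : nat) (e1 e2 : R) : R := log_eps e1 e2 + ln n%:R.

End Orders.

(* Main.v *)
(* Let L be a Lipschitz constant of the Hessian along the segments contained in
   the initial level set of a call of the Newton-CG method with tolerances
   eps_g and eps_H. Every iteration decreases the objective by a multiple of
   min (eps_g^2 / eps_H, eps_H^3) / L^2, except for unit SOL steps leading to
   a point with a small gradient. After such a step the oracle is called,
   which stops the method or yields a decrease, so the number of iterations is
   at most 2 plus twice the total decrease over this quantity. If the line
   search rejects a step size s, consider the first point of the ray at which
   the decrease condition fails: its step size is at most s and all points
   before it are in the level set, so Taylor's formula bounds s from below.

   The capped CG method stops within n iterations because the residuals are
   orthogonal, and within O (sqrt kappa log kappa) iterations because as long
   as it runs the residuals are squeezed between the thresholds of its second
   and fourth tests. The oracle is limited to a similar number by definition.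

   For the augmented Lagrangian with penalty parameter rho, the level sets lie
   in S, the total decrease is O (1), the Hessian is O (rho), and L is O (rho),
   or O (1) when c is affine. The method stops once the tolerances are final
   and rho exceeds a multiple of eps_1^(-2). Until then rho is multiplied by r
   at most O (log (1 / eps_1)) times, and O (log (1 / eps_1)) outer iterations
   separate two increases because each of them multiplies the infeasibility by
   at most alpha. *)
Require Import Defs.
From HB Require Import structures.
From mathcomp Require Import all_boot all_order all_algebra.
From mathcomp Require Import all_classical all_reals all_analysis.
From mathcomp Require Import ring lra.

Set Implicit Arguments.
Unset Strict Implicit.
Unset Printing Implicit Defensive.

Import Order.TTheory GRing.Theory Num.Theory.
Import numFieldNormedType.Exports.

Local Open Scope classical_set_scope.
Local Open Scope ring_scope.

(** * Euclidean and spectral norms *)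

Section EuclideanTheory.
Context {R : realType}.

(** The hidden constant is fixed before [n], [f] and [c], so every estimate is an explicit
    expression in the parameters, [m] and the regularity constant [K]. Compactness serves to show
    that [K] is a genuine derivative bound.

    Sublevel sets need not be convex, and an accepted unit step says nothing about the points
    between its ends. If the segment leaves the level set, the decrease condition fails at an
    intermediate step size, and the analysis of rejected steps applies to that one instead.

    Both tolerances of outer iteration k are the same power, with exponent in [0, 1], of [eps1] and
    [eps2]. The reciprocal of the final complexity thus bounds the decrease of the early calls too.

    As long as the tolerances are not final, a failure to stop gives no information on the
    infeasibility. There are boundedly many such iterations, and they are absorbed by enlarging both
    the allowed number of penalty increases and the allowed number of contractions.

    Two logarithms come from the product of these two numbers, a third from the length of a
    subroutine call. *)

Lemma dotpE n (u v : 'cV[R]_n) : dotp u v = (u^T *m v) 0 0.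
Proof. by rewrite mxE; apply: eq_bigr => i _; rewrite mxE. Qed.

Lemma dotpC n (u v : 'cV[R]_n) : dotp u v = dotp v u.
Proof. by apply: eq_bigr => i _; rewrite mulrC. Qed.

Lemma dotpDr n (u v w : 'cV[R]_n) : dotp u (v + w) = dotp u v + dotp u w.
Proof. by rewrite !dotpE mulmxDr mxE. Qed.

Lemma dotpZr n a (u v : 'cV[R]_n) : dotp u (a *: v) = a * dotp u v.
Proof. by rewrite !dotpE -scalemxAr mxE. Qed.

Lemma dotpDl n (u v w : 'cV[R]_n) : dotp (v + w) u = dotp v u + dotp w u.
Proof. by rewrite dotpC dotpDr !(dotpC u). Qed.

Lemma dotpZl n a (u v : 'cV[R]_n) : dotp (a *: u) v = a * dotp u v.
Proof. by rewrite dotpC dotpZr dotpC. Qed.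

Lemma dotpNr n (u v : 'cV[R]_n) : dotp u (- v) = - dotp u v.
Proof. by rewrite -scaleN1r dotpZr mulN1r. Qed.

Lemma dotpNl n (u v : 'cV[R]_n) : dotp (- u) v = - dotp u v.
Proof. by rewrite dotpC dotpNr dotpC. Qed.

Lemma dotp0r n (u : 'cV[R]_n) : dotp u 0 = 0.
Proof. by rewrite -(scale0r u) dotpZr mul0r. Qed.

Lemma dotp0l n (u : 'cV[R]_n) : dotp 0 u = 0.
Proof. by rewrite dotpC dotp0r. Qed.

Lemma dotp_mulmxr n m (A : 'M[R]_(m, n)) u v :
  dotp u (A *m v) = dotp (A^T *m u) v.
Proof. by rewrite !dotpE trmx_mul trmxK mulmxA. Qed.

Lemma dotp_ge0 n (u : 'cV[R]_n) : 0 <= dotp u u.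
Proof. by apply: sumr_ge0 => i _; rewrite -expr2 sqr_ge0. Qed.

Lemma enorm_ge0 n (u : 'cV[R]_n) : 0 <= enorm u.
Proof. exact: sqrtr_ge0. Qed.

Lemma enorm_sqr n (u : 'cV[R]_n) : enorm u ^+ 2 = dotp u u.
Proof. by rewrite sqr_sqrtr // dotp_ge0. Qed.

Lemma enorm_eq0 n (u : 'cV[R]_n) : (enorm u == 0) = (u == 0).
Proof.
apply/eqP/eqP => [u0|->]; last by rewrite /enorm dotp0r sqrtr0.
have /psumr_eq0P u00 : dotp u u = 0 by rewrite -enorm_sqr u0 expr0n.
apply/colP => i; rewrite mxE; apply/eqP.
by rewrite -sqrf_eq0 expr2 u00 // => j _; rewrite -expr2 sqr_ge0.
Qed.

Lemma enorm0 n : enorm (0 : 'cV[R]_n) = 0.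
Proof. by apply/eqP; rewrite enorm_eq0. Qed.

Lemma enorm_gt0 n (u : 'cV[R]_n) : (0 < enorm u) = (u != 0).
Proof. by rewrite lt_neqAle enorm_ge0 andbT eq_sym enorm_eq0. Qed.

Lemma enormZ n a (u : 'cV[R]_n) : enorm (a *: u) = `|a| * enorm u.
Proof.
by rewrite /enorm dotpZl dotpZr mulrA -expr2 sqrtrM ?sqr_ge0 // sqrtr_sqr.
Qed.

Lemma enormN n (u : 'cV[R]_n) : enorm (- u) = enorm u.
Proof. by rewrite -scaleN1r enormZ normrN1 mul1r. Qed.

Lemma cauchy_schwarz n (u v : 'cV[R]_n) : `|dotp u v| <= enorm u * enorm v.
Proof.
have [->|v0] := eqVneq v 0; first by rewrite dotp0r normr0 enorm0 mulr0.
rewrite -ler_sqr ?nnegrE ?mulr_ge0 ?enorm_ge0 // real_normK ?num_real //.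
have b0 : 0 < dotp v v by rewrite -enorm_sqr exprn_gt0 // enorm_gt0.
have := dotp_ge0 (dotp v v *: u - dotp u v *: v).
rewrite exprMn !enorm_sqr dotpDl !dotpDr !dotpNl !dotpNr !dotpZl !dotpZr.
rewrite (dotpC v u) -(pmulr_rge0 _ b0) => h.
rewrite -subr_ge0 -(pmulr_rge0 _ b0) -(pmulr_rge0 _ b0).
by apply: le_trans h _; rewrite le_eqVlt; apply/orP; left; apply/eqP; ring.
Qed.

Lemma dotp_le n (u v : 'cV[R]_n) : dotp u v <= enorm u * enorm v.
Proof. exact: le_trans (ler_norm _) (cauchy_schwarz u v). Qed.

Lemma enormD n (u v : 'cV[R]_n) : enorm (u + v) <= enorm u + enorm v.
Proof.
rewrite -ler_sqr ?nnegrE ?addr_ge0 ?enorm_ge0 // sqrrD !enorm_sqr.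
rewrite dotpDl !dotpDr (dotpC v u); have := dotp_le u v; lra.
Qed.

Lemma enormB n (u v : 'cV[R]_n) : enorm (u - v) <= enorm u + enorm v.
Proof. by rewrite -(enormN v) enormD. Qed.

Lemma enorm_sum n (I : Type) (s : seq I) (P : pred I) (F : I -> 'cV[R]_n) :
  enorm (\sum_(i <- s | P i) F i) <= \sum_(i <- s | P i) enorm (F i).
Proof.
elim/big_rec2: _ => [|i y x _ h]; first by rewrite enorm0.
by apply: le_trans (enormD _ _) _; rewrite lerD2l.
Qed.

Lemma dotp_delta n (u : 'cV[R]_n) i : dotp (delta_mx i 0) u = u i 0.
Proof.
rewrite /dotp (bigD1 i) //= mxE !eqxx mul1r big1 ?addr0 // => j ji.
by rewrite mxE (negPf ji) mul0r.
Qed.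

Lemma enorm_delta n i : enorm (delta_mx i 0 : 'cV[R]_n) = 1.
Proof. by rewrite /enorm dotp_delta mxE !eqxx sqrtr1. Qed.

Lemma coord_le_enorm n (u : 'cV[R]_n) i : `|u i 0| <= enorm u.
Proof.
by rewrite -dotp_delta (le_trans (cauchy_schwarz _ _)) // enorm_delta mul1r.
Qed.

Lemma col_sum_delta n (u : 'cV[R]_n) : u = \sum_i u i 0 *: delta_mx i 0.
Proof.
apply/colP => j; rewrite summxE (bigD1 j) //= !mxE !eqxx mulr1 big1 ?addr0 //.
by move=> i ij; rewrite !mxE eq_sym (negPf ij) mulr0.
Qed.

Lemma enorm_le_sum n (u : 'cV[R]_n) : enorm u <= \sum_i `|u i 0|.
Proof.
rewrite {1}(col_sum_delta u); apply: le_trans (enorm_sum _ _ _) _; apply: ler_sum => i _.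
by rewrite enormZ enorm_delta mulr1.
Qed.

(** A crude operator bound: it shows that the supremum defining [snorm] is over a bounded set, and
    later turns entrywise bounds on Hessians into spectral ones. *)
Definition row_sum n (A : 'M[R]_n) : R := \sum_i enorm (row i A)^T.

Lemma enorm_mulmx_row_sum n (A : 'M[R]_n) v :
  enorm (A *m v) <= row_sum A * enorm v.
Proof.
apply: le_trans (enorm_le_sum _) _; rewrite mulr_suml; apply: ler_sum => i _.
have -> : (A *m v) i 0 = dotp (row i A)^T v.
  by rewrite dotpE trmxK -row_mul [RHS]mxE.
exact: cauchy_schwarz.
Qed.

Lemma snorm_ub n (A : 'M[R]_n) v : enorm (A *m v) <= snorm A * enorm v.
Proof.
have [->|v0] := eqVneq v 0; first by rewrite mulmx0 enorm0 mulr0.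
have nv : 0 < enorm v by rewrite enorm_gt0.
have -> : v = enorm v *: ((enorm v)^-1 *: v) by rewrite scalerA divff ?scale1r // gt_eqF.
set w := _^-1 *: v.
have w1 : enorm w = 1 by rewrite enormZ ger0_norm ?invr_ge0 ?ltW // mulVf ?gt_eqF.
move: w w1 => w w1.
rewrite -scalemxAr !enormZ w1 mulr1 ger0_norm ?enorm_ge0 // mulrC.
rewrite ler_pM2r //; apply: ub_le_sup; last by exists w.
exists (row_sum A) => _ [u /= u1 <-].
by rewrite (le_trans (enorm_mulmx_row_sum _ _)) // u1 mulr1.
Qed.

(** For [n = 0] the unit sphere is empty and the supremum has its default value 0, while [M] could
    be negative. *)
Lemma snorm_le n (A : 'M[R]_n) M : (0 < n)%N ->
  (forall v, enorm (A *m v) <= M * enorm v) -> snorm A <= M.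
Proof.
case: n A => // n A _ h; apply: ge_sup.
  by exists (enorm (A *m delta_mx 0 0)); exists (delta_mx 0 0) => //=; exact: enorm_delta.
by move=> _ [v /= v1 <-]; rewrite (le_trans (h v)) // v1 mulr1.
Qed.

Lemma snorm_ge0 n (A : 'M[R]_n) : (0 < n)%N -> 0 <= snorm A.
Proof.
case: n A => // n A _; have := snorm_ub A (delta_mx 0 0).
by rewrite enorm_delta mulr1; apply: le_trans; exact: enorm_ge0.
Qed.

Lemma snormD n (A B : 'M[R]_n) : (0 < n)%N -> snorm (A + B) <= snorm A + snorm B.
Proof.
move=> n0; apply: snorm_le => // v; rewrite mulmxDl mulrDl.
by apply: le_trans (enormD _ _) _; apply: lerD; exact: snorm_ub.
Qed.

Lemma snorm0 n : (0 < n)%N -> snorm (0 : 'M[R]_n) = 0.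
Proof.
move=> n0; apply/eqP; rewrite eq_le snorm_ge0 // andbT.
by apply: snorm_le => // v; rewrite mul0mx mul0r enorm0.
Qed.

Lemma snorm_sum n (I : Type) (s : seq I) (P : pred I) (F : I -> 'M[R]_n) :
  (0 < n)%N ->
  snorm (\sum_(i <- s | P i) F i) <= \sum_(i <- s | P i) snorm (F i).
Proof.
move=> n0; elim/big_rec2: _ => [|i y x _ h]; first by rewrite snorm0.
by apply: le_trans (snormD _ _ _) _; rewrite // lerD2l.
Qed.

Lemma snormZ n a (A : 'M[R]_n) : (0 < n)%N -> snorm (a *: A) <= `|a| * snorm A.
Proof.
move=> n0; apply: snorm_le => // v; rewrite -scalemxAl enormZ -mulrA.
by apply: ler_wpM2l => //; exact: snorm_ub.
Qed.

Lemma snorm_outer n (u v : 'cV[R]_n) : (0 < n)%N ->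
  snorm (u *m v^T) <= enorm u * enorm v.
Proof.
move=> n0; apply: snorm_le => // w; rewrite -mulmxA.
have -> : v^T *m w = (dotp v w)%:M by rewrite [LHS]mx11_scalar -dotpE.
rewrite mul_mx_scalar enormZ mulrC -mulrA.
by apply: ler_wpM2l; [exact: enorm_ge0|exact: cauchy_schwarz].
Qed.

Lemma quadZ n (A : 'M[R]_n) a v : quad A (a *: v) = a ^+ 2 * quad A v.
Proof. by rewrite /quad -scalemxAr dotpZl dotpZr mulrA expr2. Qed.

Lemma quad_shift n (A : 'M[R]_n) a v :
  quad (A + a%:M) v = quad A v + a * enorm v ^+ 2.
Proof. by rewrite /quad mulmxDl dotpDr mul_scalar_mx dotpZr enorm_sqr. Qed.

(* The Gram matrix is invertible and factors through a space of dimension n. *)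
Lemma orthogonal_card n j (r : 'I_j -> 'cV[R]_n) :
  (forall i, r i != 0) -> (forall i k, i != k -> dotp (r i) (r k) = 0) ->
  (j <= n)%N.
Proof.
move=> r0 ro; pose Rm : 'M[R]_(n, j) := \matrix_(a, i) r i a 0.
have GE : Rm^T *m Rm = diag_mx (\row_i dotp (r i) (r i)).
  apply/matrixP => i k; rewrite !mxE.
  transitivity (dotp (r i) (r k)); first by apply: eq_bigr => a _; rewrite !mxE.
  by have [->|/ro ->] := eqVneq i k; rewrite ?mulr1n ?mulr0n.
have : Rm^T *m Rm \in unitmx.
  rewrite GE unitmxE det_diag unitfE; apply/prodf_neq0 => i _.
  by rewrite mxE -enorm_sqr sqrf_eq0 enorm_eq0.
rewrite -row_free_unit => /eqP <-.
exact: leq_trans (mxrankM_maxr _ _) (rank_leq_row _).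
Qed.

End EuclideanTheory.

(** * The conjugate gradient method *)

Section ConjugateGradient.
Context {R : realType} (n : nat) (H : 'M[R]_n) (g : 'cV[R]_n) (eps : R).
Hypothesis Hsym : H^T = H.

Let Hb := H + (2 * eps)%:M.
Let y := cg_y H g eps.
Let r := cg_r H g eps.
Let p := cg_p H g eps.
Let a j := dotp (r j) (r j) / quad Hb (p j).

Let Hb_sym u v : dotp u (Hb *m v) = dotp v (Hb *m u).
Proof. by rewrite dotp_mulmxr linearD /= Hsym tr_scalar_mx dotpC. Qed.

Let yS j : y j.+1 = y j + a j *: p j.
Proof. by rewrite /y /a /r /p /cg_y /cg_r /cg_p /=; case: cg_yrp => [[? ?] ?]. Qed.

Let rS j : r j.+1 = r j + a j *: (Hb *m p j).
Proof. by rewrite /a /r /p /cg_r /cg_p /=; case: cg_yrp => [[? ?] ?]. Qed.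

Let pS j : p j.+1 = - r j.+1 + (enorm (r j.+1) ^+ 2 / enorm (r j) ^+ 2) *: p j.
Proof. by rewrite /r /p /cg_r /cg_p /=; case: cg_yrp => [[? ?] ?]. Qed.

Lemma cg_residual j : r j = Hb *m y j + g.
Proof.
elim: j => [|j IH]; first by rewrite /r /y /cg_r /cg_y /= mulmx0 add0r.
by rewrite rS yS mulmxDr -scalemxAr IH addrAC.
Qed.

Section Orthogonality.
Variable j : nat.
Hypothesis r_neq0 : forall i, (i < j)%N -> r i != 0.
Hypothesis p_curv : forall i, (i < j)%N -> quad Hb (p i) != 0.

Let rr_neq0 i : (i < j)%N -> dotp (r i) (r i) != 0.
Proof. by move=> /r_neq0; rewrite -enorm_sqr sqrf_eq0 enorm_eq0. Qed.

Let a_neq0 i : (i < j)%N -> a i != 0.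
Proof. by move=> ij; rewrite mulf_neq0 ?rr_neq0 // invr_neq0 ?p_curv. Qed.

Let Hp i : (i < j)%N -> Hb *m p i = (a i)^-1 *: (r i.+1 - r i).
Proof. by move=> ij; rewrite rS addrAC subrr add0r scalerA mulVf ?scale1r ?a_neq0. Qed.

(** One induction carries all relations: conjugacy makes the new residual orthogonal to the [p i],
    each earlier residual is a combination of the [p i], and [Hb *m p i] is a multiple of
    [r i.+1 - r i], which gives conjugacy back. [Hb] may be indefinite. *)
Lemma cg_orthogonal k : (k <= j)%N ->
  dotp (r k) (p k) = - dotp (r k) (r k) /\
  forall i, (i < k)%N ->
    [/\ dotp (r k) (p i) = 0, dotp (p k) (Hb *m p i) = 0
      & dotp (r k) (r i) = 0].
Proof.
elim: k => [_|k IH kj].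
  by split=> //; rewrite /p /r /cg_p /cg_r /= dotpNr.
have [rp orth] := IH (ltnW kj).
have rp0 i : (i < k.+1)%N -> dotp (r k.+1) (p i) = 0.
  rewrite ltnS leq_eqVlt rS dotpDl dotpZl => /orP[/eqP ->|ik].
    rewrite rp (dotpC (Hb *m _)) -/(quad Hb (p k)) /a divfK ?p_curv //.
    by rewrite addrC subrr.
  have [-> pp0 _] := orth i ik.
  by rewrite dotpC Hb_sym pp0 mulr0 addr0.
have rr0 i : (i < k.+1)%N -> dotp (r k.+1) (r i) = 0.
  case: i => [|i] ik.
    have -> : r 0 = - p 0%N by rewrite /r /p /cg_r /cg_p /= opprK.
    by rewrite dotpNr rp0 ?oppr0.
  have -> : r i.+1 = (enorm (r i.+1) ^+ 2 / enorm (r i) ^+ 2) *: p i - p i.+1.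
    by rewrite (pS i) opprD opprK addrCA subrr addr0.
  by rewrite dotpDr dotpNr dotpZr !rp0 ?mulr0 ?subrr // ltnW.
split=> [|i ik].
  by rewrite pS dotpDr dotpNr dotpZr rp0 // mulr0 addr0.
have kj' : (k < j)%N by [].
split; [exact: rp0| |exact: rr0].
rewrite pS dotpDl dotpNl dotpZl; move: ik; rewrite ltnS leq_eqVlt => /orP[/eqP ->|ik].
  rewrite {1}Hp // dotpZr dotpDr dotpNr (rr0 k) // subr0 -/(quad Hb (p k)).
  rewrite !enorm_sqr /a.
  by have := rr_neq0 kj'; have := p_curv kj' => ? ?; field; apply/andP.
have [_ -> _] := orth i ik.
rewrite Hp ?(ltn_trans ik) // dotpZr dotpDr dotpNr !rr0 ?(ltn_trans ik) //.
by rewrite !(subr0, mulr0, oppr0, addr0).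
Qed.

(** [y j] is a combination of the earlier [p i], to which [r j] is orthogonal. For a SOL direction
    this turns the residual equation into an exact value of the slope [dotp g d]. *)
Lemma cg_iterate_orthogonal : dotp (y j) (r j) = 0.
Proof.
have [_ orth] := cg_orthogonal (leqnn j).
suff : forall k, (k <= j)%N -> dotp (y k) (r j) = 0 by apply.
elim=> [_|k IH kj]; first by rewrite /y /cg_y /= dotp0l.
rewrite yS dotpDl dotpZl IH ?(ltnW kj) // dotpC.
by case: (orth k kj) => -> _ _; rewrite mulr0 addr0.
Qed.

Lemma cg_index_le_dim : (j <= n)%N.
Proof.
apply: (@orthogonal_card _ _ _ (fun i : 'I_j => r i)) => [i|i k].
  exact: r_neq0.
wlog ik : i k / (i < k)%N.
  move=> h ik; have := ik; rewrite neq_ltn => /orP[lt|lt]; first exact: h.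
  by rewrite dotpC; apply: h => //; rewrite eq_sym.
by move=> _; rewrite dotpC; case: (cg_orthogonal (ltnW (ltn_ord k))) => _ /(_ i ik) [].
Qed.

End Orthogonality.

End ConjugateGradient.

(** * Properties of the directions returned by the capped CG method *)

Section CappedCGTheory.
Context {R : realType} (n : nat) (H : 'M[R]_n) (g : 'cV[R]_n) (eps zeta : R).
Hypotheses (Hsym : H^T = H) (eps_gt0 : 0 < eps) (zeta01 : 0 < zeta < 1).
Hypothesis (g_neq0 : g != 0).

Let n_gt0 : (0 < n)%N.
Proof.
by case: n g g_neq0 => // v /eqP[]; apply/colP => -[].
Qed.

Lemma update_U_ge (U : R) v : U <= update_U H U v.
Proof.
rewrite /update_U; case: ifP => // lt.
have [v0|v0] := eqVneq v 0; first by rewrite v0 mulmx0 enorm0 mulr0 ltxx in lt.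
by rewrite ler_pdivlMr ?enorm_gt0 // ltW.
Qed.

Lemma update_U_bound (U : R) v : enorm (H *m v) <= update_U H U v * enorm v.
Proof.
rewrite /update_U; case: ltP => // lt.
have [v0|v0] := eqVneq v 0; first by rewrite v0 mulmx0 enorm0 mulr0.
by rewrite divfK // enorm_eq0.
Qed.

Lemma update_U_le (U : R) v : U <= snorm H -> update_U H U v <= snorm H.
Proof.
rewrite /update_U; case: ifP => // lt _.
have [v0|v0] := eqVneq v 0; first by rewrite v0 mulmx0 enorm0 mulr0 ltxx in lt.
by rewrite ler_pdivrMr ?enorm_gt0 // snorm_ub.
Qed.

Lemma cg_U_ge0 j : 0 <= cg_U H g eps 0 j.
Proof.
elim: j => [|j IH] /=; first exact: update_U_ge.
by do 3! apply: le_trans (update_U_ge _ _).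
Qed.

Lemma cg_U_le j : cg_U H g eps 0 j <= snorm H.
Proof.
elim: j => [|j IH] /=; first by apply: update_U_le; exact: snorm_ge0.
by do 3! apply: update_U_le.
Qed.

Lemma cg_U_bound j : (0 < j)%N ->
  enorm (H *m cg_y H g eps j) <= cg_U H g eps 0 j * enorm (cg_y H g eps j).
Proof.
case: j => // j _.
apply: le_trans (update_U_bound (update_U H (cg_U H g eps 0 j) (cg_p H g eps j.+1)) _) _.
by apply: ler_wpM2r; [exact: enorm_ge0|exact: update_U_ge].
Qed.

Lemma kappa_ge2 (U : R) : 0 <= U -> 2 <= kappa eps U.
Proof.
by move=> U0; rewrite /kappa ler_pdivlMr // lerDr.
Qed.

Lemma zetahat_gt0 (U : R) : 0 <= U -> 0 < zetahat eps zeta U.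
Proof.
move=> /kappa_ge2 k2; case/andP: zeta01 => z0 _.
by rewrite divr_gt0 // mulr_gt0 // (lt_le_trans _ k2).
Qed.

(** A zero residual would pass the SOL test and end the loop. *)
Lemma running_neq0 j : cg_running H g eps zeta 0 j ->
  forall i, (i < j)%N -> cg_r H g eps i != 0.
Proof.
move=> run [_|i ij]; first exact: g_neq0.
apply/negP => /eqP r0.
have := run _ ij; rewrite !negb_or => /and4P[_ + _ _].
rewrite /test_sol /= r0 enorm0 mulr_ge0 ?enorm_ge0 // ltW // zetahat_gt0 //.
by rewrite (le_trans (cg_U_ge0 i)) //; do 3! apply: le_trans (update_U_ge _ _).
Qed.

(** The failed test along [p i] gives positive curvature only if [p i] is nonzero. This follows from
    the product of [r i] and [p i] being minus the square of the norm of [r i], a relation that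
    needs the earlier curvatures: hence the strong induction. *)
Lemma running_curvature j : cg_running H g eps zeta 0 j ->
  forall i, (i < j)%N -> quad (H + (2 * eps)%:M) (cg_p H g eps i) != 0.
Proof.
move=> run i; have [m] := ubnP i; elim: m i => // m IH i im ij.
have := run _ ij; rewrite !negb_or => /and4P[_ _ + _].
rewrite /test_p /low_curv -leNgt => h.
suff p0 : cg_p H g eps i != 0.
  by rewrite gt_eqF // (lt_le_trans _ h) // mulr_gt0 // exprn_gt0 // enorm_gt0.
have rn k : (k < i)%N -> cg_r H g eps k != 0.
  by move=> ki; apply: (running_neq0 run); exact: ltn_trans ij.
have pn k : (k < i)%N -> quad (H + (2 * eps)%:M) (cg_p H g eps k) != 0.
  by move=> ki; by apply: IH; [rewrite -ltnS (leq_trans _ im)|exact: ltn_trans ij].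
have [rp _] := cg_orthogonal Hsym rn pn (leqnn i).
apply: contraTneq (running_neq0 run ij) => p0; move: rp; rewrite p0 dotp0r.
by move=> /esym/eqP; rewrite oppr_eq0 -enorm_sqr sqrf_eq0 enorm_eq0 => ->.
Qed.

Lemma running_le_dim j : cg_running H g eps zeta 0 j -> (j <= n)%N.
Proof.
move=> run.
exact: (cg_index_le_dim Hsym (running_neq0 run) (running_curvature run)).
Qed.

Lemma capped_cg_NC d M : capped_cg H g eps zeta 0 NC d M ->
  quad H d < - eps * enorm d ^+ 2.
Proof.
have lc v : low_curv H eps v -> quad H v < - eps * enorm v ^+ 2.
  by rewrite /low_curv quad_shift; lra.
move E: NC => t h; case: h E => //.
- by move=> j _ /andP[_ /lc].
- by move=> j _ _ _ /lc.
- by move=> j i _ _ _ _ _ _ /lc.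
Qed.

(** The SOL test measures the residual against [g], the descent analysis needs it against [d]. Since
    [g] is the residual minus [Hbar *m d], its norm is at most that of the residual plus
    [(U + 2 * eps) * enorm d]. With [zetahat * (U + 2 * eps) = zeta * eps / 3] and
    [zetahat <= 1 / 6], the residual is at most 6/5 of [zeta * eps / 3 * enorm d]. *)
Lemma capped_cg_SOL d M : capped_cg H g eps zeta 0 SOL d M ->
  [/\ eps * enorm d ^+ 2 <= quad (H + (2 * eps)%:M) d,
      dotp g d = - quad (H + (2 * eps)%:M) d, d != 0
    & enorm ((H + (2 * eps)%:M) *m d + g) <= eps * zeta / 2 * enorm d].
Proof.
move E: SOL => t h; case: h E => // j run ty ts _.
have /andP[j0 rs] := ts.
have rE := cg_residual H g eps j.
have yr := cg_iterate_orthogonal Hsym (running_neq0 run) (running_curvature run).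
move: ty; rewrite /test_y j0 /low_curv /= -leNgt => curv.
set yj := cg_y H g eps j in rE yr curv *.
set rj := cg_r H g eps j in rE yr rs *.
set U := cg_U H g eps 0 j in rs.
have U0 : 0 <= U := cg_U_ge0 j.
have k2 := kappa_ge2 U0.
have UE : U + 2 * eps = kappa eps U * eps by rewrite /kappa divfK ?gt_eqF.
have HbY : enorm ((H + (2 * eps)%:M) *m yj) <= (U + 2 * eps) * enorm yj.
  rewrite mulmxDl mul_scalar_mx; apply: le_trans (enormD _ _) _.
  rewrite (mulrDl U) enormZ gtr0_norm ?mulr_gt0 // lerD2r.
  exact: cg_U_bound.
have r0E : cg_r H g eps 0%N = g by [].
rewrite r0E in rs.
have gle : enorm g <= enorm rj + (U + 2 * eps) * enorm yj.
  have {1}-> : g = rj - (H + (2 * eps)%:M) *m yj by rewrite rE addrAC subrr add0r.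
  by apply: le_trans (enormB _ _) _; rewrite lerD2l.
case/andP: zeta01 => z0 z1.
have zk : zetahat eps zeta U * (U + 2 * eps) = zeta * eps / 3.
  by rewrite UE /zetahat; field; rewrite gt_eqF // (lt_le_trans _ k2).
have zh0 := zetahat_gt0 U0.
have zh : zetahat eps zeta U <= 1 / 6.
  rewrite /zetahat ler_pdivrMr; last by rewrite mulr_gt0 // (lt_le_trans _ k2).
  lra.
have yj0 : 0 <= enorm yj := enorm_ge0 _.
have rb : enorm rj <= eps * zeta / 2 * enorm yj.
  have h1 : enorm rj <= zetahat eps zeta U * enorm rj + zeta * eps / 3 * enorm yj.
    apply: le_trans rs _; rewrite -zk -mulrA -mulrDr.
    by apply: ler_wpM2l; [exact: ltW|].
  have h2 : zetahat eps zeta U * enorm rj <= 1 / 6 * enorm rj.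
    by apply: ler_wpM2r => //; exact: enorm_ge0.
  have h3 : enorm rj <= 6 / 5 * (zeta * eps / 3 * enorm yj) by lra.
  have : 0 <= zeta * eps * enorm yj by rewrite !mulr_ge0 ?(ltW z0) ?(ltW eps_gt0).
  by move: h3; rewrite !mulrA (mulrC eps); lra.
split => //.
- move: yr; rewrite rE dotpDr -/(quad _ _) (dotpC yj g) => /eqP.
  by rewrite addr_eq0 => /eqP ->; rewrite opprK.
- apply/eqP => y0; move: gle; rewrite y0 enorm0 mulr0 addr0 => gle.
  have : 0 < enorm g by rewrite enorm_gt0.
  have : zetahat eps zeta U * enorm g <= 1 / 6 * enorm g.
    by apply: ler_wpM2r => //; exact: enorm_ge0.
  lra.
- by rewrite -rE.
Qed.

End CappedCGTheory.

(** * Number of iterations of the capped CG method *)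

Section CappedCGIterations.
Context {R : realType}.

(** With [s] the square root of [k], tau is [1 - 1 / (s + 1)], and [1 / (s + 1) >= 1 / (2 * k)]. The
    square root at least halves the gap to 1, which is thus at least [1 / (4 * k)]. *)
Lemma sqrt_cg_T_le (eps U : R) : 0 < eps -> 0 <= U ->
  Num.sqrt (cg_T eps U) <= 8 * kappa eps U ^+ 3.
Proof.
move=> e0 U0; have k2 := kappa_ge2 e0 U0; rewrite /cg_T /cg_tau.
move: (kappa eps U) k2 => k k2.
have k0 : 0 < k by lra.
set s := Num.sqrt k; have s0 : 0 < s by rewrite sqrtr_gt0.
have s2 : s ^+ 2 = k by rewrite sqr_sqrtr // ltW.
set q := Num.sqrt (s / _); have q0 : 0 <= q by exact: sqrtr_ge0.
have q2 : q ^+ 2 = 1 - 1 / (s + 1).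
  rewrite sqr_sqrtr; last by rewrite divr_ge0 //; lra.
  by field; rewrite gt_eqF //; lra.
have i0 : 0 < 1 / (s + 1) by rewrite divr_gt0 //; lra.
have q1 : q < 1 by nra.
have sk : s + 1 <= 2 * k by nra.
have i4 : 1 / (2 * k) <= 1 / (s + 1).
  by rewrite !div1r lef_pV2 ?posrE; lra.
have q4 : 1 / (4 * k) <= 1 - q.
  have -> : 1 / (4 * k) = 1 / (2 * k) / 2 by field; rewrite gt_eqF.
  nra.
have p0 : 0 < 1 / (4 * k) by rewrite divr_gt0 //; lra.
rewrite -[X in _ <= X]ger0_norm; last by rewrite mulr_ge0 // exprn_ge0 // ltW.
rewrite -sqrtr_sqr ler_sqrt; last exact: sqr_ge0.
rewrite ler_pdivrMr; last by rewrite exprn_gt0; lra.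
have -> : 4 * k ^+ 4 = (8 * k ^+ 3) ^+ 2 * (1 / (4 * k)) ^+ 2 by field; rewrite gt_eqF.
apply: ler_wpM2l; first exact: sqr_ge0.
by rewrite ler_sqr ?nnegrE //; [exact: ltW|lra].
Qed.

(** From tau being [1 - 1 / (s + 1)], by concavity of the logarithm. *)
Lemma cg_tau_powR_le (eps U x : R) : 0 < eps -> 0 <= U -> 0 <= x ->
  cg_tau eps U `^ x <= expR (- (x / (Num.sqrt (kappa eps U) + 1))).
Proof.
move=> e0 U0 x0; have k2 := kappa_ge2 e0 U0; rewrite /cg_tau.
move: (kappa eps U) k2 => k k2.
have s0 : 0 < Num.sqrt k by rewrite sqrtr_gt0; lra.
move: (Num.sqrt k) s0 => s s0.
have t0 : 0 < s / (s + 1) by rewrite divr_gt0 //; lra.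
rewrite /powR gt_eqF // ler_expR -mulrN; apply: ler_wpM2l => //.
have -> : s / (s + 1) = 1 + - (s + 1)^-1 by field; rewrite gt_eqF //; lra.
apply: le_ln1Dx; rewrite ltrN2 invf_lt1; lra.
Qed.

Lemma running_index_le (n : nat) (H : 'M[R]_n) (g : 'cV[R]_n) (eps zeta Km : R) j :
  0 < eps -> 0 < zeta < 1 -> g != 0 -> kappa eps (snorm H) <= Km ->
  cg_running H g eps zeta 0 j ->
  j%:R <= 2 + 2 * (Num.sqrt Km + 1) * ln (24 * Km ^+ 4 / zeta).
Proof.
move=> e0 z01 g0 kK run.
have n0 : (0 < n)%N by case: n g g0 {H kK run} => // v /eqP[]; apply/colP => -[].
have := kappa_ge2 e0 (snorm_ge0 H n0) => k2.
have K2 : 2 <= Km by exact: le_trans kK.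
case/andP: (z01) => z0 z1.
have lnK : 0 <= ln (24 * Km ^+ 4 / zeta).
  rewrite ln_ge0 // ler_pdivlMr // mul1r.
  have : 1 <= Km ^+ 4 by rewrite exprn_ege1 //; lra.
  lra.
have sK0 : 0 <= Num.sqrt Km := sqrtr_ge0 _.
have RHS : 0 <= 2 * (Num.sqrt Km + 1) * ln (24 * Km ^+ 4 / zeta).
  by rewrite !mulr_ge0 //; lra.
case: j run => [|[|i]] run; [lra|lra|].
(* At the last tested index the SOL test and the slow-decay test both failed, so [zetahat] is below
   the slow-decay threshold. Taking logarithms bounds the index; 24 is the 8 of [sqrt_cg_T_le] times
   the 3 in [zetahat]. *)
have := run i.+1 (ltnSn _); rewrite !negb_or => /and4P[_ h1 _ h2].
rewrite /test_sol ltn0Sn andTb -ltNge in h1.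
rewrite /test_slow ltn0Sn andTb -leNgt in h2.
move: h1 h2.
set U := cg_U H g eps 0 i.+1 => h1 h2.
have U0 : 0 <= U by exact: cg_U_ge0.
have UH := cg_U_le H eps g0 i.+1; rewrite -/U in UH.
have kU : kappa eps U <= Km.
  apply: le_trans kK; rewrite /kappa ler_pM2r ?invr_gt0 //; lra.
have kU2 := kappa_ge2 e0 U0.
have g00 : 0 < enorm (cg_r H g eps 0) by rewrite enorm_gt0.
have {h1 h2} := lt_le_trans h1 h2; rewrite ltr_pM2r // => h.
have x0 : 0 <= i.+1%:R / 2 :> R by rewrite divr_ge0.
have h3 : zetahat eps zeta U <
    8 * kappa eps U ^+ 3 * expR (- (i.+1%:R / 2 / (Num.sqrt (kappa eps U) + 1))).
  apply: lt_le_trans h _; apply: ler_pM; rewrite ?sqrtr_ge0 ?powR_ge0 //.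
    exact: sqrt_cg_T_le.
  exact: cg_tau_powR_le.
have ss0 : 0 < Num.sqrt (kappa eps U) + 1 by rewrite ltr_wpDl // sqrtr_ge0.
have sle : Num.sqrt (kappa eps U) <= Num.sqrt Km by rewrite ler_sqrt //; lra.
move: h3 kU kU2 ss0 sle; rewrite /zetahat; move: (kappa eps U) => k h3 kK' k2' ss0 sle.
have k0 : 0 < k by lra.
move: (Num.sqrt k) ss0 sle h3 => s ss0 sle.
rewrite expRN; set x := i.+1%:R / 2 / (s + 1).
have E0 := expR_gt0 x => h3.
have h4 : zeta * expR x < 24 * k ^+ 4.
  have -> : zeta * expR x = zeta / (3 * k) * (3 * k * expR x) by field; rewrite gt_eqF.
  have -> : 24 * k ^+ 4 = 8 * k ^+ 3 * (expR x)^-1 * (3 * k * expR x).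
    by field; rewrite gt_eqF.
  by rewrite ltr_pM2r // !mulr_gt0.
have kK4 : k ^+ 4 <= Km ^+ 4 by rewrite lerXn2r ?nnegrE //; lra.
have xle : x <= ln (24 * Km ^+ 4 / zeta).
  rewrite -[x]expRK ler_ln ?posrE //; last first.
    by rewrite divr_gt0 // mulr_gt0 // exprn_gt0; lra.
  by rewrite ler_pdivlMr // mulrC; lra.
have xE : i.+1%:R = 2 * ((s + 1) * x) by rewrite /x; field; rewrite gt_eqF.
have h5 : (s + 1) * x <= (Num.sqrt Km + 1) * ln (24 * Km ^+ 4 / zeta).
  by apply: ler_pM => //; [exact: ltW|rewrite /x !divr_ge0 // ltW|lra].
rewrite -[i.+2]addn1 natrD xE; lra.
Qed.


End CappedCGIterations.

(** * Functions of one variable *)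

Section OneVariable.
Context {R : realType}.
Implicit Types phi h P : R -> R.

Lemma is_derive_continuous phi (phi1 : R -> R) :
  (forall t : R, is_derive t 1 phi (phi1 t)) -> continuous phi.
Proof.
move=> d t; apply: differentiable_continuous; apply/derivable1_diffP.
exact: ex_derive.
Qed.

Lemma is_derive_monomial (k : R) n (t : R) :
  is_derive t 1 (fun u : R => k * u ^+ n) (k * (n%:R * t ^+ n.-1)).
Proof.
have h : is_derive t 1 (k *: (fun u : R => u ^+ n))
                       (k *: ('D_1 (fun u : R => u ^+ n) t)).
  by apply: is_deriveZ; apply: derivableP; exact: exprn_derivable.
apply: is_derive_eq; rewrite exp_derive.
by rewrite /GRing.scale /= mulr1.
Qed.

Lemma is_derive_add phi h (phi1 h1 l t : R) :
  is_derive t 1 phi phi1 -> is_derive t 1 h h1 -> phi1 + h1 = l ->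
  is_derive t 1 (fun u => phi u + h u) l.
Proof. by move=> d1 d2 <-; exact: is_deriveD. Qed.

(** The mean value theorem for [phi - P]. The derivatives are compared on the open interval, because
    a ray is controlled only before its first crossing. *)
Lemma increment_le phi phi1 P P1 (s : R) :
  (forall t : R, is_derive t 1 phi (phi1 t)) ->
  (forall t : R, is_derive t 1 P (P1 t)) -> 0 < s ->
  (forall t : R, 0 < t < s -> phi1 t <= P1 t) ->
  phi s - phi 0 <= P s - P 0.
Proof.
move=> dphi dP s0 le.
have d (t : R) : is_derive t 1 (phi - P) (phi1 t - P1 t).
  exact: is_deriveB.
have := @MVT R (phi - P) (fun t => phi1 t - P1 t) 0 s s0 (fun t _ => d t).
case=> [|c]; first exact/continuous_subspaceT/(is_derive_continuous d).
rewrite in_itv /= => cs; rewrite subr0 => e.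
have : (phi1 c - P1 c) * s <= 0.
  by rewrite pmulr_lle0 // subr_le0 le.
rewrite -e.
have -> : (phi - P) s = phi s - P s by [].
have -> : (phi - P) 0 = phi 0 - P 0 by [].
lra.
Qed.

Lemma mean_value phi phi1 (s : R) :
  (forall t : R, is_derive t 1 phi (phi1 t)) -> 0 < s ->
  exists2 t, 0 < t < s & phi s - phi 0 = phi1 t * s.
Proof.
move=> d s0; have [|c] := @MVT R phi phi1 0 s s0 (fun t _ => d t).
  exact/continuous_subspaceT/(is_derive_continuous d).
by rewrite in_itv /= subr0 => cs e; exists c.
Qed.

Lemma taylor2 phi phi1 (s a M : R) :
  (forall t : R, is_derive t 1 phi (phi1 t)) -> 0 < s ->
  (forall t : R, 0 < t < s -> phi1 t <= a + M * t) ->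
  phi s <= phi 0 + a * s + M * s ^+ 2 / 2.
Proof.
move=> d s0 le.
have dP (t : R) : is_derive t 1 (fun t : R => a * t + M / 2 * t ^+ 2) (a + M * t).
  apply: is_derive_add (is_derive_monomial a 1 t) (is_derive_monomial _ 2 t) _.
  by rewrite /=; field.
have := increment_le d dP s0 le.
by rewrite !mulr0 expr0n !mulr0; lra.
Qed.

Lemma taylor3 phi phi1 phi2 (s M : R) :
  (forall t : R, is_derive t 1 phi (phi1 t)) ->
  (forall t : R, is_derive t 1 phi1 (phi2 t)) -> 0 < s ->
  (forall t : R, 0 < t < s -> phi2 t <= phi2 0 + M * t) ->
  phi s <= phi 0 + phi1 0 * s + phi2 0 * s ^+ 2 / 2 + M * s ^+ 3 / 6.
Proof.
move=> d1 d2 s0 le.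
have dP (t : R) : is_derive t 1
    (fun t : R => phi1 0 * t + phi2 0 / 2 * t ^+ 2 + M / 6 * t ^+ 3)
    (phi1 0 + phi2 0 * t + M * t ^+ 2 / 2).
  have dQ := is_derive_add (is_derive_monomial (phi1 0) 1 t)
                           (is_derive_monomial (phi2 0 / 2) 2 t) erefl.
  apply: (is_derive_add dQ (is_derive_monomial (M / 6) 3 t)).
  by rewrite /=; field.
have le1 t : 0 < t < s -> phi1 t <= phi1 0 + phi2 0 * t + M * t ^+ 2 / 2.
  case/andP=> t0 ts; apply: (taylor2 d2 t0) => u /andP[u0 ut].
  by apply: le; rewrite u0 (lt_trans ut).
have := increment_le d1 dP s0 le1.
by rewrite !expr0n !mulr0; lra.
Qed.

Lemma derive_lt0_right h (l : R) : is_derive (0 : R) 1 h l -> l < 0 ->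
  exists2 a : R, 0 < a & forall t : R, 0 < t < a -> h t < h 0.
Proof.
move=> d l0.
have dl : (fun t : R => t^-1 *: (h (t *: 1 + 0) - h 0)) @ 0^' --> l.
  by rewrite -(@derive_val _ _ _ _ _ _ _ d); apply: (@ex_derive _ _ _ _ _ _ _ d).
have : \forall t \near (0 : R)^', t^-1 *: (h (t *: 1 + 0) - h 0) < 0.
  exact: (cvgr_lt _ dl _ l0).
rewrite near_withinE => /nbhs_ballP[a /= a0 ha]; exists a => // t /andP[t0 ta].
have := ha t; rewrite /ball /= sub0r normrN gtr0_norm // => /(_ ta).
rewrite gt_eqF // => /(_ isT).
rewrite addr0 [t *: 1]mulr1 /GRing.scale /= pmulr_rlt0 ?invr_gt0 //.
by rewrite subr_lt0.
Qed.

(** The first alternative serves SOL directions; the second serves NC directions, whose slope may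
    vanish. *)
Lemma descent_right phi phi1 phi2 (q : R) :
  (forall t : R, is_derive t 1 phi (phi1 t)) ->
  (forall t : R, is_derive t 1 phi1 (phi2 t)) ->
  phi1 0 < 0 \/ phi1 0 <= 0 /\ phi2 0 + 2 * q < 0 ->
  exists2 a : R, 0 < a & forall t : R, 0 < t < a -> phi t + q * t ^+ 2 < phi 0.
Proof.
move=> d1 d2.
have dq (t : R) : is_derive t 1 (fun t : R => phi t + q * t ^+ 2) (phi1 t + 2 * q * t).
  by apply: is_derive_add (is_derive_monomial q 2 t) _; rewrite /=; ring.
case=> [lt0|[le0 lt0]].
  have [] := @derive_lt0_right (fun t : R => phi t + q * t ^+ 2) _ (dq 0).
    by rewrite mulr0 addr0.
  by rewrite /= expr0n mulr0 addr0 => a a0 h; exists a.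
have dq1 (t : R) : is_derive t 1 (fun t : R => phi1 t + 2 * q * t) (phi2 t + 2 * q).
  by apply: is_derive_add (is_derive_monomial (2 * q) 1 t) _; rewrite /=; ring.
have [a a0 h] := derive_lt0_right (dq1 0) lt0.
exists a => // t /andP[t0 ta].
have [c /andP[c0 ct]] := mean_value dq t0.
rewrite expr0n mulr0 addr0 => e; rewrite -subr_lt0 e pmulr_llt0 //.
apply: lt_le_trans (h c _) _; first by rewrite c0 (lt_trans ct).
by rewrite mulr0 addr0.
Qed.

(** [s] is the infimum of the positive points where the decrease fails. The initial descent keeps it
    away from 0, and continuity makes the decrease fail at [s] itself. *)
Lemma first_crossing phi (q s1 : R) : continuous phi ->
  (exists2 a : R, 0 < a & forall t : R, 0 < t < a -> phi t + q * t ^+ 2 < phi 0) ->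
  0 < s1 -> phi 0 <= phi s1 + q * s1 ^+ 2 ->
  exists2 s, 0 < s <= s1 & phi 0 <= phi s + q * s ^+ 2 /\
    forall t : R, 0 < t < s -> phi t + q * t ^+ 2 < phi 0.
Proof.
move=> cphi [a a0 ha] s10 h1.
pose psi t := phi t + q * t ^+ 2.
pose A := [set t | 0 < t /\ phi 0 <= psi t].
have As1 : A s1 by [].
have lbA : lbound A a.
  move=> t [t0 ht]; rewrite leNgt; apply/negP => ta.
  by have := ha t; rewrite t0 ta => /(_ isT); rewrite ltNge -/(psi t) ht.
have hA : has_inf A by split; [exists s1|exists a].
have sa : a <= inf A by apply: lb_le_inf => //; exists s1.
have below t : 0 < t < inf A -> psi t < phi 0.
  case/andP=> t0 tA; rewrite ltNge; apply/negP => h.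
  by move: tA; rewrite ltNge => /negP; apply; apply: ge_inf => //; exists a.
exists (inf A).
  by rewrite (lt_le_trans a0 sa) /=; apply: ge_inf => //; exists a.
split=> //; rewrite leNgt; apply/negP => lt.
have cpsi : continuous psi.
  move=> t; apply: cvgD; first exact: cphi.
  by apply: cvgM; [exact: cvg_cst|exact: exprn_continuous].
have : \forall t \near inf A, psi t < phi 0 by exact: (cvgr_lt _ (cpsi (inf A)) _ lt).
move=> /nbhs_ballP[e /= e0 he].
have [t [t0 ht] te] := inf_adherent e0 hA.
have : psi t < phi 0.
  apply: he; rewrite /ball /= distrC ger0_norm ?subr_ge0 ?ltrBlDl //.
  by apply: ge_inf => //; exists a.
by rewrite ltNge ht.
Qed.

End OneVariable.

(** * Gradients and Hessians *)

Lemma half_distance_absurd {R : realType} (a b y y' : R) : y = y' ->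
  `|a - y| < `|b - a| / 2 -> `|b - y'| < `|b - a| / 2 -> False.
Proof.
by move=> <- h1 h2; have := ler_distD y b a; rewrite (distrC y a); lra.
Qed.

Section Gradients.
Context {R : realType} (n : nat).
Implicit Types (F G : 'cV[R]_n -> R) (x d u : 'cV[R]_n).

Lemma derive_grad F x d : differentiable F x -> 'D_d F x = dotp (grad F x) d.
Proof.
move=> dF; rewrite deriveE //.
rewrite {1}(col_sum_delta d) linear_sum /=; apply: eq_bigr => i _.
by rewrite linearZ /= mxE deriveE // mulrC.
Qed.

Lemma is_derive_line F x d : (forall y, differentiable F y) -> forall t : R,
  is_derive t 1 (fun s : R => F (x + s *: d)) (dotp (grad F (x + t *: d)) d).
Proof.
move=> dF t; have dd : derivable F (x + t *: d) d by exact: diff_derivable.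
have e : (fun h : R => h^-1 *: (F (x + (h *: 1 + t) *: d) - F (x + t *: d))) =
         (fun h : R => h^-1 *: (F (h *: d + (x + t *: d)) - F (x + t *: d))).
  by apply/funext => h; rewrite [h *: 1]mulr1 scalerDl addrCA.
apply: DeriveDef; first by rewrite /derivable /= e.
by rewrite -derive_grad // /derive /= e.
Qed.

Lemma hess_grad F x i j : hess F x i j = grad (fun y => grad F y i 0) x j 0.
Proof. by rewrite !mxE. Qed.

Lemma gradD F G x : differentiable F x -> differentiable G x ->
  grad (fun y => F y + G y) x = grad F x + grad G x.
Proof. by move=> dF dG; apply/colP => i; rewrite !mxE deriveD //; exact: diff_derivable. Qed.

Lemma gradM F G x : differentiable F x -> differentiable G x ->
  grad (fun y => F y * G y) x = F x *: grad G x + G x *: grad F x.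
Proof. by move=> dF dG; apply/colP => i; rewrite !mxE deriveM //; exact: diff_derivable. Qed.

Lemma grad_cst (k : R) x : grad (fun=> k) x = 0.
Proof. by apply/colP => i; rewrite !mxE derive_cst. Qed.

Lemma gradZ k F x : differentiable F x ->
  grad (fun y => k * F y) x = k *: grad F x.
Proof.
move=> dF; rewrite (gradM (differentiable_cst k x) dF) grad_cst scaler0 addr0 //.
Qed.

Lemma grad_sum m (F : 'I_m -> 'cV[R]_n -> R) x :
  (forall i, differentiable (F i) x) ->
  grad (fun y => \sum_i F i y) x = \sum_i grad (F i) x.
Proof.
move=> dF; apply/colP => j; rewrite summxE mxE.
have -> : (fun y => \sum_i F i y) = \sum_i F i by apply/funext => y; rewrite fct_sumE.
rewrite derive_sum; last by move=> i; exact: diff_derivable.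
by apply: eq_bigr => i _; rewrite mxE.
Qed.

Lemma differentiable_fsum m (F : 'I_m -> 'cV[R]_n -> R) x :
  (forall i, differentiable (F i) x) ->
  differentiable (fun y => \sum_i F i y) x.
Proof.
move=> dF.
have -> : (fun y => \sum_i F i y) = \sum_i F i by apply/funext => y; rewrite fct_sumE.
exact: differentiable_sum.
Qed.

(* Working form of being twice differentiable: the Hessian need not be
   continuous, but it must be symmetric. *)
Definition twice_diff F := [/\ forall x, differentiable F x,
  forall i x, differentiable (fun y => grad F y i 0) x
  & forall x, (hess F x)^T = hess F x].

(** Pairing with the fixed vector [u] gives a scalar function [G] whose gradient is the transposed
    Hessian applied to [u], so the rule for scalar functions on a line applies. *)
Lemma is_derive_grad_line F x d u : twice_diff F -> forall t : R,
  is_derive t 1 (fun s : R => dotp u (grad F (x + s *: d)))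
                (dotp u (hess F (x + t *: d) *m d)).
Proof.
case=> _ dG _ t.
pose G y := \sum_i u i 0 * grad F y i 0.
have dGi i y : differentiable (fun y => u i 0 * grad F y i 0) y.
  by apply: differentiableM; [exact: differentiable_cst|exact: dG].
have dG' y : differentiable G y by exact: differentiable_fsum.
apply: is_derive_eq (is_derive_line x d dG' t) _.
rewrite grad_sum // dotp_mulmxr; congr (dotp _ d); apply/colP => j.
rewrite summxE [RHS]mxE; apply: eq_bigr => i _.
rewrite gradZ; last exact: dG.
by rewrite [LHS]mxE -hess_grad [X in _ = X * _]mxE mulrC.
Qed.

Lemma is_derive_curv_line F x d : twice_diff F -> forall t : R,
  is_derive t 1 (fun s : R => dotp (grad F (x + s *: d)) d)
                (quad (hess F (x + t *: d)) d).
Proof.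
move=> tF t; rewrite (_ : (fun s => _) = (fun s => dotp d (grad F (x + s *: d)))).
  exact: is_derive_grad_line.
by apply/funext => s; rewrite dotpC.
Qed.

Lemma differentiable_grad_coord F i x : differentiable (grad F) x ->
  differentiable (fun y => grad F y i 0) x.
Proof.
move=> dG; have := differentiable_comp dG (differentiable_coord (grad F x) i 0).
by [].
Qed.

(** * Symmetry of the Hessian *)

Section Schwarz.
Variables (F : 'cV[R]_n -> R).
Hypothesis FC2 : C2 F.

Let dF x : differentiable F x. Proof. by case: FC2. Qed.
Let dG i x : differentiable (fun y => grad F y i 0) x.
Proof. by apply: differentiable_grad_coord; case: FC2. Qed.

(** The mean value theorem is used along [u] for the increment in direction [v], then along [v] for
    the partial derivative in direction [u]. *)
Let second_difference x (i j : 'I_n) (s : R) : 0 < s ->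
  exists a b : R, [/\ 0 < a < s, 0 < b < s &
    F (x + s *: delta_mx i 0 + s *: delta_mx j 0) - F (x + s *: delta_mx i 0)
    - F (x + s *: delta_mx j 0) + F x
    = s ^+ 2 * hess F (x + a *: delta_mx i 0 + b *: delta_mx j 0) i j].
Proof.
move=> s0; set u := delta_mx i 0 : 'cV[R]_n; set v := delta_mx j 0 : 'cV[R]_n.
have d1 (t : R) : is_derive t 1 (fun t : R => F (x + s *: v + t *: u) + - F (x + t *: u))
    (dotp (grad F (x + s *: v + t *: u)) u - dotp (grad F (x + t *: u)) u).
  by apply: is_deriveB; exact: is_derive_line.
have [a as_ e1] := mean_value d1 s0.
have d2 (t : R) : is_derive t 1 (fun t : R => grad F (x + a *: u + t *: v) i 0)
    (dotp (grad (fun y => grad F y i 0) (x + a *: u + t *: v)) v).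
  by apply: (@is_derive_line (fun y => grad F y i 0)).
have [b bs e2] := mean_value d2 s0.
exists a, b; split=> //.
rewrite !scale0r !addr0 in e1 e2.
have dd y : dotp (grad F y) u = grad F y i 0 by rewrite dotpC dotp_delta.
rewrite !dd in e1.
rewrite [dotp _ v]dotpC dotp_delta -hess_grad in e2.
rewrite (addrAC x (s *: v) (a *: u)) e2 in e1.
rewrite expr2 -mulrA (mulrC s (hess _ _ _ _)) (mulrC s) -e1.
rewrite (addrAC x (s *: u)); ring.
Qed.

(** The second difference over a square does not depend on the order of its sides, so an entry and
    its transpose take a common value at two points arbitrarily close to [x]; continuity concludes.
    The orthogonality relations of CG rest on this symmetry. *)
Lemma hess_sym x : (hess F x)^T = hess F x.
Proof.
apply/matrixP => i j; rewrite mxE; apply/eqP/negP => /negP ne.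
pose e := `|hess F x j i - hess F x i j| / 2.
have e0 : 0 < e by rewrite divr_gt0 // normr_gt0 subr_eq0.
have nearby k l : exists2 r : R, 0 < r &
    forall y, `|x - y| < r -> `|hess F x k l - hess F y k l| < e.
  have cH : continuous (fun y => hess F y k l).
    move=> y; apply: (@continuous_comp _ _ _ (hess F) (fun M : 'M[R]_n => M k l)).
      by case: FC2 => _ _; apply.
    exact: coord_continuous.
  have : \forall y \near x, `|hess F x k l - hess F y k l| < e.
    by have /cvgrPdist_lt /(_ e e0) := cH x.
  by move=> /nbhs_normP[r /= r0 hr]; exists r => // y; exact: hr.
have [r1 r10 h1] := nearby i j; have [r2 r20 h2] := nearby j i.
set u := delta_mx i 0 : 'cV[R]_n; set v := delta_mx j 0 : 'cV[R]_n.
(* [q] exceeds the sum of the norms of the two directions, so offsets below [s] stay within both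
   radii of continuity. *)
pose q := 1 + `|u| + `|v|.
have q0 : 0 < q by have := normr_ge0 u; have := normr_ge0 v; rewrite /q; lra.
pose s := Num.min r1 r2 / (2 * q).
have s0 : 0 < s by rewrite divr_gt0 ?mulr_gt0 // lt_min r10.
have sq : s * q < Num.min r1 r2.
  have -> : s * q = Num.min r1 r2 / 2 by rewrite /s; field; rewrite gt_eqF.
  by have : 0 < Num.min r1 r2 by [rewrite lt_min r10|]; lra.
have small a b : 0 < a < s -> 0 < b < s ->
    `|a *: u + b *: v| < Num.min r1 r2.
  case/andP=> a0 a1 /andP[b0 b1]; apply: le_lt_trans sq.
  apply: le_trans (ler_normD _ _) _; rewrite !normrZ !gtr0_norm // /q !mulrDr.
  rewrite mulr1; have : a * `|u| <= s * `|u| by rewrite ler_wpM2r // ltW.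
  have : b * `|v| <= s * `|v| by rewrite ler_wpM2r // ltW.
  lra.
have [a [b [ha hb eq1]]] := second_difference x i j s0.
have [a' [b' [ha' hb' eq2]]] := second_difference x j i s0.
have eqH : hess F (x + a *: u + b *: v) i j = hess F (x + a' *: v + b' *: u) j i.
  apply: (@mulfI _ (s ^+ 2)); first by rewrite expf_neq0 // gt_eqF.
  rewrite -eq1 -eq2 (addrAC x (s *: v)).
  by move: (F _) (F _) (F _) (F _) => y1 y2 y3 y4; ring.
have H1 : `|hess F x i j - hess F (x + a *: u + b *: v) i j| < e.
  apply: h1; rewrite -addrA opprD addrA subrr add0r normrN.
  by apply: lt_le_trans (small _ _ ha hb) _; rewrite ge_min lexx.
have H2 : `|hess F x j i - hess F (x + a' *: v + b' *: u) j i| < e.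
  apply: h2; rewrite -addrA opprD addrA subrr add0r normrN addrC.
  by apply: lt_le_trans (small _ _ hb' ha') _; rewrite ge_min lexx orbT.
exact: (half_distance_absurd eqH H1 H2).
Qed.

Lemma C2_twice_diff : twice_diff F.
Proof. by split; [exact: dF|exact: dG|exact: hess_sym]. Qed.

End Schwarz.

End Gradients.

(** * The Newton-CG method *)

Section NewtonDescent.
Context {R : realType} (n : nat) (F : 'cV[R]_n -> R).
Variables (eg eH theta zeta eta delta : R) (F0 L : R).
Hypotheses (n_gt0 : (0 < n)%N) (F_diff : twice_diff F).
Hypotheses (eg_gt0 : 0 < eg) (eH_gt0 : 0 < eH).
Hypotheses (theta01 : 0 < theta < 1) (zeta01 : 0 < zeta < 1) (eta01 : 0 < eta < 1).
Hypothesis L_ge1 : 1 <= L.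
Hypothesis hess_segment : forall x d,
  (forall u : R, 0 <= u <= 1 -> F (x + u *: d) <= F0) ->
  snorm (hess F (x + d) - hess F x) <= L * enorm d.

(** Used with [u = w = d] for the curvature along a ray, and with [w] the new gradient to bound that
    gradient after a unit step. *)
Lemma bilinear_segment x d u w (t : R) : 0 < t ->
  (forall s : R, 0 <= s <= t -> F (x + s *: d) <= F0) ->
  dotp w (hess F (x + t *: d) *m u) <=
    dotp w (hess F x *m u) + L * enorm d * enorm u * enorm w * t.
Proof.
move=> t0 seg; rewrite -lerBlDl -dotpNr -dotpDr -mulmxBl.
apply: le_trans (dotp_le _ _) _.
have h : snorm (hess F (x + t *: d) - hess F x) <= L * (t * enorm d).
  rewrite -{2}(gtr0_norm t0) -enormZ; apply: hess_segment => s /andP[s0 s1].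
  by rewrite scalerA; apply: seg; rewrite mulr_ge0 ?(ltW t0) //= ler_piMl // ltW.
have -> : L * enorm d * enorm u * enorm w * t
        = enorm w * (L * (t * enorm d) * enorm u) by ring.
apply: ler_wpM2l; first exact: enorm_ge0.
by apply: le_trans (snorm_ub _ _) _; apply: ler_wpM2r => //; exact: enorm_ge0.
Qed.

(** Both line-search conditions have the form [F (x + s *: d) < F x - q * s ^+ 2], with a [q]
    depending on the type. The crossing point [s] may be smaller than [s1], but a lower bound for
    [s] is one for [s1]. *)
Lemma rejected_step x d (q s1 : R) : F x <= F0 -> 0 <= q -> 0 < s1 ->
  dotp (grad F x) d < 0 \/
    dotp (grad F x) d <= 0 /\ quad (hess F x) d + 2 * q < 0 ->
  F x - q * s1 ^+ 2 <= F (x + s1 *: d) ->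
  exists2 s : R, 0 < s <= s1 &
    - (q * s ^+ 2) <= dotp (grad F x) d * s + quad (hess F x) d * s ^+ 2 / 2
                      + L * enorm d ^+ 3 * s ^+ 3 / 6.
Proof.
move=> xF0 q0 s10 desc rej; have dF : forall y, differentiable F y by case: F_diff.
have d1 := is_derive_line x d dF; have d2 := is_derive_curv_line x d F_diff.
have x0 : x + 0 *: d = x by rewrite scale0r addr0.
have := descent_right d1 d2 (q := q); rewrite !x0 => /(_ desc) near0.
have := first_crossing (is_derive_continuous d1) (s1 := s1) (q := q).
rewrite x0 => /(_ near0 s10); rewrite -lerBlDr => /(_ rej) [s ss1 [hs below]].
exists s => //; case/andP: ss1 => s0 ss1.
have := taylor3 (M := L * enorm d ^+ 3) d1 d2 s0; rewrite !x0 => T.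
have {}T := T _; move: hs; rewrite -lerBlDr => hs.
suff /T : forall t : R, 0 < t < s -> quad (hess F (x + t *: d)) d <=
    quad (hess F x) d + L * enorm d ^+ 3 * t by lra.
move=> t /andP[t0 ts].
have -> : L * enorm d ^+ 3 * t = L * enorm d * enorm d * enorm d * t by ring.
apply: bilinear_segment => // u /andP[u0 ut].
move: u0; rewrite le_eqVlt => /predU1P[<-|u0]; first by rewrite x0.
have := below u; rewrite u0 (le_lt_trans ut ts) => /(_ isT) h.
apply: le_trans xF0; apply: le_trans (ltW h).
by rewrite lerDl mulr_ge0 // sqr_ge0.
Qed.

Lemma line_search_rejected x t d j : line_search F eH theta eta x t d j.+1 ->
  ~~ suff_decrease F eH theta eta x t d j.
Proof. by case=> _; apply. Qed.

Lemma line_search_decrease x t d j : line_search F eH theta eta x t d j ->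
  F (x + theta ^+ j *: d) <= F x.
Proof.
case/andP: eta01 => e0 _; case/andP: theta01 => t0 _.
case=> + _; case: t => /= h; apply: ltW (lt_le_trans h _); rewrite gerBl.
  by rewrite !mulr_ge0 ?exprn_ge0 ?enorm_ge0 // ltW.
by rewrite divr_ge0 // !mulr_ge0 ?exprn_ge0 ?enorm_ge0 // ltW.
Qed.

(** [theta ^+ 2] compares an accepted step with the rejected trial before it, and [(1 - eta) ^+ 2]
    comes from the least size [3 * (1 - eta) / L] of a rejected NC step. The 16 is dictated by a
    unit NC step of length [eH / 2], which gains [eta / 2 * (eH / 2) ^+ 3]. *)
Definition decrease_const : R := eta * theta ^+ 2 * (1 - eta) ^+ 2 / 16.

Definition decrease : R :=
  decrease_const / L ^+ 2 * Num.min (eg ^+ 2 / eH) (eH ^+ 3).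

Lemma decrease_const_gt0 : 0 < decrease_const.
Proof.
case/andP: eta01 => e0 e1; case/andP: theta01 => t0 _.
by rewrite /decrease_const !mulr_gt0 ?exprn_gt0 // subr_gt0.
Qed.

Lemma decrease_const_le : decrease_const <= eta * theta ^+ 2 * (1 - eta) ^+ 2 * 9 / 16 /\
  16 * decrease_const <= eta * theta ^+ 2.
Proof.
case/andP: eta01 => e0 e1; case/andP: theta01 => t0 _.
have h : 0 < eta * theta ^+ 2 by rewrite mulr_gt0 ?exprn_gt0.
have h2 : (1 - eta) ^+ 2 <= 1 by rewrite expr_le1 //; lra.
rewrite /decrease_const; move: h2 (sqr_ge0 (1 - eta)).
by move: ((1 - eta) ^+ 2) (eta * theta ^+ 2) h => a b b0 a1 a0; split; nra.
Qed.

Lemma L2_ge1 : 1 <= L ^+ 2. Proof. by rewrite exprn_ege1. Qed.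

Lemma decrease_scaled_gt0 : 0 < decrease_const / L ^+ 2.
Proof. by apply: divr_gt0; [exact: decrease_const_gt0|exact: lt_le_trans L2_ge1]. Qed.

Lemma decrease_scaled_le : decrease_const / L ^+ 2 <= eta / 16.
Proof.
case/andP: eta01 => e0 _; case/andP: theta01 => t0 t1.
have : eta * theta ^+ 2 <= eta by rewrite ler_piMr ?(ltW e0) // expr_le1 // ltW.
rewrite ler_pdivrMr ?(lt_le_trans _ L2_ge1) //; case: decrease_const_le => _.
by move: L2_ge1 (theta ^+ 2) => L2_ge1' t2 c1 c2; have := ler_peMr (ltW e0) L2_ge1'; lra.
Qed.

Lemma decrease_gt0 : 0 < decrease.
Proof.
apply: mulr_gt0; first exact: decrease_scaled_gt0.
by rewrite lt_min divr_gt0 ?exprn_gt0.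
Qed.

Lemma decrease_le_cube (y : R) :
  decrease_const / L ^+ 2 * eH ^+ 3 <= y -> decrease <= y.
Proof.
apply: le_trans; apply: ler_wpM2l; last by rewrite ge_min lexx orbT.
exact: ltW decrease_scaled_gt0.
Qed.

Lemma decrease_le_grad (y : R) :
  decrease_const * (eg ^+ 2 / eH) <= y -> decrease <= y.
Proof.
apply: le_trans; apply: ler_pM.
- exact: ltW decrease_scaled_gt0.
- by rewrite le_min !divr_ge0 ?exprn_ge0 // ltW.
- rewrite ler_pdivrMr ?exprn_gt0 ?(lt_le_trans _ L_ge1) //.
  by rewrite ler_peMr ?(ltW decrease_const_gt0) // exprn_ege1.
- by rewrite ge_min lexx.
Qed.

Lemma NC_decrease x d j : F x <= F0 -> eH / 2 <= enorm d ->
  quad (hess F x) d = - enorm d ^+ 3 -> dotp (grad F x) d <= 0 ->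
  line_search F eH theta eta x NC d j ->
  F (x + theta ^+ j *: d) <= F x - decrease.
Proof.
case/andP: eta01 => e0 e1; case/andP: theta01 => t0 t1.
move=> xF0 dge Qd gd ls; have [/= acc _] := ls.
apply: le_trans (ltW acc) _; rewrite lerB // {acc}; apply: decrease_le_cube.
have N0 : 0 < enorm d by apply: lt_le_trans dge; rewrite divr_gt0.
have d3 : eH ^+ 3 / 8 <= enorm d ^+ 3.
  have -> : eH ^+ 3 / 8 = (eH / 2) ^+ 3 by field.
  by rewrite lerXn2r ?nnegrE ?divr_ge0 ?(ltW eH_gt0) ?(ltW N0).
set N := enorm d in dge d3 N0 *.
have N3 : 0 < N ^+ 3 by rewrite exprn_gt0.
case: j ls => [|j] ls.
  rewrite muln0 expr0 mulr1.
  apply: (@le_trans _ _ (decrease_const / L ^+ 2 * (8 * N ^+ 3))).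
    by rewrite (ler_pM2l decrease_scaled_gt0); lra.
  by have := ler_wpM2r (ltW N3) decrease_scaled_le; move: (_ / _) => k; lra.
have s10 : 0 < theta ^+ j by rewrite exprn_gt0.
have := line_search_rejected ls; rewrite /= -leNgt mulnC exprM => rej.
have -> : theta ^+ (2 * j.+1) = theta ^+ 2 * (theta ^+ j) ^+ 2.
  by rewrite mulnC exprM -exprMn -exprS.
move: (theta ^+ j) s10 rej {ls} => s1 s10 rej.
have [|||s /andP[s0 ss1] key] := @rejected_step x d (eta * N ^+ 3 / 2) _ xF0 _ s10.
- by rewrite divr_ge0 // mulr_ge0 ?ltW.
- right; split=> //; rewrite Qd -/N.
  have -> : - N ^+ 3 + 2 * (eta * N ^+ 3 / 2) = - ((1 - eta) * N ^+ 3) by field.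
  by rewrite oppr_lt0 mulr_gt0 // subr_gt0.
- apply: le_trans rej; rewrite -/N lerB // le_eqVlt; apply/orP; left; apply/eqP; ring.
rewrite Qd -/N in key; clear rej.
(* The curvature and the cubic term both scale with [N ^+ 3]; after division by [N ^+ 3 * s ^+ 2]
   the bound on [s] no longer involves the length of [d]. *)
have {}key : 3 * (1 - eta) <= L * s.
  have : dotp (grad F x) d * s <= 0 by rewrite pmulr_lle0.
  move=> gs; have : 0 <= N ^+ 3 * s ^+ 2 * (L * s - 3 * (1 - eta)).
    by move: key; move: (dotp (grad F x) d * s) gs => gs gs0; nra.
  by rewrite pmulr_rge0 ?subr_ge0 // mulr_gt0 // exprn_gt0.
have key2 : 3 * (1 - eta) <= L * s1.
  apply: le_trans key _; rewrite ler_wpM2l //; exact: le_trans L_ge1.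
have key3 : 9 * (1 - eta) ^+ 2 <= L ^+ 2 * (s1) ^+ 2.
  have -> : 9 * (1 - eta) ^+ 2 = (3 * (1 - eta)) ^+ 2 by ring.
  by rewrite -exprMn lerXn2r ?nnegrE //; [lra|rewrite mulr_ge0 ?(ltW s10) // (le_trans _ L_ge1)].
have key4 : (1 - eta) ^+ 2 * 9 / L ^+ 2 <= s1 ^+ 2.
  by rewrite ler_pdivrMr ?(lt_le_trans _ L2_ge1) //; lra.
rewrite /decrease_const.
have -> : eta * theta ^+ 2 * (1 - eta) ^+ 2 / 16 / L ^+ 2 * eH ^+ 3
  = (eta * theta ^+ 2 / 18) * ((1 - eta) ^+ 2 * 9 / L ^+ 2 * (eH ^+ 3 / 8)).
  by field; rewrite gt_eqF // (lt_le_trans _ L_ge1).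
have -> : eta * (theta ^+ 2 * s1 ^+ 2) * N ^+ 3 / 2
  = (eta * theta ^+ 2 / 2) * (s1 ^+ 2 * N ^+ 3) by ring.
apply: ler_pM.
- by rewrite divr_ge0 // mulr_ge0 ?exprn_ge0 // ltW.
- apply: mulr_ge0; apply: divr_ge0 => //; last by rewrite exprn_ge0 // ltW.
    by apply: mulr_ge0 => //; exact: sqr_ge0.
  exact: sqr_ge0.
- have : 0 <= eta * theta ^+ 2 by rewrite mulr_ge0 ?exprn_ge0 // ltW.
  lra.
- apply: ler_pM => //; last by rewrite divr_ge0 // exprn_ge0 // ltW.
  by apply: divr_ge0; [apply: mulr_ge0 => //; exact: sqr_ge0|exact: sqr_ge0].
Qed.

(** Let Q be the shifted curvature, at least [eH * N ^+ 2]. For [s <= 1] the slope -Q outweighs the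
    part [Q * s ^+ 2 / 2] of the quadratic term, and the shift by [2 * eH] pays for the [eta] term.
    What remains is [eH * N ^+ 2 * s / 2 <= L * N ^+ 3 * s ^+ 3 / 6]. As [s1 <= 1], the conclusion
    also says that [d] is long. *)
Lemma SOL_far x (d : 'cV[R]_n) : F x <= F0 -> d != 0 ->
  eH * enorm d ^+ 2 <= quad (hess F x + (2 * eH)%:M) d ->
  dotp (grad F x) d = - quad (hess F x + (2 * eH)%:M) d ->
  forall s1 : R, 0 < s1 <= 1 ->
  F x - eta * eH * enorm d ^+ 2 * s1 ^+ 2 <= F (x + s1 *: d) ->
  3 * eH <= L * enorm d * s1 ^+ 2.
Proof.
case/andP: eta01 => e0 e1 xF0 d0 curv gd s1 /andP[s10 s11] rej.
have N0 : 0 < enorm d by rewrite enorm_gt0.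
have N2 : 0 < enorm d ^+ 2 by rewrite exprn_gt0.
have eN : 0 < eH * enorm d ^+ 2 by rewrite mulr_gt0.
have [|||s /andP[s0 ss1] key] := @rejected_step x d (eta * eH * enorm d ^+ 2) _ xF0 _ s10.
- by rewrite -mulrA mulr_ge0 // ltW.
- by left; rewrite gd oppr_lt0; exact: lt_le_trans curv.
- exact: rej.
apply: (@le_trans _ _ (L * enorm d * s ^+ 2)); last first.
  apply: ler_wpM2l; first by rewrite mulr_ge0 ?(ltW N0) // (le_trans _ L_ge1).
  by rewrite lerXn2r ?nnegrE // ltW.
clear rej; move: key curv; rewrite gd quad_shift.
move: (quad _ _) (enorm d) N0 N2 eN => q N N0 N2 eN key curv.
have s1' : s <= 1 by exact: le_trans s11.
have Q0 : 0 <= (q + 2 * eH * N ^+ 2 - eH * N ^+ 2) * (s * (1 - s / 2)).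
  by apply: mulr_ge0; [lra|apply: mulr_ge0; lra].
have h1 : 0 <= (1 - eta) * (eH * N ^+ 2 * s ^+ 2).
  by rewrite !mulr_ge0 ?exprn_ge0 ?(ltW eH_gt0) ?(ltW N0) ?(ltW s0) // subr_ge0 ltW.
have : 0 <= N ^+ 2 * s * (L * N * s ^+ 2 - 3 * eH).
  have h2 : 0 <= eH * N ^+ 2 * (s * (1 - s / 2) - s / 2).
    by rewrite mulr_ge0 ?(ltW eN) //; nra.
  have -> : N ^+ 2 * s * (L * N * s ^+ 2 - 3 * eH) =
    6 * (L * N ^+ 3 * s ^+ 3 / 6) - 3 * (eH * N ^+ 2 * s) by field.
  move: h1 h2 Q0 key.
  have -> : (1 - eta) * (eH * N ^+ 2 * s ^+ 2) =
    eH * N ^+ 2 * s ^+ 2 - eta * eH * N ^+ 2 * s ^+ 2 by ring.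
  have -> : eH * N ^+ 2 * (s * (1 - s / 2) - s / 2) =
    eH * N ^+ 2 * s / 2 - eH * N ^+ 2 * s ^+ 2 / 2 by field.
  have -> : (q + 2 * eH * N ^+ 2 - eH * N ^+ 2) * (s * (1 - s / 2)) =
    q * s - q * s ^+ 2 / 2 + eH * N ^+ 2 * s - eH * N ^+ 2 * s ^+ 2 / 2 by field.
  have -> : - (q + 2 * eH * N ^+ 2) * s = - (q * s) - 2 * (eH * N ^+ 2 * s) by ring.
  lra.
by rewrite pmulr_rge0 ?subr_ge0 // mulr_gt0.
Qed.

(** Pairing with the new gradient [w] reduces the vector Taylor formula to a scalar one. The linear
    model of the gradient is the CG residual minus [2 * eH *: d], whence [5 / 2 = 2 + 1 / 2], using
    [zeta < 1]. *)
Lemma SOL_gradient x d :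
  (forall u : R, 0 <= u <= 1 -> F (x + u *: d) <= F0) ->
  enorm ((hess F x + (2 * eH)%:M) *m d + grad F x) <= eH * zeta / 2 * enorm d ->
  enorm (grad F (x + d)) <= L * enorm d ^+ 2 / 2 + 5 / 2 * eH * enorm d.
Proof.
case/andP: zeta01 => z0 z1 seg res.
set w := grad F (x + d).
have [->|w0] := eqVneq w 0.
  rewrite enorm0; have D0 := enorm_ge0 d; have L0 : 0 <= L by exact: le_trans L_ge1.
  apply: addr_ge0; last by rewrite !mulr_ge0 ?(ltW eH_gt0) // invr_ge0.
  by rewrite divr_ge0 // mulr_ge0 ?exprn_ge0.
have W0 : 0 < enorm w by rewrite enorm_gt0.
have T := @taylor2 R _ _ 1 (dotp w (hess F x *m d)) (L * enorm d * enorm d * enorm w)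
  (is_derive_grad_line x d w F_diff) ltr01.
have {T} : enorm w ^+ 2 <= dotp w (grad F x) + dotp w (hess F x *m d)
    + L * enorm d * enorm d * enorm w / 2.
  rewrite enorm_sqr {2}/w.
  move: T; rewrite scale1r scale0r addr0 expr1n !mulr1; apply.
  move=> t /andP[t0 t1]; apply: bilinear_segment => // s /andP[s0 st].
  by apply: seg; rewrite s0 (le_trans st) // ltW.
have -> : dotp w (grad F x) + dotp w (hess F x *m d) =
    dotp w ((hess F x + (2 * eH)%:M) *m d + grad F x) - 2 * eH * dotp w d.
  by rewrite mulmxDl mul_scalar_mx !dotpDr dotpZr; ring.
have h1 := dotp_le w ((hess F x + (2 * eH)%:M) *m d + grad F x).
have h2 : enorm w * enorm ((hess F x + (2 * eH)%:M) *m d + grad F x)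
    <= enorm w * (eH * zeta / 2 * enorm d) by rewrite ler_pM2l.
have h3 : - (enorm w * enorm d) <= dotp w d by have /ler_normlP[] := cauchy_schwarz w d; lra.
have h4 : 2 * eH * - (enorm w * enorm d) <= 2 * eH * dotp w d by rewrite ler_pM2l // mulr_gt0.
have h5 : zeta * (eH * enorm w * enorm d) <= eH * enorm w * enorm d.
  by rewrite ler_piMl ?(ltW z1) // !mulr_ge0 ?enorm_ge0 // ltW.
move=> h; rewrite -(ler_pM2l W0) -expr2; apply: le_trans h _.
move: h1 h2 h4 h5; move: (dotp w (_ + _)) (dotp w d) (enorm (_ + _)) (enorm d) (enorm w) => a b r D W.
have -> : W * (L * D ^+ 2 / 2 + 5 / 2 * eH * D) =
   L * D * D * W / 2 + 5 / 2 * (eH * W * D) by ring.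
have -> : W * (eH * zeta / 2 * D) = zeta * (eH * W * D) / 2 by ring.
have -> : 2 * eH * - (W * D) = - 2 * (eH * W * D) by ring.
lra.
Qed.

Lemma decrease_le_SOL (v : R) : eH ^+ 2 <= L ^+ 2 * v ->
  decrease <= eta * eH * theta ^+ 2 * v.
Proof.
move=> h; apply: decrease_le_cube.
have v0 : 0 <= v.
  rewrite -(pmulr_rge0 _ (lt_le_trans ltr01 L2_ge1)).
  by apply: le_trans h; exact: sqr_ge0.
apply: (@le_trans _ _ (decrease_const * eH * v)).
  rewrite mulrAC ler_pdivrMr ?(lt_le_trans _ L2_ge1) //.
  have -> : decrease_const * eH * v * L ^+ 2 = decrease_const * (eH * (L ^+ 2 * v)) by ring.
  by rewrite (ler_pM2l decrease_const_gt0) exprS (ler_pM2l eH_gt0).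
have -> : eta * eH * theta ^+ 2 * v = eta * theta ^+ 2 * (eH * v) by ring.
rewrite -mulrA; apply: ler_wpM2r; first by rewrite mulr_ge0 // ltW.
by case: decrease_const_le => _; have := decrease_const_gt0; lra.
Qed.

Lemma SOL_decrease x (d : 'cV[R]_n) j : F x <= F0 -> d != 0 ->
  eH * enorm d ^+ 2 <= quad (hess F x + (2 * eH)%:M) d ->
  dotp (grad F x) d = - quad (hess F x + (2 * eH)%:M) d ->
  enorm ((hess F x + (2 * eH)%:M) *m d + grad F x) <= eH * zeta / 2 * enorm d ->
  line_search F eH theta eta x SOL d j ->
  enorm (grad F (x + theta ^+ j *: d)) <= eg \/
  F (x + theta ^+ j *: d) <= F x - decrease.
Proof.
case/andP: (eta01) => e0 e1; case/andP: (theta01) => t0 t1.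
move=> xF0 d0 curv gd res ls; have far := SOL_far xF0 d0 curv gd.
have [/= acc _] := ls.
have N0 : 0 < enorm d by rewrite enorm_gt0.
have L0 : 0 < L by exact: lt_le_trans L_ge1.
have e3 : eH <= 3 * eH by rewrite ler_peMl ?(ltW eH_gt0) // ler1n.
have sq (v : R) : 0 <= v -> eH <= L * enorm d -> eH <= L * enorm d * v ->
    eH ^+ 2 <= L ^+ 2 * (v * enorm d ^+ 2).
  move=> v0 h1 h2; have -> : L ^+ 2 * (v * enorm d ^+ 2)
    = (L * enorm d) * (L * enorm d * v) by ring.
  by rewrite expr2; apply: ler_pM => //; exact: ltW.
have t2 : theta ^+ 2 <= 1 by rewrite expr_le1 // ltW.
case: j ls acc => [|j] ls.
  rewrite muln0 !expr0 scale1r mulr1 => acc.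
  have full : decrease <= eta * eH * theta ^+ 2 * enorm d ^+ 2 ->
      F (x + d) <= F x - decrease.
    move=> h; apply: le_trans (ltW acc) _; rewrite lerB //; apply: le_trans h _.
    by rewrite ler_wpM2r ?exprn_ge0 ?(ltW N0) // ler_piMr // mulr_ge0 // ltW.
  (* The gradient estimate requires the whole segment in the level set. Otherwise some intermediate
     point lies above [F x]; the decrease condition fails there, and [far] with [s1 = u] shows that
     [d] is long, so that the accepted unit step gains enough. *)
  have [seg|] := pselect (forall u : R, 0 <= u <= 1 -> F (x + u *: d) <= F x).
    have [le|gt] := leP (enorm (grad F (x + d))) eg; [by left|right].
    have gle := SOL_gradient (fun u h => le_trans (seg u h) xF0) res.
    have [big|small] := leP eH (L * enorm d).
      apply: full; apply: decrease_le_SOL; rewrite -[enorm d ^+ 2]mul1r.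
      by apply: sq => //; rewrite mulr1.
    apply: le_trans (ltW acc) _; rewrite lerB //; apply: decrease_le_grad.
    (* For a short direction, [L * enorm d < eH] bounds the quadratic term of [gle] by half of
       [eH * enorm d], and 1/2 + 5/2 = 3. *)
    have egN : eg <= 3 * eH * enorm d.
      have : L * enorm d ^+ 2 <= eH * enorm d.
        by rewrite expr2 mulrA ler_wpM2r // ltW.
      lra.
    have eg2 : eg ^+ 2 / eH <= 9 * eH * enorm d ^+ 2.
      rewrite ler_pdivrMr //.
      have -> : 9 * eH * enorm d ^+ 2 * eH = (3 * eH * enorm d) ^+ 2 by ring.
      by rewrite lerXn2r ?nnegrE ?mulr_ge0 // ltW.
    apply: (@le_trans _ _ (decrease_const * (9 * eH * enorm d ^+ 2))).
      by rewrite ler_pM2l // decrease_const_gt0.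
    have -> : decrease_const * (9 * eH * enorm d ^+ 2)
      = (9 * decrease_const) * (eH * enorm d ^+ 2) by ring.
    rewrite -[eta * eH * _]mulrA; apply: ler_wpM2r.
      by rewrite mulr_ge0 ?exprn_ge0 // ltW.
    have : eta * theta ^+ 2 <= eta by rewrite ler_piMr // ltW.
    by case: decrease_const_le => _; have := decrease_const_gt0; lra.
  move=> /existsNP[u /not_implyP[/andP[u0 u1] /negP]]; rewrite -ltNge => gtu.
  right; have {}u0 : 0 < u.
    rewrite lt_neqAle u0 andbT; apply: contraTneq gtu => <-.
    by rewrite scale0r addr0 ltxx.
  have h : 3 * eH <= L * enorm d * u ^+ 2.
    apply: far; first by rewrite u0.
    apply: le_trans (ltW gtu); rewrite gerBl !mulr_ge0 ?exprn_ge0 //; exact: ltW.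
  have h1 : eH <= L * enorm d.
    have : L * enorm d * u ^+ 2 <= L * enorm d.
      by rewrite ler_piMr ?mulr_ge0 ?(ltW L0) ?(ltW N0) // expr_le1 // ltW.
    exact/le_trans/(le_trans e3 h).
  apply: full; apply: decrease_le_SOL; rewrite -[enorm d ^+ 2]mul1r.
  by apply: sq => //; rewrite mulr1.
move=> acc; right; apply: le_trans (ltW acc) _; rewrite lerB // {acc}.
have s10 : 0 < theta ^+ j by rewrite exprn_gt0.
have s11 : theta ^+ j <= 1 by rewrite exprn_ile1 // ltW.
have := line_search_rejected ls; rewrite /= -leNgt mulnC exprM => rej.
have -> : theta ^+ (2 * j.+1) = theta ^+ 2 * (theta ^+ j) ^+ 2.
  by rewrite mulnC exprM -exprMn -exprS.
move: (theta ^+ j) s10 s11 rej {ls} => s1 s10 s11 rej.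
have h : 3 * eH <= L * enorm d * s1 ^+ 2.
  apply: far; first by rewrite s10.
  by apply: le_trans rej; rewrite [X in F x - X <= _]mulrAC.
have h1 : eH <= L * enorm d.
  have : L * enorm d * s1 ^+ 2 <= L * enorm d.
    by rewrite ler_piMr ?mulr_ge0 ?(ltW L0) ?(ltW N0) // expr_le1 // ltW.
  exact/le_trans/(le_trans e3 h).
rewrite mulrA -[_ * enorm d ^+ 2]mulrA; apply: decrease_le_SOL.
by apply: sq => //; [exact: sqr_ge0|exact: le_trans e3 h].
Qed.

(** The threshold [eH / 2] is that of the eigenvalue oracle; CG directions satisfy the stronger one
    with [eH]. The scaling makes the length of the step equal to its normalized curvature, and the
    sign makes it non-ascending. *)
Lemma nc_direction_descent x (d : 'cV[R]_n) : d != 0 ->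
  quad (hess F x) d <= - (eH / 2) * enorm d ^+ 2 ->
  let D := nc_direction F x d in
  [/\ eH / 2 <= enorm D, quad (hess F x) D = - enorm D ^+ 3
    & dotp (grad F x) D <= 0].
Proof.
move=> d0 curv /=; set q := quad _ _ in curv *.
have N0 : 0 < enorm d by rewrite enorm_gt0.
have q0 : q < 0 by apply: le_lt_trans curv _; rewrite nmulr_rlt0 ?exprn_gt0 // oppr_lt0 divr_gt0.
have aq : `|q| = - q by rewrite ltr0_norm.
have asgn (s : R) : `|sgn s| = 1 by rewrite /sgn; case: ifP; rewrite ?normrN normr1.
have sgn2 (s : R) : sgn s ^+ 2 = 1 by rewrite /sgn; case: ifP; rewrite ?sqrrN expr1n.
have ND : enorm (nc_direction F x d) = - q / enorm d ^+ 2.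
  rewrite /nc_direction enormZ normrN normrM asgn mul1r -/q aq ger0_norm.
    by field; rewrite gt_eqF.
  by rewrite divr_ge0 ?exprn_ge0 ?(ltW N0) // oppr_ge0 ltW.
split.
- by rewrite ND ler_pdivlMr ?exprn_gt0 //; move: curv; rewrite mulNr; lra.
- rewrite ND /nc_direction quadZ -/q aq sqrrN exprMn sgn2 mul1r.
  by field; rewrite gt_eqF.
- rewrite /nc_direction dotpZr dotpC mulNr oppr_le0 mulrAC.
  apply: mulr_ge0; last by rewrite divr_ge0 ?exprn_ge0 // ltW.
  rewrite /sgn; case: (lerP 0 (dotp (grad F x) d)) => h /=; first by rewrite mul1r.
  by rewrite mulN1r oppr_ge0 ltW.
Qed.

Variables (Flow Mmax : R).
Hypothesis F_low : forall x, F x <= F0 -> Flow <= F x.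
Hypothesis call_products : forall x M o, F x <= F0 ->
  ncg_call F eg eH zeta delta x M o -> M%:R <= Mmax.

Lemma ncg_step_decrease x M t d j : F x <= F0 ->
  ncg_call F eg eH zeta delta x M (Direction t d) ->
  line_search F eH theta eta x t d j ->
  F (x + theta ^+ j *: d) <= F x - decrease \/
  eg < enorm (grad F x) /\ enorm (grad F (x + theta ^+ j *: d)) <= eg.
Proof.
move=> xF0; have Hsym : (hess F x)^T = hess F x by case: F_diff.
have NC (v : 'cV[R]_n) : v != 0 ->
    quad (hess F x) v <= - (eH / 2) * enorm v ^+ 2 ->
    line_search F eH theta eta x NC (nc_direction F x v) j ->
    F (x + theta ^+ j *: nc_direction F x v) <= F x - decrease.
  move=> v0 curv; have [? ? ?] := nc_direction_descent v0 curv.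
  exact: NC_decrease.
move E: (Direction t d) => o call; case: call E => //.
- move=> d' M' gt cg [-> ->] ls; have g0 : grad F x != 0.
    by rewrite -enorm_gt0; exact: lt_trans gt.
  have [h1 h2 h3 h4] := capped_cg_SOL Hsym eH_gt0 zeta01 g0 cg.
  by have [|] := SOL_decrease xF0 h3 h1 h2 h4 ls; [right|left].
- move=> d' M' gt cg [-> ->] ls; left.
  have curv := capped_cg_NC cg.
  have d0 : d' != 0.
    by apply: contraTneq curv => ->; rewrite enorm0 expr0n mulr0 /quad dotp0l ltxx.
  apply: NC => //; apply: le_trans (ltW curv) _.
  by rewrite ler_wpM2r ?exprn_ge0 ?enorm_ge0 // lerN2 ler_pdivrMr // ler_peMr ?ler1n // ltW.
- move=> b v M' _ _ orc [-> ->] ls; left; move: ls.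
  move E: (Some v) orc => ov orc; case: orc E => // k v' _ [_ v1 curv] [->] ls.
  have v0 : v' != 0 by rewrite -enorm_gt0 v1.
  (* For a unit vector, the direction built from the oracle coincides with [nc_direction]. *)
  move: ls; have := NC v' v0; rewrite /nc_direction v1 !expr1n divr1; apply.
  by rewrite mulr1 -mulNr.
Qed.

(** An amortized count. A decrease earns two units: one pays for the step itself, the other restores
    the spare unit held at large gradients. A SOL step without decrease spends that spare unit and
    ends at a small gradient, where the sharper second bound is available. *)
Lemma newton_cg_bound x N M o :
  newton_cg F eg eH theta zeta eta delta x N M o -> F x <= F0 ->
  [/\ N%:R * decrease <= 2 * (F x - Flow) + 2 * decrease,
      enorm (grad F x) <= eg -> N%:R * decrease <= 2 * (F x - Flow) + decrease,
      M%:R <= N%:R * Mmax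
    & forall y, o = Some y -> F y <= F x].
Proof.
have D0 := decrease_gt0.
elim=> {x N M o} [x M o call|x M call|x M t d j N M' o call ls _ IH] xF0.
- have := F_low xF0; split=> [|_||//]; try lra.
  by rewrite mul1r; exact: call_products call.
- have := F_low xF0; split=> [|_||y [<-] //]; try lra.
  by rewrite mul1r; exact: call_products call.
have dec := line_search_decrease ls.
have [IH1 IH2 IHM IHo] := IH (le_trans dec xF0).
rewrite -[N.+1]addn1 natrD [_ * decrease]mulrDl mul1r; split.
- case: (ncg_step_decrease xF0 call ls) => [h|[_ /IH2 h]]; lra.
- by case: (ncg_step_decrease xF0 call ls) => [h _|[/lt_geF ->//]]; lra.
- by have := call_products xF0 call; rewrite natrD; move: IHM; rewrite mulrDl mul1r; lra.
- by move=> y /IHo h; exact: le_trans dec.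
Qed.

End NewtonDescent.

(** A CG call reaching index [j] costs at most [3 * j + 1] products, plus [j] for the final search;
    the call that ends at index 0 still costs one. *)
Lemma charge_le j : (4 * j + 1 <= 5 * maxn j 1)%N.
Proof. by case: j => // j; rewrite (maxn_idPl _) // (mulSn 4) addnC leq_add2r. Qed.

(** * Hessian-vector products of one subroutine call *)

Section CallProducts.
Context {R : realType} (n : nat) (F : 'cV[R]_n -> R) (eg eH zeta delta : R).
Hypotheses (n_gt0 : (0 < n)%N) (F_diff : twice_diff F).
Hypotheses (eg_gt0 : 0 < eg) (eH_gt0 : 0 < eH).
Hypotheses (zeta01 : 0 < zeta < 1) (delta01 : 0 < delta < 1).

(** One number for both subroutines: the bound on the CG index plus the Lanczos limit. The common
    summand 2 also covers the 1 and the rounding up in [lanczos_max]. *)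
Definition subroutine_bound (Km : R) : R :=
  2 + 2 * (Num.sqrt Km + 1) * ln (24 * Km ^+ 4 / zeta)
  + ln (11 / 4 * n%:R / delta ^+ 2) / 2 * Num.sqrt Km.

Lemma ln_dim_ge0 : 0 <= ln (11 / 4 * n%:R / delta ^+ 2).
Proof.
case/andP: delta01 => d0 d1; apply: ln_ge0.
rewrite ler_pdivlMr ?exprn_gt0 // mul1r.
have : delta ^+ 2 <= 1 by rewrite expr_le1 // ltW.
have : 1 <= n%:R :> R by rewrite ler1n.
lra.
Qed.

Lemma ln_kappa_ge0 (Km : R) : 2 <= Km -> 0 <= ln (24 * Km ^+ 4 / zeta).
Proof.
case/andP: zeta01 => z0 z1 K2; apply: ln_ge0; rewrite ler_pdivlMr // mul1r.
have : 1 <= Km ^+ 4 by rewrite exprn_ege1 //; lra.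
lra.
Qed.

Lemma subroutine_bound_ge0 (Km : R) : 2 <= Km -> 0 <= subroutine_bound Km.
Proof.
move=> /ln_kappa_ge0 lk; have ld := ln_dim_ge0; have sK := sqrtr_ge0 Km.
apply: addr_ge0; last by rewrite mulr_ge0 // divr_ge0.
by rewrite addr_ge0 // mulr_ge0 // mulr_ge0 // addr_ge0.
Qed.

Lemma ncg_products_le x (Km : R) M o : kappa eH (snorm (hess F x)) <= Km ->
  ncg_call F eg eH zeta delta x M o ->
  M%:R <= 5 * Num.min n%:R (subroutine_bound Km).
Proof.
move=> kK; have Hsym : (hess F x)^T = hess F x by case: F_diff.
have K2 : 2 <= Km by apply: le_trans kK; exact: kappa_ge2 (snorm_ge0 _ n_gt0).
have lnd := ln_dim_ge0; have lnk := ln_kappa_ge0 K2.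
have sK : 0 <= Num.sqrt Km := sqrtr_ge0 _.
have t1 : 0 <= 2 * (Num.sqrt Km + 1) * ln (24 * Km ^+ 4 / zeta).
  by rewrite mulr_ge0 // mulr_ge0 //; lra.
have t2 : 0 <= ln (11 / 4 * n%:R / delta ^+ 2) / 2 * Num.sqrt Km.
  by rewrite mulr_ge0 // divr_ge0.
have cg j : eg < enorm (grad F x) -> cg_running (hess F x) (grad F x) eH zeta 0 j ->
    (4 * j + 1)%:R <= 5 * Num.min n%:R (subroutine_bound Km).
  move=> gt run; have g0 : grad F x != 0 by rewrite -enorm_gt0; exact: lt_trans gt.
  have jn := running_le_dim Hsym eH_gt0 zeta01 g0 run.
  have jB := running_index_le eH_gt0 zeta01 g0 kK run.
  apply: (@le_trans _ _ (5 * (maxn j 1)%:R)).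
    by rewrite -(natrM R 5) ler_nat charge_le.
  rewrite ler_pM2l // le_min; apply/andP; split.
    by rewrite ler_nat geq_max jn.
  rewrite /subroutine_bound natr_max ge_max; apply/andP; split; lra.
have lz b k : lz_reached (hess F x) eH delta b k ->
    k%:R <= 5 * Num.min n%:R (subroutine_bound Km).
  case=> /andP[k0 +] _ _; rewrite leq_min => /andP[kn kB].
  apply: (@le_trans _ _ (1 * k%:R)); first by rewrite mul1r.
  apply: ler_pM => //; first by rewrite ler1n.
  rewrite le_min; apply/andP; split; first by rewrite ler_nat.
  have S0 : 0 <= snorm (hess F x) / eH by rewrite divr_ge0 ?snorm_ge0 // ltW.
  set y := ln _ / 2 * _ in kB.
  have y0 : 0 <= y by rewrite mulr_ge0 ?divr_ge0 ?sqrtr_ge0.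
  have cy : 0 <= Num.ceil y by rewrite ceil_ge0; lra.
  have {}kB : k%:R <= 1 + (y + 1).
    apply: (@le_trans _ _ (1 + `|Num.ceil y|%N)%:R); first by rewrite ler_nat.
    rewrite natrD lerD2l natr_absz ger0_norm //.
    by have := ceilB1_lt y; rewrite intrB ltrBlDr; exact: ltW.
  have yB : y <= ln (11 / 4 * n%:R / delta ^+ 2) / 2 * Num.sqrt Km.
    rewrite ler_wpM2l ?divr_ge0 // ler_sqrt; last lra.
    by apply: le_trans kK; rewrite /kappa ler_pM2r ?invr_gt0 // lerDl mulr_ge0 // ltW.
  rewrite /subroutine_bound; move: kB yB t1; move: (_ * ln _) (_ * Num.sqrt Km) y {y0 cy}.
  by move=> u v w; lra.
case=> {M o}.
- move=> j gt run; apply: le_trans (cg j gt run).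
  by rewrite ler_nat /cg_products leq_add2r leq_mul2r orbT.
- move=> d M gt; move E : SOL => t call; case: call E => // j run _ _ _.
  apply: le_trans (cg j gt run).
  by rewrite ler_nat /cg_products leq_add2r leq_mul2r orbT.
- move=> d M gt; move E : NC => t call; case: call E => //.
  + move=> j run _ _; apply: le_trans (cg j gt run).
    by rewrite ler_nat /cg_products leq_add2r leq_mul2r orbT.
  + move=> j run _ _ _ _; apply: le_trans (cg j gt run).
    by rewrite ler_nat /cg_products leq_add2r leq_mul2r orbT.
  + move=> j i run _ _ _ _ _ _ _; apply: le_trans (cg j gt run).
    by rewrite ler_nat /cg_products addnAC mulSn leq_add2r addnC.
- by move=> b k _ _; exact: lz.
- move=> b v M _ _; move E : (Some v) => ov call; case: call E => // k v' rk _ _.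
  exact: lz rk.
- move=> b M _ _; move E : None => ov call; case: call E => // k rk _ _ _.
  exact: lz rk.
Qed.

End CallProducts.

(** * The augmented Lagrangian *)

Section AuglagCalculus.
Context {R : realType} (n m : nat) (f : 'cV[R]_n -> R) (c : 'cV[R]_n -> 'cV[R]_m).
Variables (z : 'cV[R]_n) (lam : 'cV[R]_m) (rho : R).
Hypotheses (f_diff : twice_diff f) (c_diff : forall i, twice_diff (comp_fun c i)).

Let Fa := auglag f c z lam rho.
(** The coordinates of the updated multiplier [lam + rho *: ctilde c z x], which are the weights of
    the constraints in the derivatives. *)
Let mult i x := lam i 0 + rho * (comp_fun c i x - comp_fun c i z).

Lemma auglagE : Fa = fun x => f x + \sum_i
  (lam i 0 * (comp_fun c i x - comp_fun c i z)
   + rho / 2 * ((comp_fun c i x - comp_fun c i z) * (comp_fun c i x - comp_fun c i z))).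
Proof.
apply/funext => x; rewrite /Fa /auglag -addrA enorm_sqr; congr (_ + _).
rewrite big_split /= -mulr_sumr mulrAC; congr (_ + _ * _);
  by apply: eq_bigr => i _; rewrite /ctilde !mxE.
Qed.

Let dc i x : differentiable (comp_fun c i) x.
Proof. by case: (c_diff i). Qed.

Let dt i x : differentiable (fun x => comp_fun c i x - comp_fun c i z) x.
Proof. by apply: differentiableD; [exact: dc|exact: differentiable_cst]. Qed.

Let gt i x : grad (fun x => comp_fun c i x - comp_fun c i z) x = grad (comp_fun c i) x.
Proof.
by rewrite (gradD (dc i x) (differentiable_cst (- comp_fun c i z) x)) grad_cst addr0.
Qed.

Let dmult i x : differentiable (mult i) x.
Proof.
apply: differentiableD; first exact: differentiable_cst.
by apply: differentiableM; [exact: differentiable_cst|exact: dt].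
Qed.

Let gmult i x : grad (mult i) x = rho *: grad (comp_fun c i) x.
Proof.
rewrite (gradD (differentiable_cst (lam i 0) x)
  (differentiableM (differentiable_cst rho x) (dt i x))).
by rewrite grad_cst add0r gradZ // gt.
Qed.

Let term i x := lam i 0 * (comp_fun c i x - comp_fun c i z)
   + rho / 2 * ((comp_fun c i x - comp_fun c i z) * (comp_fun c i x - comp_fun c i z)).

Let dl i x : differentiable (fun x => lam i 0 * (comp_fun c i x - comp_fun c i z)) x.
Proof. by apply: differentiableM; [exact: differentiable_cst|exact: dt]. Qed.

Let dsq i x : differentiable
  (fun x => (comp_fun c i x - comp_fun c i z) * (comp_fun c i x - comp_fun c i z)) x.
Proof. by apply: differentiableM; exact: dt. Qed.

Let dq i x : differentiable (fun x => rho / 2 *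
  ((comp_fun c i x - comp_fun c i z) * (comp_fun c i x - comp_fun c i z))) x.
Proof. by apply: differentiableM; [exact: differentiable_cst|exact: dsq]. Qed.

Let dterm i x : differentiable (term i) x.
Proof. by apply: differentiableD; [exact: dl|exact: dq]. Qed.

Let gterm i x : grad (term i) x = mult i x *: grad (comp_fun c i) x.
Proof.
rewrite (gradD (dl i x) (dq i x)) (gradZ _ (dt i x)) (gradZ _ (dsq i x)).
rewrite (gradM (dt i x) (dt i x)) gt -scalerDl !scalerA -scalerDl /mult.
by congr (_ *: _); field.
Qed.

Lemma auglag_differentiable x : differentiable Fa x.
Proof.
rewrite auglagE; apply: differentiableD; first by case: f_diff.
by apply: differentiable_fsum => i; exact: dterm.
Qed.

Lemma auglag_grad x :
  grad Fa x = grad f x + \sum_i mult i x *: grad (comp_fun c i) x.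
Proof.
rewrite auglagE (@gradD _ _ f (fun x => \sum_i term i x)); last first.
- by apply: differentiable_fsum => i; exact: dterm.
- by case: f_diff.
by rewrite grad_sum //; congr (_ + _); apply: eq_bigr => i _; exact: gterm.
Qed.

Let dcg i a x : differentiable (fun y => grad (comp_fun c i) y a 0) x.
Proof. by case: (c_diff i). Qed.

Let dfg a x : differentiable (fun y => grad f y a 0) x.
Proof. by case: f_diff. Qed.

Let gradEa a : (fun y => grad Fa y a 0) =
  fun y => grad f y a 0 + \sum_i mult i y * grad (comp_fun c i) y a 0.
Proof.
apply/funext => y; rewrite auglag_grad mxE summxE; congr (_ + _).
by apply: eq_bigr => i _; rewrite mxE.
Qed.

Let dmg i a x : differentiable (fun y => mult i y * grad (comp_fun c i) y a 0) x.
Proof. by apply: differentiableM; [exact: dmult|exact: dcg]. Qed.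

Lemma auglag_grad_differentiable a x : differentiable (fun y => grad Fa y a 0) x.
Proof.
rewrite gradEa; apply: differentiableD; first exact: dfg.
by apply: differentiable_fsum => i; exact: dmg.
Qed.

Lemma auglag_hess x : hess Fa x = hess f x + \sum_i
  (mult i x *: hess (comp_fun c i) x
   + rho *: (grad (comp_fun c i) x *m (grad (comp_fun c i) x)^T)).
Proof.
apply/matrixP => a b; rewrite hess_grad gradEa.
rewrite (@gradD _ _ (fun y => grad f y a 0)
  (fun y => \sum_i mult i y * grad (comp_fun c i) y a 0)); last first.
- by apply: differentiable_fsum => i; exact: dmg.
- exact: dfg.
rewrite mxE -hess_grad [RHS]mxE; congr (_ + _).
rewrite grad_sum; last by move=> i; exact: dmg.
rewrite !summxE; apply: eq_bigr => i _.
rewrite (gradM (dmult i x) (dcg i a x)) gmult mxE [RHS]mxE; congr (_ + _).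
  by rewrite mxE -hess_grad [RHS]mxE.
rewrite mxE [RHS]mxE [(_ *m _) a b]mxE big_ord1 [X in _ = _ * (_ * X)]mxE.
by rewrite [X in _ * X = _]mxE; ring.
Qed.

Lemma auglag_twice_diff : twice_diff Fa.
Proof.
split; [exact: auglag_differentiable|exact: auglag_grad_differentiable|].
move=> x; rewrite auglag_hess linearD /= linear_sum /=.
have [_ _ ->] := f_diff; congr (_ + _); apply: eq_bigr => i _.
rewrite linearD !linearZ /= trmx_mul trmxK.
by have [_ _ ->] := c_diff i.
Qed.

End AuglagCalculus.

(** * Level sets of the augmented Lagrangian *)

Section LevelSet.
Context {R : realType} (n m : nat) (f : 'cV[R]_n -> R) (c : 'cV[R]_n -> 'cV[R]_m).
Variables (fhi flow gamma df dc Lambda rho0 : R) (z : 'cV[R]_n).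
Hypotheses (gamma_gt0 : 0 < gamma) (Lambda_gt0 : 0 < Lambda).
Hypothesis rho0_gt : 2 * gamma < rho0.
Hypothesis f_low : forall x, flow <= f x + gamma * enorm (c x) ^+ 2 / 2.
Hypotheses (z_feas : enorm (c z) <= 1 / 2) (z_hi : f z <= fhi).

Definition infeas_const : R := fhi - flow + gamma.
(** The last term is minus the minimum over t of [(rho0 - 2 * gamma) / 2 * t ^+ 2 - Lambda * t], t
    standing for the norm of [ctilde]. *)
Definition auglag_low : R := flow - gamma - Lambda ^+ 2 / (2 * (rho0 - 2 * gamma)).

Lemma infeas_const_ge0 : 0 <= infeas_const.
Proof.
rewrite /infeas_const; have h := f_low z.
have : enorm (c z) ^+ 2 <= 1 by rewrite expr_le1 ?enorm_ge0 //; move: z_feas; lra.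
move=> h2; have : gamma * enorm (c z) ^+ 2 <= gamma * 1 by rewrite ler_wpM2l // ltW.
by move: z_hi gamma_gt0; lra.
Qed.

Variables (lam : 'cV[R]_m) (rho : R).
Hypotheses (lam_le : enorm lam <= Lambda) (rho_ge : rho0 <= rho).

Let Fa := auglag f c z lam rho.

Lemma dotp_lam_ge x : - (Lambda * enorm (ctilde c z x)) <= dotp lam (ctilde c z x).
Proof.
have /ler_normlP[h _] := cauchy_schwarz lam (ctilde c z x).
have : enorm lam * enorm (ctilde c z x) <= Lambda * enorm (ctilde c z x).
  by rewrite ler_wpM2r // enorm_ge0.
lra.
Qed.

(** Passing from [c] to [ctilde] squares a sum and doubles [gamma / 2]. This is why the penalty must
    exceed [2 * gamma]. *)
Lemma f_ge_ctilde x : flow - gamma / 2 - gamma * enorm (ctilde c z x) ^+ 2 <= f x.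
Proof.
have h := f_low x.
have -> : enorm (ctilde c z x) = enorm (c x - c z) by [].
have h1 : enorm (c x) <= enorm (c x - c z) + 1 / 2.
  have {1}-> : c x = (c x - c z) + c z by rewrite subrK.
  by apply: le_trans (enormD _ _) _; rewrite lerD2l.
have h2 : enorm (c x) ^+ 2 <= 2 * enorm (c x - c z) ^+ 2 + 1 / 2.
  have : enorm (c x) ^+ 2 <= (enorm (c x - c z) + 1 / 2) ^+ 2.
    by rewrite lerXn2r ?nnegrE ?enorm_ge0 ?addr_ge0 ?enorm_ge0.
  by have := sqr_ge0 (enorm (c x - c z) - 1 / 2); lra.
have : gamma * enorm (c x) ^+ 2 <= gamma * (2 * enorm (c x - c z) ^+ 2 + 1 / 2).
  by rewrite ler_wpM2l // ltW.
by move: (enorm (c x - c z) ^+ 2) gamma_gt0 => t; lra.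
Qed.

Lemma level_infeas x : Fa x <= f z ->
  (rho - 2 * gamma) / 2 * enorm (ctilde c z x) ^+ 2 - Lambda * enorm (ctilde c z x)
    <= infeas_const.
Proof.
rewrite /Fa /auglag /infeas_const; have := dotp_lam_ge x; have := f_ge_ctilde x.
by move: (dotp lam _) (enorm _) z_hi gamma_gt0 => a t; lra.
Qed.

(** The right-hand side is the larger root of the quadratic inequality [level_infeas] with [rho]
    lowered to [rho0]; completing the square gives it. *)
Lemma level_infeas_le x : Fa x <= f z ->
  enorm (ctilde c z x) <=
    Num.sqrt (2 * infeas_const / (rho0 - 2 * gamma)
              + Lambda ^+ 2 / (rho0 - 2 * gamma) ^+ 2) + Lambda / (rho0 - 2 * gamma).
Proof.
move/level_infeas; set t := enorm _ => h.
have D0 : 0 < rho0 - 2 * gamma by rewrite subr_gt0.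
have t2 : (rho0 - 2 * gamma) * t ^+ 2 <= (rho - 2 * gamma) * t ^+ 2.
  by rewrite ler_wpM2r ?sqr_ge0 // lerD2r.
have {h t2} : (rho0 - 2 * gamma) * t ^+ 2 - 2 * Lambda * t <= 2 * infeas_const by lra.
move: (rho0 - 2 * gamma) D0 => D D0 h.
rewrite -lerBlDr; apply: le_trans (ler_norm _) _; rewrite -sqrtr_sqr.
apply: ler_wsqrtr; rewrite -subr_ge0.
have -> : 2 * infeas_const / D + Lambda ^+ 2 / D ^+ 2 - (t - Lambda / D) ^+ 2
  = (2 * infeas_const - (D * t ^+ 2 - 2 * Lambda * t)) / D by field; rewrite gt_eqF.
by rewrite divr_ge0 // ?subr_ge0 // ltW.
Qed.

(** Multiply [level_infeas] by [2 * e ^+ 2]. With [e < 2 * t] and [e <= 1], the terms on the right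
    are at most 8 and 4 times [t ^+ 2], which then cancels; [e <= 1] also absorbs the
    [2 * gamma]. *)
Lemma level_infeas_rho x (e : R) : 0 < e <= 1 -> Fa x <= f z ->
  e / 2 < enorm (ctilde c z x) ->
  rho <= (2 * gamma + 8 * infeas_const + 4 * Lambda) * e ^- 2.
Proof.
case/andP=> e0 e1 /level_infeas; set t := enorm _ => h et.
have A0 := infeas_const_ge0.
have t0 : 0 < t by lra.
rewrite ler_pdivlMr ?exprn_gt0 //.
have e2 : e ^+ 2 <= 1 by rewrite expr_le1 // ltW.
have h1 : (rho - 2 * gamma) * e ^+ 2 * t ^+ 2 <= (8 * infeas_const + 4 * Lambda) * t ^+ 2.
  have et2 : e ^+ 2 <= 4 * t ^+ 2 by nra.
  have ett : e * t <= 2 * t ^+ 2 by nra.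
  have -> : (rho - 2 * gamma) * e ^+ 2 * t ^+ 2 =
    2 * e ^+ 2 * ((rho - 2 * gamma) / 2 * t ^+ 2) by field.
  have h2 : 2 * e ^+ 2 * ((rho - 2 * gamma) / 2 * t ^+ 2)
      <= 2 * e ^+ 2 * (infeas_const + Lambda * t).
    by rewrite ler_wpM2l ?mulr_ge0 ?exprn_ge0 ?(ltW e0) //; lra.
  apply: le_trans h2 _.
  have h3 : infeas_const * e ^+ 2 <= infeas_const * (4 * t ^+ 2) by rewrite ler_wpM2l.
  have h4 : Lambda * e * (e * t) <= Lambda * 1 * (2 * t ^+ 2).
    apply: ler_pM => //; first by rewrite mulr_ge0 // ltW.
      by rewrite mulr_ge0 // ltW.
    by rewrite ler_wpM2l // ltW.
  have -> : 2 * e ^+ 2 * (infeas_const + Lambda * t) =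
    2 * (infeas_const * e ^+ 2) + 2 * (Lambda * e * (e * t)) by ring.
  lra.
rewrite ler_pM2r ?exprn_gt0 // in h1.
have : gamma * e ^+ 2 <= gamma * 1 by rewrite ler_wpM2l // ltW.
by move: h1; rewrite mulrBl; lra.
Qed.

Lemma auglag_lower x : auglag_low <= Fa x.
Proof.
have D0 : 0 < rho0 - 2 * gamma by rewrite subr_gt0.
rewrite /Fa /auglag /auglag_low; have := dotp_lam_ge x; have := f_ge_ctilde x.
move: (dotp lam _) (enorm _) => a t h1 h2.
have t2 : (rho0 - 2 * gamma) * t ^+ 2 <= (rho - 2 * gamma) * t ^+ 2.
  by rewrite ler_wpM2r ?sqr_ge0 // lerD2r.
have : 0 <= (rho0 - 2 * gamma) * (t - Lambda / (rho0 - 2 * gamma)) ^+ 2.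
  by rewrite mulr_ge0 ?sqr_ge0 // ltW.
have -> : (rho0 - 2 * gamma) * (t - Lambda / (rho0 - 2 * gamma)) ^+ 2 =
  (rho0 - 2 * gamma) * t ^+ 2 - 2 * Lambda * t
  + 2 * (Lambda ^+ 2 / (2 * (rho0 - 2 * gamma))).
  by move: (rho0 - 2 * gamma) D0 => D D0; field; rewrite gt_eqF.
by move: (_ / (2 * _)) gamma_gt0 => q; lra.
Qed.

Hypothesis rho0_df : Lambda ^+ 2 / (2 * rho0) <= df.
Hypothesis rho0_dc : Num.sqrt (2 * infeas_const / (rho0 - 2 * gamma)
  + Lambda ^+ 2 / (rho0 - 2 * gamma) ^+ 2) + Lambda / (rho0 - 2 * gamma) <= dc.

Lemma level_ctilde_le x : Fa x <= f z -> enorm (ctilde c z x) <= dc.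
Proof. by move=> h; apply: le_trans rho0_dc; exact: level_infeas_le. Qed.

(** The multiplier and penalty terms together are at least [- Lambda ^+ 2 / (2 * rho0)], which
    bounds [f]; the other bound adds the infeasibility of [z]. *)
Lemma level_Sset x : Fa x <= f z -> Sset f c fhi df dc x.
Proof.
move=> h; split.
  apply: (@le_trans _ _ (fhi + Lambda ^+ 2 / (2 * rho0))); last by rewrite lerD2l.
  have r0 : 0 < rho0 by move: rho0_gt gamma_gt0; lra.
  move: h (dotp_lam_ge x); rewrite /Fa /auglag.
  move: (dotp lam _) (enorm _) => a t h1 h2.
  have t2 : rho0 * t ^+ 2 <= rho * t ^+ 2 by rewrite ler_wpM2r ?sqr_ge0.
  have : 0 <= rho0 * (t - Lambda / rho0) ^+ 2 by rewrite mulr_ge0 ?sqr_ge0 // ltW.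
  have -> : rho0 * (t - Lambda / rho0) ^+ 2 =
    rho0 * t ^+ 2 - 2 * Lambda * t + 2 * (Lambda ^+ 2 / (2 * rho0)).
    by field; rewrite gt_eqF.
  by move: (_ / (2 * _)) z_hi => q; lra.
have := level_ctilde_le h; rewrite /ctilde => h1.
have {1}-> : c x = (c x - c z) + c z by rewrite subrK.
by apply: le_trans (enormD _ _) _; move: z_feas; lra.
Qed.

End LevelSet.

(** A product rule for differences: every summand contains exactly one difference, to which one
    Lipschitz estimate applies. *)
Lemma hess_term_difference {R : realType} n (l r py px pz : R)
    (Hy Hx : 'M[R]_n) (gy gx : 'cV[R]_n) :
  (l + r * (py - pz)) *: Hy + r *: (gy *m gy^T)
    - ((l + r * (px - pz)) *: Hx + r *: (gx *m gx^T))
  = (l + r * (py - pz)) *: (Hy - Hx) + (r * (py - px)) *: Hx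
    + r *: ((gy - gx) *m gy^T + gx *m (gy - gx)^T).
Proof.
have -> : (gy - gx)^T = gy^T - gx^T by rewrite linearB.
rewrite mulmxBl mulmxBr.
move: (gy *m gy^T) (gx *m gy^T) (gx *m gx^T) => M1 M2 M3.
by apply/matrixP => a b; rewrite !mxE; ring.
Qed.

(** * Hessian bounds on the level sets *)

Section AuglagLipschitz.
Context {R : realType} (n m : nat) (f : 'cV[R]_n -> R) (c : 'cV[R]_n -> 'cV[R]_m).
Variables (fhi df dc Lambda K : R) (Omega : set 'cV[R]_n) (z : 'cV[R]_n).
Variables (lam : 'cV[R]_m) (rho : R).
Hypotheses (n_gt0 : (0 < n)%N).
Hypotheses (f_diff : twice_diff f) (c_diff : forall i, twice_diff (comp_fun c i)).
Hypotheses (lam_le : enorm lam <= Lambda) (rho_gt0 : 0 < rho).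

Let Fa := auglag f c z lam rho.
Let S := Sset f c fhi df dc.

Hypothesis level_S : forall x, Fa x <= f z -> S x.
Hypothesis level_ct : forall x, Fa x <= f z -> enorm (ctilde c z x) <= dc.
Hypotheses (S_Omega : S `<=` Omega) (HK : derivative_bound f c S Omega K).

Let mult i x := lam i 0 + rho * (comp_fun c i x - comp_fun c i z).

Let K0 : 0 <= K. Proof. by case: HK. Qed.

Let mult_le i x : Fa x <= f z -> `|mult i x| <= Lambda + rho * dc.
Proof.
move=> h; apply: le_trans (ler_normD _ _) _; apply: lerD.
  exact: le_trans (coord_le_enorm _ _) lam_le.
rewrite normrM gtr0_norm // ler_wpM2l ?(ltW rho_gt0) //.
apply: le_trans (level_ct h); have := coord_le_enorm (ctilde c z x) i.
by rewrite /ctilde !mxE.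
Qed.

Definition auglag_hess_bound : R :=
  K + m%:R * ((Lambda + rho * dc) * K + rho * K ^+ 2).

Lemma auglag_hess_le x : Fa x <= f z -> snorm (hess Fa x) <= auglag_hess_bound.
Proof.
move=> h; have Sx := level_S h; have [_ Hf Hc _ _] := HK.
rewrite auglag_hess //; apply: le_trans (snormD _ _ n_gt0) _.
apply: lerD; first by case: (Hf x Sx).
apply: le_trans (snorm_sum _ _ _ n_gt0) _.
rewrite mulr_natl -[X in _ *+ X]card_ord -sumr_const; apply: ler_sum => i _.
have [gi hi] := Hc i x Sx.
apply: le_trans (snormD _ _ n_gt0) _; apply: lerD.
  apply: le_trans (snormZ _ _ n_gt0) _; apply: ler_pM => //; first exact: snorm_ge0.
  exact: mult_le.
apply: le_trans (snormZ _ _ n_gt0) _; rewrite gtr0_norm // ler_wpM2l ?(ltW rho_gt0) //.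
apply: le_trans (snorm_outer _ _ n_gt0) _.
by rewrite expr2; apply: ler_pM => //; exact: enorm_ge0.
Qed.

Lemma comp_fun_lipschitz i x d :
  (forall u : R, 0 <= u <= 1 -> S (x + u *: d)) ->
  `|comp_fun c i (x + d) - comp_fun c i x| <= K * enorm d.
Proof.
move=> seg; have [_ _ Hc _ _] := HK.
have dci : forall y, differentiable (comp_fun c i) y by case: (c_diff i).
have [t /andP[t0 t1]] := mean_value (is_derive_line x d dci) ltr01.
rewrite scale1r scale0r addr0 mulr1 => ->.
apply: le_trans (cauchy_schwarz _ _) _; apply: ler_wpM2r; first exact: enorm_ge0.
by case: (Hc i (x + t *: d)) => //; apply: seg; rewrite !ltW.
Qed.

Lemma grad_comp_lipschitz i x d :
  (forall u : R, 0 <= u <= 1 -> S (x + u *: d)) ->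
  enorm (grad (comp_fun c i) (x + d) - grad (comp_fun c i) x) <= K * enorm d.
Proof.
move=> seg; have [_ _ Hc _ _] := HK.
(* Pairing the increment with itself allows a scalar mean value theorem. *)
set w := _ - _; have [->|w0] := eqVneq w 0.
  by rewrite enorm0 mulr_ge0 ?enorm_ge0.
have [t /andP[t0 t1]] := mean_value (is_derive_grad_line x d w (c_diff i)) ltr01.
rewrite scale1r scale0r addr0 mulr1 -dotpNr -dotpDr -/w -enorm_sqr => e.
rewrite -(@ler_pM2l _ (enorm w)) ?enorm_gt0 // -expr2 e.
apply: le_trans (dotp_le _ _) _; apply: ler_wpM2l; first exact: enorm_ge0.
apply: le_trans (snorm_ub _ _) _; apply: ler_wpM2r; first exact: enorm_ge0.
by case: (Hc i (x + t *: d)) => //; apply: seg; rewrite !ltW.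
Qed.

(** Of the three [rho * K ^+ 2], one comes from the variation of the multiplier and two from the
    outer product of the gradients. The leading 1 ensures that the constant is at least 1, as the
    descent analysis requires. *)
Definition auglag_lip : R :=
  1 + K + m%:R * ((Lambda + rho * dc) * K + 3 * (rho * K ^+ 2)).

Lemma auglag_hess_segment x d :
  (forall u : R, 0 <= u <= 1 -> Fa (x + u *: d) <= f z) ->
  snorm (hess Fa (x + d) - hess Fa x) <= auglag_lip * enorm d.
Proof.
move=> segF; have seg u : 0 <= u <= 1 -> S (x + u *: d) by move=> /segF/level_S.
have Fx : Fa x <= f z by have := segF 0; rewrite scale0r addr0 lexx ler01; apply.
have Fy : Fa (x + d) <= f z by have := segF 1; rewrite scale1r ler01 lexx; apply.
have Sx := level_S Fx; have Sy := level_S Fy.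
have [_ _ Hc Lf Lc] := HK; have N0 := enorm_ge0 d.
have xd : x + d - x = d by rewrite addrAC subrr add0r.
rewrite !auglag_hess // opprD addrACA -sumrB.
apply: le_trans (snormD _ _ n_gt0) _; rewrite /auglag_lip mulrDl; apply: lerD.
  have := Lf _ _ (S_Omega Sy) (S_Omega Sx); rewrite xd => h.
  by apply: le_trans h _; rewrite ler_wpM2r //; move: K0; lra.
apply: le_trans (snorm_sum _ _ _ n_gt0) _.
rewrite -mulrA mulr_natl -[X in _ *+ X]card_ord -sumr_const; apply: ler_sum => i _.
set gy := grad _ (x + d); set gx := grad _ x.
set Hy := hess _ (x + d); set Hx := hess _ x.
have -> : (lam i 0 + rho * (comp_fun c i (x + d) - comp_fun c i z)) *: Hy
    + rho *: (gy *m gy^T)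
    - ((lam i 0 + rho * (comp_fun c i x - comp_fun c i z)) *: Hx
    + rho *: (gx *m gx^T))
  = mult i (x + d) *: (Hy - Hx)
    + (rho * (comp_fun c i (x + d) - comp_fun c i x)) *: Hx
    + rho *: ((gy - gx) *m gy^T + gx *m (gy - gx)^T).
  exact: hess_term_difference.
have [gyK hyK] := Hc i _ Sy; have [gxK hxK] := Hc i _ Sx.
have cl := comp_fun_lipschitz i seg; have gl := grad_comp_lipschitz i seg.
rewrite -/gy -/gx in gl gyK gxK; rewrite -/Hy -/Hx in hyK hxK.
have -> : ((Lambda + rho * dc) * K + 3 * (rho * K ^+ 2)) * enorm d =
  (Lambda + rho * dc) * (K * enorm d) + rho * (K * enorm d) * K
  + rho * (K * enorm d * K + K * (K * enorm d)) by ring.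
apply: le_trans (snormD _ _ n_gt0) _; apply: lerD.
  apply: le_trans (snormD _ _ n_gt0) _; apply: lerD.
    apply: le_trans (snormZ _ _ n_gt0) _; apply: ler_pM => //; first exact: snorm_ge0.
      exact: mult_le.
    by have := Lc i _ _ (S_Omega Sy) (S_Omega Sx); rewrite xd.
  apply: le_trans (snormZ _ _ n_gt0) _; rewrite normrM gtr0_norm //.
  apply: ler_pM => //; first by rewrite mulr_ge0 ?(ltW rho_gt0).
    exact: snorm_ge0.
  by rewrite ler_wpM2l ?(ltW rho_gt0).
apply: le_trans (snormZ _ _ n_gt0) _; rewrite gtr0_norm // ler_wpM2l ?(ltW rho_gt0) //.
apply: le_trans (snormD _ _ n_gt0) _; apply: lerD.
  by apply: le_trans (snorm_outer _ _ n_gt0) _; apply: ler_pM => //; exact: enorm_ge0.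
by apply: le_trans (snorm_outer _ _ n_gt0) _; apply: ler_pM => //; exact: enorm_ge0.
Qed.

Lemma affine_grad i : affine_map c ->
  exists g, forall x, grad (comp_fun c i) x = g.
Proof.
case=> A [b Ab]; exists (row i A)^T => x; apply/colP => j.
rewrite mxE /comp_fun.
have -> : (fun x => c x i 0) = (fun x => dotp (row i A)^T x + b i 0).
  by apply/funext => y; rewrite Ab mxE dotpE trmxK -row_mul [X in _ = X + _]mxE.
have lin (y : 'cV[R]_n) (h : R) :
  h^-1 *: (dotp (row i A)^T (h *: delta_mx j 0 + y) + b i 0
           - (dotp (row i A)^T y + b i 0)) = h^-1 * h * A i j.
  rewrite dotpDr dotpZr (dotpC _ (delta_mx _ _)) dotp_delta !mxE /GRing.scale /=.
  by ring.
rewrite /derive; apply/cvg_lim => //.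
have -> : (fun h : R => h^-1 *: (((fun x0 : 'cV_n => dotp (row i A)^T x0 + b i 0) \o shift x)
   (h *: delta_mx j 0) - (dotp (row i A)^T x + b i 0))) = (fun h : R => h^-1 * h * A i j).
  by apply/funext => h /=; rewrite lin.
rewrite !mxE; apply: cvg_near_cst.
(* The difference quotient is constant only for [h] different from 0. *)
by near=> h; rewrite mulVf ?mul1r //; near: h; exact: nbhs_dnbhs_neq.
Unshelve. all: by end_near.
Qed.

Lemma affine_hess i x : affine_map c -> hess (comp_fun c i) x = 0.
Proof.
move=> /(affine_grad i)[g gE]; apply/matrixP => a b; rewrite !mxE.
have -> : (fun y => grad (comp_fun c i) y a 0) = fun=> g a 0.
  by apply/funext => y; rewrite gE.
by rewrite derive_cst.
Qed.

(** The constraint Hessians vanish and the outer products are constant, so the penalty parameter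
    cancels in the difference. *)
Lemma affine_hess_segment x d : affine_map c ->
  (forall u : R, 0 <= u <= 1 -> Fa (x + u *: d) <= f z) ->
  snorm (hess Fa (x + d) - hess Fa x) <= (1 + K) * enorm d.
Proof.
move=> aff segF.
have Fx : Fa x <= f z by have := segF 0; rewrite scale0r addr0 lexx ler01; apply.
have Fy : Fa (x + d) <= f z by have := segF 1; rewrite scale1r ler01 lexx; apply.
have Sx := level_S Fx; have Sy := level_S Fy.
have [_ _ _ Lf _] := HK; have N0 := enorm_ge0 d.
have xd : x + d - x = d by rewrite addrAC subrr add0r.
rewrite !auglag_hess // opprD addrACA -sumrB big1 ?addr0.
  have := Lf _ _ (S_Omega Sy) (S_Omega Sx); rewrite xd => h.
  by apply: le_trans h _; rewrite ler_wpM2r //; move: K0; lra.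
move=> i _; rewrite !(affine_hess _ _ aff) !scaler0 !add0r.
by have [g gE] := affine_grad i aff; rewrite !gE subrr.
Qed.

End AuglagLipschitz.

(** * The regularity constant is a derivative bound *)

Section RegularityConstant.
Context {R : realType} (n m : nat) (f : 'cV[R]_n -> R) (c : 'cV[R]_n -> 'cV[R]_m).
Variables (S Omega : set 'cV[R]_n).
Hypotheses (n_gt0 : (0 < n)%N) (S_compact : compact S).

Lemma compact_abs_bound (h : 'cV[R]_n -> R) : continuous h ->
  exists B : R, 0 <= B /\ forall x, S x -> `|h x| <= B.
Proof.
move=> ch; have := continuous_compact (continuous_subspaceT ch) S_compact.
move=> /compact_bounded[M [_ hM]]; exists (Num.max 0 (M + 1)); split.
  by rewrite le_max lexx.
move=> x Sx; apply: hM; last by exists x.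
by rewrite lt_max ltrDl ltr01 orbT.
Qed.

Lemma C2_derivatives_bounded (F : 'cV[R]_n -> R) : C2 F ->
  exists B : R, 0 <= B /\ forall x, S x -> enorm (grad F x) <= B /\ snorm (hess F x) <= B.
Proof.
move=> [_ dG cH].
have cg i : continuous (fun x => grad F x i 0).
  by move=> x; apply: differentiable_continuous; exact: differentiable_grad_coord.
have ch (p : 'I_n * 'I_n) : continuous (fun x => hess F x p.1 p.2).
  move=> x; apply: (@continuous_comp _ _ _ (hess F) (fun M : 'M[R]_n => M p.1 p.2)).
    exact: cH.
  exact: coord_continuous.
have [Bg hBg] := choice (fun i => compact_abs_bound (cg i)).
have [Bh hBh] := choice (fun p => compact_abs_bound (ch p)).
have s1 : 0 <= \sum_i Bg i by apply: sumr_ge0 => i _; case: (hBg i).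
have s2 : 0 <= \sum_i \sum_j Bh (i, j).
  by apply: sumr_ge0 => i _; apply: sumr_ge0 => j _; case: (hBh (i, j)).
exists (\sum_i Bg i + \sum_i \sum_j Bh (i, j)); split; first exact: addr_ge0.
move=> x Sx; split.
  apply: (@le_trans _ _ (\sum_i Bg i)); last by rewrite lerDl.
  apply: le_trans (enorm_le_sum _) _; apply: ler_sum => i _.
  by case: (hBg i) => _; apply.
apply: (@le_trans _ _ (\sum_i \sum_j Bh (i, j))); last by rewrite lerDr.
apply: (@le_trans _ _ (row_sum (hess F x))).
  by apply: snorm_le => // v; exact: enorm_mulmx_row_sum.
apply: ler_sum => i _; apply: le_trans (enorm_le_sum _) _; apply: ler_sum => j _.
by case: (hBh (i, j)) => _ /(_ x Sx); rewrite [(_^T) j 0]mxE [row _ _ _ _]mxE.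
Qed.

Lemma hess_lipschitz_le (F : 'cV[R]_n -> R) (L L' : R) : L <= L' ->
  hess_lipschitz F Omega L -> hess_lipschitz F Omega L'.
Proof.
move=> LL h x y Ox Oy; apply: le_trans (h x y Ox Oy) _.
by apply: ler_wpM2r => //; exact: enorm_ge0.
Qed.

Lemma hess_lipschitz_inf (F : 'cV[R]_n -> R) (E : set R) : E !=set0 ->
  (forall k, E k -> hess_lipschitz F Omega k) -> hess_lipschitz F Omega (inf E).
Proof.
move=> E0 h x y Ox Oy; have [xy|xy] := eqVneq (enorm (x - y)) 0.
  by case: E0 => k /h /(_ _ _ Ox Oy); rewrite xy !mulr0.
have xy0 : 0 < enorm (x - y) by rewrite lt_neqAle enorm_ge0 eq_sym xy.
rewrite -ler_pdivrMr //; apply: lb_le_inf => // k /h /(_ _ _ Ox Oy).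
by rewrite ler_pdivrMr.
Qed.

(** Each condition bounds [K] from below by a closed inequality, so it passes to the infimum of a
    nonempty set. The witness [K] of nonemptiness may depend on the dimension, being used for
    nothing else. *)
Lemma regularity_const_attained : C2 f -> (forall i, C2 (comp_fun c i)) ->
  (exists L, hess_lipschitz f Omega L) ->
  (forall i, exists L, hess_lipschitz (comp_fun c i) Omega L) ->
  derivative_bound f c S Omega (regularity_const f c S Omega).
Proof.
move=> Cf Cc [Lf hLf] /choice[Lc hLc].
have [Bf [Bf0 hBf]] := C2_derivatives_bounded Cf.
have [Bc hBc] := choice (fun i => C2_derivatives_bounded (Cc i)).
pose K := Bf + `|Lf| + \sum_i (Bc i + `|Lc i|).
have t0 i : 0 <= Bc i + `|Lc i| by rewrite addr_ge0 //; case: (hBc i).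
have sum0 : 0 <= \sum_i (Bc i + `|Lc i|) by apply: sumr_ge0.
have ti i : Bc i + `|Lc i| <= \sum_i (Bc i + `|Lc i|).
  by rewrite (bigD1 i) //= lerDl sumr_ge0.
have E0 : [set K | derivative_bound f c S Omega K] !=set0.
  exists K; have nf := normr_ge0 Lf; split.
  - by rewrite /K !addr_ge0.
  - by move=> x Sx; have [h1 h2] := hBf x Sx; rewrite /K; split; lra.
  - move=> i x Sx; have [_ /(_ x Sx)[h1 h2]] := hBc i.
    by have := ti i; have := normr_ge0 (Lc i); rewrite /K; split; lra.
  - by apply: hess_lipschitz_le hLf; have := ler_norm Lf; rewrite /K; lra.
  - move=> i; apply: hess_lipschitz_le (hLc i); have [Bi0 _] := hBc i.
    by have := ler_norm (Lc i); have := ti i; rewrite /K; lra.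
have inf_ge v : (forall k, derivative_bound f c S Omega k -> v <= k) ->
  v <= regularity_const f c S Omega by move=> h; apply: lb_le_inf.
split.
- by apply: inf_ge => k [].
- by move=> x Sx; split; apply: inf_ge => k [_ /(_ x Sx)[]].
- by move=> i x Sx; split; apply: inf_ge => k [_ _ /(_ i x Sx)[]].
- by apply: hess_lipschitz_inf => // k [].
- by move=> i; apply: hess_lipschitz_inf E0 _ => k [_ _ _ _ h]; exact: h.
Qed.

End RegularityConstant.

(** * The augmented Lagrangian method *)

Section Tolerances.
Context {R : realType} (P : al_params R).
Hypothesis ratio_gt1 : 1 < al_ratio P.

(** The tolerance is the power of [e] with exponent the minimum of 1 and [k * ln r / ln 2]. It
    matters that this exponent does not depend on [e]: both tolerances share it. *)
Lemma tolerance_expR k : exists b : R, [/\ 0 <= b <= 1,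
  ln 2 <= k%:R * ln (al_ratio P) -> b = 1
  & forall e : R, 0 < e < 1 -> tolerance P e k = expR (b * ln e)].
Proof.
have l2 : 0 < ln (2 : R) by rewrite ln_gt0 ?ltr1n.
have lr : 0 < ln (al_ratio P) by rewrite ln_gt0.
pose a := k%:R * ln (al_ratio P) / ln 2.
have a0 : 0 <= a by rewrite divr_ge0 ?mulr_ge0 // ltW.
exists (Num.min 1 a); split.
- by rewrite le_min ler01 a0 ge_min lexx.
- by move=> h; apply/min_idPl; rewrite ler_pdivlMr // mul1r.
move=> e /andP[e0 e1].
have le0 : ln e < 0 by rewrite ln_lt0 // e0.
rewrite /tolerance /powR gt_eqF ?(lt_trans ltr01) //.
have -> : k%:R * ln e / ln 2 * ln (al_ratio P) = a * ln e by rewrite /a; field; rewrite gt_eqF.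
have -> : e = expR (1 * ln e) by rewrite mul1r lnK.
rewrite expRK !mul1r.
case: (leP 1 a) => h.
  by rewrite mul1r; apply/max_idPl; rewrite ler_expR ler_neMl // ltW.
by apply/max_idPr; rewrite ler_expR -[leLHS]mul1r ler_nM2r // ltW.
Qed.

Lemma tolerance_gt0 (e : R) k : 0 < e -> 0 < tolerance P e k.
Proof. by move=> e0; rewrite lt_max e0. Qed.

Lemma tolerance_ge (e : R) k : e <= tolerance P e k.
Proof. by rewrite le_max lexx. Qed.

Lemma tolerance_final (e : R) k : 0 < e < 1 ->
  ln 2 <= k%:R * ln (al_ratio P) -> tolerance P e k <= e.
Proof.
move=> e01 h; have [b [_ /(_ h) -> ->]] := tolerance_expR k => //.
by case/andP: e01 => e0 _; rewrite mul1r lnK.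
Qed.

Lemma iter_bound_ge1 (e1 e2 : R) : 0 < e2 < 1 -> 1 <= iter_bound e1 e2.
Proof.
case/andP=> e0 e1'; rewrite /iter_bound le_max; apply/orP; right.
by rewrite invf_ge1 ?exprn_gt0 // expr_le1 // ltW.
Qed.

(** The ratio of the squared gradient tolerance to the curvature tolerance need not be monotone in
    the outer index in a fixed direction. Being a power of its final value with exponent in [0, 1],
    it lies between 1 and that value, and [iter_bound] is at least 1. *)
Lemma iter_bound_tolerance (e1 e2 : R) k : 0 < e1 < 1 -> 0 < e2 < 1 ->
  (iter_bound e1 e2)^-1 <=
    Num.min (tolerance P e1 k ^+ 2 / tolerance P e2 k) (tolerance P e2 k ^+ 3).
Proof.
move=> h1 h2; have ib1 := iter_bound_ge1 e1 h2.
have ib0 : 0 < iter_bound e1 e2 by exact: lt_le_trans ib1.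
case/andP: (h1) => e10 e11; case/andP: (h2) => e20 e21.
rewrite le_min; apply/andP; split.
  have [b [/andP[b0 b1] _ tE]] := tolerance_expR k; rewrite !tE //.
  have lib : Num.max 0 (ln e2 - 2 * ln e1) <= ln (iter_bound e1 e2).
    rewrite ge_max ln_ge0 //= -ler_expR lnK ?posrE // expRD expRN expRM_natl.
    by rewrite !lnK ?posrE // mulrC /iter_bound le_max lexx.
  rewrite -[X in X^-1 <= _]lnK ?posrE // -expRN -expRM_natl -expRN -expRD ler_expR.
  have -> : 2 * (b * ln e1) - b * ln e2 = - (b * (ln e2 - 2 * ln e1)) by ring.
  rewrite lerN2; apply: le_trans lib.
  move: (_ - _) => u; have [u0|u0] := leP 0 u.
    by rewrite ler_piMl.
  by rewrite mulr_ge0_le0 // ltW.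
rewrite -[X in _ <= X]invrK lef_pV2 ?posrE ?invr_gt0 ?exprn_gt0 ?tolerance_gt0 //.
rewrite /iter_bound le_max; apply/orP; right.
rewrite lef_pV2 ?posrE ?exprn_gt0 ?tolerance_gt0 //.
by rewrite lerXn2r ?nnegrE ?tolerance_ge // ltW // tolerance_gt0.
Qed.

End Tolerances.

(** * Outer iterations of the augmented Lagrangian method *)

Section ALRuns.
Context {R : realType} (n m : nat) (f : 'cV[R]_n -> R) (c : 'cV[R]_n -> 'cV[R]_m).
Variables (fhi flow gamma df dc K : R) (P : al_params R) (Omega : set 'cV[R]_n).
Variables (eps1 eps2 : R) (z : 'cV[R]_n).
Let Lam := al_Lambda P.
Let rho0 := al_rho0 P.
Hypotheses (n_gt0 : (0 < n)%N) (gamma_gt0 : 0 < gamma).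
Hypotheses (Lam_gt0 : 0 < Lam) (rho0_gt : 2 * gamma < rho0).
Hypotheses (alpha01 : 0 < al_alpha P < 1) (ratio_gt1 : 1 < al_ratio P).
Hypotheses (delta01 : 0 < al_delta P < 1) (theta01 : 0 < al_theta P < 1).
Hypotheses (zeta01 : 0 < al_zeta P < 1) (eta01 : 0 < al_eta P < 1).
Hypothesis rho0_df : Lam ^+ 2 / (2 * rho0) <= df.
Hypothesis rho0_dc : Num.sqrt (2 * infeas_const fhi flow gamma / (rho0 - 2 * gamma)
  + Lam ^+ 2 / (rho0 - 2 * gamma) ^+ 2) + Lam / (rho0 - 2 * gamma) <= dc.
Hypotheses (f_diff : twice_diff f) (c_diff : forall i, twice_diff (comp_fun c i)).
Hypothesis f_low : forall x, flow <= f x + gamma * enorm (c x) ^+ 2 / 2.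
Hypothesis S_Omega : Sset f c fhi df dc `<=` Omega.
Hypothesis HK : derivative_bound f c (Sset f c fhi df dc) Omega K.
Hypotheses (eps1_01 : 0 < eps1 < 1) (eps2_01 : 0 < eps2 < 1).
Hypotheses (z_feas : enorm (c z) <= eps1 / 2) (z_hi : f z <= fhi).
Variables (rhoM Lb : R).
Hypothesis Lb_ge1 : 1 <= Lb.
Hypothesis Lb_lip : forall lam rho x d, enorm lam <= Lam -> rho0 <= rho <= rhoM ->
  (forall u : R, 0 <= u <= 1 -> auglag f c z lam rho (x + u *: d) <= f z) ->
  snorm (hess (auglag f c z lam rho) (x + d) - hess (auglag f c z lam rho) x)
    <= Lb * enorm d.

Let Flow := auglag_low flow gamma Lam rho0.
Let cdec := decrease_const (al_theta P) (al_eta P).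

(** The Lipschitz constant [Lb] is kept abstract: it is where the general case, a multiple of
    [eps1 ^- 2], and the affine case, [1 + K], differ. *)
Definition inner_iterations : R :=
  2 * (fhi - Flow) * (Lb ^+ 2 / cdec) * iter_bound eps1 eps2 + 2.

Definition kappa_bound : R := auglag_hess_bound m dc Lam K rhoM / eps2 + 2.

Definition call_bound : R :=
  5 * Num.min n%:R (subroutine_bound n (al_zeta P) (al_delta P) kappa_bound).

Let rho0_pos : 0 < rho0.
Proof. by apply: lt_trans rho0_gt; rewrite mulr_gt0. Qed.

Let z_half : enorm (c z) <= 1 / 2.
Proof.
case/andP: eps1_01 => _ e1; apply: le_trans z_feas _.
by rewrite ler_pM2r ?invr_gt0 // ltW.
Qed.

Lemma auglag_at_z lam rho : auglag f c z lam rho z = f z.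
Proof.
by rewrite /auglag /ctilde subrr dotp0r enorm0 expr0n mulr0 mul0r !addr0.
Qed.

Lemma auglag_x_init lam rho x :
  auglag f c z lam rho (x_init f c z x lam rho) <= f z.
Proof. by rewrite /x_init; case: ltP => // _; rewrite auglag_at_z. Qed.

Lemma dc_ge0 : 0 <= dc.
Proof.
apply: le_trans rho0_dc; apply: addr_ge0; first exact: sqrtr_ge0.
by rewrite divr_ge0 ?(ltW Lam_gt0) // subr_ge0 ltW.
Qed.

Lemma auglag_hess_bound_le (rho : R) : rho <= rhoM ->
  auglag_hess_bound m dc Lam K rho <= auglag_hess_bound m dc Lam K rhoM.
Proof.
move=> rr; have [K0 _ _ _ _] := HK; have d0 := dc_ge0.
rewrite /auglag_hess_bound lerD2l ler_wpM2l //.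
apply: lerD; last by rewrite ler_wpM2r // sqr_ge0.
by rewrite ler_wpM2r // lerD2l ler_wpM2r.
Qed.

Lemma inner_run_bound k x lam rho N M o : enorm lam <= Lam ->
  rho0 <= rho <= rhoM -> inner_run f c P eps1 eps2 z k x lam rho N M o ->
  [/\ N%:R <= inner_iterations, M%:R <= N%:R * call_bound
    & forall y, o = Some y -> auglag f c z lam rho y <= f z].
Proof.
move=> lamL /andP[r0 rM] run; set Fa := auglag f c z lam rho.
case/andP: (eps1_01) => e10 e11; case/andP: (eps2_01) => e20 e21.
have tg0 : 0 < tolerance P eps1 k := tolerance_gt0 P k e10.
have tH0 : 0 < tolerance P eps2 k := tolerance_gt0 P k e20.
have Fdiff : twice_diff Fa by exact: auglag_twice_diff.
have low y : Flow <= Fa y by exact: auglag_lower.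
have rpos : 0 < rho by exact: lt_le_trans r0.
have lvS y : Fa y <= f z -> Sset f c fhi df dc y.
  exact: (level_Sset gamma_gt0 rho0_gt f_low z_half z_hi lamL r0 rho0_df rho0_dc).
have lvc y : Fa y <= f z -> enorm (ctilde c z y) <= dc.
  exact: (level_ctilde_le gamma_gt0 rho0_gt f_low z_half z_hi lamL r0 rho0_dc).
have prods y M' o' : Fa y <= f z ->
    ncg_call Fa (tolerance P eps1 k) (tolerance P eps2 k) (al_zeta P) (al_delta P) y M' o' ->
    M'%:R <= call_bound.
  move=> Fy call; apply: (ncg_products_le n_gt0 Fdiff tg0 tH0 zeta01 delta01 _ call).
  rewrite /kappa mulrDl mulfK ?gt_eqF // /kappa_bound lerD2r.
  have hb := auglag_hess_le n_gt0 f_diff c_diff lamL rpos lvS lvc HK Fy.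
  apply: ler_pM; [exact: snorm_ge0|by rewrite invr_ge0 ltW| |].
    exact: le_trans hb (auglag_hess_bound_le rM).
  by rewrite lef_pV2 ?posrE // tolerance_ge.
have x0 := auglag_x_init lam rho x.
have lip y d := Lb_lip (x := y) (d := d) lamL.
have {}lip y d : (forall u : R, 0 <= u <= 1 -> Fa (y + u *: d) <= f z) ->
    snorm (hess Fa (y + d) - hess Fa y) <= Lb * enorm d.
  by apply: lip; rewrite r0.
have [h1 _ h3 h4] := newton_cg_bound Fdiff tg0 tH0 theta01 zeta01 eta01 Lb_ge1 lip
  (fun y _ => low y) prods run x0.
split=> //; last by move=> y /h4 /le_trans; apply.
have D0 := decrease_gt0 tg0 tH0 theta01 eta01 Lb_ge1.
have c0 : 0 < cdec := decrease_const_gt0 theta01 eta01.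
have L0 : 0 < Lb by exact: lt_le_trans Lb_ge1.
have iD : (decrease (tolerance P eps1 k) (tolerance P eps2 k) (al_theta P) (al_eta P) Lb)^-1
    <= Lb ^+ 2 / cdec * iter_bound eps1 eps2.
  rewrite -[leRHS]invrK lef_pV2 ?posrE //; last first.
    rewrite invr_gt0; apply: mulr_gt0; first by apply: divr_gt0 => //; exact: exprn_gt0.
    exact: (lt_le_trans ltr01 (iter_bound_ge1 _ eps2_01)).
  rewrite invfM invf_div /decrease ler_wpM2l ?iter_bound_tolerance //.
  by apply: divr_ge0; [exact: ltW|rewrite exprn_ge0 // ltW].
move: D0 iD h1; rewrite /inner_iterations; move: (decrease _ _ _ _ _) => D D0 iD h1.
have lowx := low (x_init f c z x lam rho).
have {}h1 : N%:R <= 2 * (fhi - Flow) * D^-1 + 2.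
  rewrite -(ler_pM2r D0) mulrDl mulfVK ?gt_eqF //; apply: le_trans h1 _.
  by rewrite lerD2r ler_pM2l // lerD2r (le_trans x0).
apply: le_trans h1 _; rewrite lerD2r -(mulrA (2 * (fhi - Flow))) ler_wpM2l // mulr_ge0 // subr_ge0.
by apply: le_trans lowx _; exact: le_trans x0 z_hi.
Qed.

Variables (K0 I0 J0 : nat).
Hypothesis K0_final : forall k, (K0 <= k)%N -> ln 2 <= k%:R * ln (al_ratio P).
Hypothesis I0_large : (2 * gamma + 8 * infeas_const fhi flow gamma + 4 * Lam) * eps1 ^- 2
  < rho0 * al_ratio P ^+ I0.
Hypothesis J0_small : al_alpha P ^+ J0 * dc <= eps1 / 2.
Hypothesis rhoM_large : rho0 * al_ratio P ^+ (I0 + K0) <= rhoM.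

Let I1 := (I0 + K0)%N.
Let J1 := (J0 + K0).+1.

(** Once the tolerances are final, only the feasibility test can fail. The point [z] accounts for at
    most half of [eps1], so [ctilde] exceeds the other half, which limits the penalty parameter. *)
Lemma al_stop_fails k x' lam rho : (K0 <= k)%N -> enorm lam <= Lam ->
  auglag f c z lam rho x' <= f z -> ~~ al_stop c P eps1 eps2 k x' ->
  eps1 / 2 < enorm (ctilde c z x') /\
  rho <= (2 * gamma + 8 * infeas_const fhi flow gamma + 4 * Lam) * eps1 ^- 2.
Proof.
move=> /K0_final kK lamL lv.
rewrite /al_stop !tolerance_final //= -ltNge => cx.
have h : eps1 / 2 < enorm (ctilde c z x').
  have : enorm (c x') <= enorm (ctilde c z x') + enorm (c z).
    by rewrite -{1}(subrK (c z) (c x')); exact: enormD.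
  by move: cx z_feas; lra.
split=> //; apply: (level_infeas_rho gamma_gt0 Lam_gt0 f_low z_half z_hi lamL _ lv h).
by case/andP: eps1_01 => -> /ltW ->.
Qed.

(* [i] counts the increases of the penalty parameter so far, [s] the outer
   iterations since the last one; both are at most [k], which handles the
   first [K0] iterations, whose tolerances are not yet the final ones. *)
Lemma al_run_bound k x lam rho N M : al_run f c P eps1 eps2 z k x lam rho N M ->
  forall i s, enorm lam <= Lam -> rho = rho0 * al_ratio P ^+ i ->
  (i <= I1)%N -> (i <= k)%N -> (s < J1)%N -> (s <= k)%N ->
  ((0 < k)%N -> enorm (ctilde c z x) <= al_alpha P ^+ s * dc) ->
  let calls := ((I1 - i) * J1 + (J1 - s)).+1 in
  N%:R <= calls%:R * inner_iterations /\
  M%:R <= calls%:R * inner_iterations * call_bound.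
Proof.
have d0 := dc_ge0.
have r1 : 0 < al_ratio P by exact: lt_trans ratio_gt1.
have a0 : 0 < al_alpha P by case/andP: alpha01.
have rho_range i : (i <= I1)%N -> rho0 <= rho0 * al_ratio P ^+ i <= rhoM.
  move=> iI; rewrite ler_peMr ?(ltW rho0_pos) ?exprn_ege1 ?(ltW ratio_gt1) //=.
  apply: le_trans rhoM_large; rewrite ler_pM2l // ler_weXn2l // ltW //.
have single k' x' lam' rho' N' M' o i : enorm lam' <= Lam ->
    rho' = rho0 * al_ratio P ^+ i -> (i <= I1)%N ->
    inner_run f c P eps1 eps2 z k' x' lam' rho' N' M' o ->
    [/\ N'%:R <= inner_iterations, M'%:R <= inner_iterations * call_bound,
        0 <= inner_iterations, 0 <= call_bound
      & forall y, o = Some y -> auglag f c z lam' rho' y <= f z].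
  move=> lamL rE iI run; have rr := rho_range i iI; rewrite -rE in rr.
  have [h1 h2 h3] := inner_run_bound lamL rr run.
  have K0' : 0 <= inner_iterations by exact: le_trans h1.
  have kb : 2 <= kappa_bound.
    rewrite /kappa_bound lerDr divr_ge0 //; last by case/andP: eps2_01 => /ltW.
    have [KK _ _ _ _] := HK; case/andP: (rho_range 0%N isT) => _ rM0.
    have rM : 0 <= rhoM by apply: le_trans rM0; rewrite expr0 mulr1 ltW.
    rewrite /auglag_hess_bound; apply: addr_ge0 => //; apply: mulr_ge0 => //.
    apply: addr_ge0; apply: mulr_ge0 => //; last exact: sqr_ge0.
    by apply: addr_ge0; [exact: ltW|exact: mulr_ge0].
  have cb : 0 <= call_bound.
    by rewrite /call_bound mulr_ge0 // le_min ler0n subroutine_bound_ge0.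
  split=> //; apply: le_trans h2 _; exact: ler_wpM2r.
elim=> {k x lam rho N M} [k x lam rho N M run|k x lam rho N M x' run st|
    k x lam rho N M x' lam' N' M' run nst [lamB _] _ IH] i s lamL rE iI ik sJ sk xb /=.
- have [h1 h2 i0 c0 _] := single _ _ _ _ _ _ _ _ lamL rE iI run.
  split; first by apply: le_trans h1 _; rewrite ler_peMl // ler1n.
  by apply: le_trans h2 _; rewrite ler_wpM2r // ler_peMl // ler1n.
- have [h1 h2 i0 c0 _] := single _ _ _ _ _ _ _ _ lamL rE iI run.
  split; first by apply: le_trans h1 _; rewrite ler_peMl // ler1n.
  by apply: le_trans h2 _; rewrite ler_wpM2r // ler_peMl // ler1n.
have [h1 h2 i0 c0 lv] := single _ _ _ _ _ _ _ _ lamL rE iI run.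
have {}lv := lv x' erefl.
have rr := rho_range i iI; rewrite -rE in rr; case/andP: rr => r0 rM.
have ctb : enorm (ctilde c z x') <= dc.
  exact: (level_ctilde_le gamma_gt0 rho0_gt f_low z_half z_hi lamL r0 rho0_dc lv).
(* The remaining count is lexicographic: an increase of the penalty lowers the first component and
   resets the second; any other iteration lowers the second. *)
have [j [t [rE' jI jk [tJ tk] [xb' pot]]]] : exists j t,
    [/\ rho_next c P z k x x' rho = rho0 * al_ratio P ^+ j,
        (j <= I1)%N, (j <= k.+1)%N, (t < J1)%N /\ (t <= k.+1)%N
      & enorm (ctilde c z x') <= al_alpha P ^+ t * dc /\
        ((I1 - j) * J1 + (J1 - t) < (I1 - i) * J1 + (J1 - s))%N].
  rewrite /rho_next; case: ifP => [_|/negbT].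
    have iI1 : (i < I1)%N.
      have [kK|kK] := leqP K0 k; last first.
        by rewrite /I1 ltn_addl // (leq_ltn_trans ik).
      have [_ rD] := al_stop_fails kK lamL lv nst.
      rewrite /I1 ltn_addr //; rewrite ltnNge; apply/negP => Ii.
      have := le_lt_trans rD I0_large; rewrite rE ltr_pM2l // ltNge.
      by rewrite ler_weXn2l // ltW.
    exists i.+1, 0%N; split=> //; first by rewrite rE exprS; ring.
    split; first by rewrite expr0 mul1r.
    by rewrite subn0 addnC -mulSn subnSK // -[ltnLHS]addn0 ltn_add2l subn_gt0.
  (* Without an increase the index [k] is positive, so the infeasibility of [x] is under control;
     that of the arbitrary starting point is not. *)
  rewrite negb_or -leNgt => /andP[k0 xx'].
  have xb1 : enorm (ctilde c z x') <= al_alpha P ^+ s.+1 * dc.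
    apply: le_trans xx' _; rewrite exprS -mulrA ler_pM2l //.
    by apply: xb; rewrite lt0n.
  have sJ1 : (s.+1 < J1)%N.
    rewrite /J1 ltnS; have [kK|kK] := leqP K0 k; last first.
      by rewrite ltn_addl // (leq_ltn_trans sk).
    have [ct _] := al_stop_fails kK lamL lv nst.
    rewrite ltn_addr // ltnNge; apply/negP => Js.
    have := lt_le_trans ct xb1; rewrite ltNge => /negP; apply.
    apply: le_trans J0_small; rewrite ler_wpM2r // ler_wiXn2l ?(ltW a0) //.
      by case/andP: alpha01 => _ /ltW.
    exact: leq_trans Js _.
  exists i, s.+1; split=> //; first exact: leqW.
  split=> //; rewrite ltn_add2l ltn_sub2l //.
have [g1 g2] := IH j t lamB rE' jI jk tJ tk (fun _ => xb').
have big : ((I1 - j) * J1 + (J1 - t)).+1%:R + 1 <=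
    ((I1 - i) * J1 + (J1 - s)).+1%:R :> R.
  by rewrite natr1 ler_nat ltnS.
have big1 := ler_wpM2r i0 big; rewrite mulrDl mul1r in big1.
have big2 := ler_wpM2r c0 big1; rewrite mulrDl in big2.
split; rewrite natrD addrC; [apply: le_trans big1|apply: le_trans big2]; exact: lerD.
Qed.

End ALRuns.

(** * Orders of magnitude *)

Section Orders.
Context {R : realType}.

Lemma truncn_le_norm (y : R) : (Num.truncn y)%:R <= `|y|.
Proof.
have [y0|y0] := leP 0 y; first by rewrite (le_trans _ (ler_norm _)) // truncn_le.
suff -> : Num.truncn y = 0%N by [].
by apply/eqP; rewrite -leqn0 truncn_le_nat (lt_trans y0).
Qed.

Lemma log_inv_ge0 (e1 : R) : 0 < e1 < 1 -> 0 <= ln e1^-1.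
Proof. by case/andP=> e0 e1'; rewrite ln_ge0 // invf_ge1 // ltW. Qed.

Lemma log_eps_ge1 (e1 e2 : R) : 0 < e1 < 1 -> 0 < e2 < 1 -> 1 <= log_eps e1 e2.
Proof.
by move=> /log_inv_ge0 h1 /log_inv_ge0 h2; rewrite /log_eps -addrA lerDl addr_ge0.
Qed.

Lemma log_inv_le (e1 e2 : R) : 0 < e2 < 1 -> 1 + ln e1^-1 <= log_eps e1 e2.
Proof. by move=> /log_inv_ge0 h; rewrite /log_eps lerDl. Qed.

Lemma log_eps_le_dim n (e1 e2 : R) : (0 < n)%N -> log_eps e1 e2 <= log_eps_dim n e1 e2.
Proof. by move=> n0; rewrite /log_eps_dim lerDl ln_ge0 // ler1n. Qed.

Lemma inv_sqr_ge1 (e1 : R) : 0 < e1 < 1 -> 1 <= e1 ^- 2.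
Proof. by case/andP=> e0 e1'; rewrite invf_ge1 ?exprn_gt0 // expr_le1 // ltW. Qed.

(** The 8 comes from the fourth power of [e1 ^- 2 / e2] inside the logarithm, the 1 from the [ln n]
    in the Lanczos limit. *)
Definition subroutine_const (zeta delta Kc : R) : R :=
  2 + 2 * (Num.sqrt Kc + 1) * (`|ln (24 * Kc ^+ 4 / zeta)| + 8)
  + (`|ln (11 / 4 / delta ^+ 2)| + 1) / 2 * Num.sqrt Kc.

Lemma subroutine_const_ge0 (zeta delta Kc : R) : 0 <= subroutine_const zeta delta Kc.
Proof.
have s0 := sqrtr_ge0 Kc.
rewrite /subroutine_const; apply: addr_ge0.
  by apply: addr_ge0 => //; rewrite mulr_ge0 ?mulr_ge0 ?addr_ge0.
by rewrite mulr_ge0 // divr_ge0 // addr_ge0.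
Qed.

(** [e1 ^- 2 / e2] is the square of the quantity [X] in [mv_factor], so the square root of the
    condition number is of order [X]. The remaining factors are logarithms, including that of the
    dimension. *)
Lemma subroutine_bound_le n (zeta delta Kc Km e1 e2 : R) : (0 < n)%N ->
  0 < e1 < 1 -> 0 < e2 < 1 -> 0 < zeta < 1 -> 0 < delta < 1 -> 1 <= Kc ->
  2 <= Km -> Km <= Kc * (e1 ^- 2 / e2) ->
  Num.min n%:R (subroutine_bound n zeta delta Km)
    <= (1 + subroutine_const zeta delta Kc) *
       (mv_factor n e1 e2 * log_eps_dim n e1 e2).
Proof.
move=> n0 h1 h2 z01 d01 Kc1 Km2 KmK.
have l1 := log_eps_ge1 h1 h2; have ld := log_eps_le_dim e1 e2 n0.
have x0 := log_inv_ge0 h1; have y0 := log_inv_ge0 h2.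
case/andP: h1 => e10 e11; case/andP: h2 => e20 e21.
case/andP: z01 => z0 z1; case/andP: d01 => d0 d1.
set l := log_eps_dim n e1 e2 in ld *.
set X := e1^-1 * (Num.sqrt e2)^-1.
have s20 : 0 < Num.sqrt e2 by rewrite sqrtr_gt0.
have s21 : Num.sqrt e2 <= 1 by rewrite -sqrtr1 ler_sqrt // ltW.
have X1 : 1 <= X.
  by rewrite -[1]mulr1; apply: ler_pM => //; rewrite invf_ge1 // ltW.
have X2 : e1 ^- 2 / e2 = X ^+ 2 by rewrite /X exprMn !exprVn sqr_sqrtr // ltW.
have sK : Num.sqrt Km <= Num.sqrt Kc * X.
  rewrite -[X]ger0_norm; last exact: le_trans X1.
  rewrite -sqrtr_sqr -sqrtrM; last exact: le_trans Kc1.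
  by rewrite -X2 ler_sqrt // (le_trans _ KmK) // (le_trans _ Km2).
have Km0 : 0 < Km by apply: lt_le_trans Km2.
have Kc0 : 0 < Kc by apply: lt_le_trans Kc1.
have X0 : 0 < X by apply: lt_le_trans X1.
have lnX2 : ln (e1 ^- 2 / e2) = 2 * ln e1^-1 + ln e2^-1.
  rewrite lnM ?posrE ?invr_gt0 ?exprn_gt0 // -exprVn lnXn ?invr_gt0 //.
  by rewrite mulr_natl.
have ln1 : ln (24 * Km ^+ 4 / zeta) <= (`|ln (24 * Kc ^+ 4 / zeta)| + 8) * l.
  have le1 : 24 * Km ^+ 4 / zeta <= 24 * Kc ^+ 4 / zeta * (e1 ^- 2 / e2) ^+ 4.
    have -> : 24 * Kc ^+ 4 / zeta * (e1 ^- 2 / e2) ^+ 4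
      = 24 * (Kc * (e1 ^- 2 / e2)) ^+ 4 / zeta by rewrite [in RHS]exprMn; ring.
    rewrite ler_wpM2r ?invr_ge0 ?(ltW z0) // ler_wpM2l //.
    by rewrite lerXn2r ?nnegrE ?(ltW Km0) // (le_trans _ KmK) // ltW.
  have p1 : 0 < 24 * Kc ^+ 4 / zeta by rewrite divr_gt0 // mulr_gt0 // exprn_gt0.
  have p2 : 0 < e1 ^- 2 / e2 by rewrite divr_gt0 // invr_gt0 exprn_gt0.
  have p3 : 0 < 24 * Km ^+ 4 / zeta by rewrite divr_gt0 // mulr_gt0 // exprn_gt0.
  have le2 : ln (24 * Km ^+ 4 / zeta) <= ln (24 * Kc ^+ 4 / zeta) + 4 * ln (e1 ^- 2 / e2).
    apply: (@le_trans _ _ (ln (24 * Kc ^+ 4 / zeta * (e1 ^- 2 / e2) ^+ 4))).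
      by rewrite ler_ln ?posrE // mulr_gt0 // exprn_gt0.
    by rewrite lnM ?posrE ?exprn_gt0 // lnXn // (mulr_natl (ln _) 4).
  apply: le_trans le2 _; rewrite lnX2.
  have a0 := ler_norm (ln (24 * Kc ^+ 4 / zeta)).
  have a1 : `|ln (24 * Kc ^+ 4 / zeta)| * 1 <= `|ln (24 * Kc ^+ 4 / zeta)| * l.
    by rewrite ler_wpM2l //; exact: (le_trans l1 ld).
  move: l1 ld a0 a1; rewrite /log_eps.
  by move: (ln (_ / zeta)) `|_| (ln e1^-1) (ln e2^-1) x0 y0 => u v x y x0 y0; lra.
have ln2 : ln (11 / 4 * n%:R / delta ^+ 2) <= (`|ln (11 / 4 / delta ^+ 2)| + 1) * l.
  have n0' : 0 < n%:R :> R by rewrite ltr0n.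
  rewrite mulrAC lnM ?posrE // ?divr_gt0 ?exprn_gt0 //.
  have a0 := ler_norm (ln (11 / 4 / delta ^+ 2)).
  have a1 : `|ln (11 / 4 / delta ^+ 2)| * 1 <= `|ln (11 / 4 / delta ^+ 2)| * l.
    by rewrite ler_wpM2l //; exact: (le_trans l1 ld).
  have : ln n%:R <= l by rewrite /l /log_eps_dim lerDr (le_trans _ l1).
  by move: a0 a1; move: (ln (_ / _)) `|_| (ln n%:R) => u v w; lra.
have l0 : 1 <= l by exact: (le_trans l1 ld).
have sc0 := sqrtr_ge0 Kc.
have B : subroutine_bound n zeta delta Km <= subroutine_const zeta delta Kc * (X * l).
  rewrite /subroutine_bound /subroutine_const.
  have lk0 : 0 <= ln (24 * Km ^+ 4 / zeta) by apply: ln_kappa_ge0 => //; rewrite z0.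
  have ld0 : 0 <= ln (11 / 4 * n%:R / delta ^+ 2) by apply: ln_dim_ge0 => //; rewrite d0.
  rewrite [leRHS](_ : _ = 2 * (X * l)
    + 2 * (Num.sqrt Kc + 1) * (`|ln (24 * Kc ^+ 4 / zeta)| + 8) * (X * l)
    + (`|ln (11 / 4 / delta ^+ 2)| + 1) / 2 * Num.sqrt Kc * (X * l)); last by ring.
  apply: lerD; first apply: lerD.
  - rewrite -[leLHS]mulr1 ler_wpM2l // -[leLHS]mulr1.
    by apply: ler_pM.
  - have -> : 2 * (Num.sqrt Kc + 1) * (`|ln (24 * Kc ^+ 4 / zeta)| + 8) * (X * l)
      = (2 * ((Num.sqrt Kc + 1) * X)) * ((`|ln (24 * Kc ^+ 4 / zeta)| + 8) * l) by ring.
    apply: ler_pM; [by rewrite mulr_ge0 // addr_ge0 // sqrtr_ge0|exact: lk0| |exact: ln1].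
    by rewrite ler_wpM2l // mulrDl mul1r; exact: lerD.
  - have -> : (`|ln (11 / 4 / delta ^+ 2)| + 1) / 2 * Num.sqrt Kc * (X * l)
      = ((`|ln (11 / 4 / delta ^+ 2)| + 1) * l / 2) * (Num.sqrt Kc * X) by ring.
    apply: ler_pM; [by rewrite divr_ge0|exact: sqrtr_ge0| |exact: sK].
    by rewrite ler_wpM2r // invr_ge0.
have C0 := subroutine_const_ge0 zeta delta Kc.
move: (subroutine_const _ _ _) C0 B => C C0 B.
rewrite /mv_factor -/X.
have nn : 0 <= n%:R :> R by [].
(* If [n] is the minimum, the summand 1 of the prefactor suffices; otherwise [C] does. *)
have [nX|nX] := leP n%:R X.
  apply: (@le_trans _ _ n%:R); first by rewrite ge_min lexx.
  rewrite mulrCA ler_peMr // -[leLHS]mulr1; apply: ler_pM => //.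
  by rewrite lerDl.
apply: (@le_trans _ _ (C * (X * l))); first by rewrite ge_min B orbT.
rewrite ler_wpM2r ?lerDr // mulr_ge0 ?(ltW X0) // (le_trans _ l0) //.
Qed.

End Orders.

(** * The explicit constants and their growth *)

Section Constants.
Context {R : realType} (m : nat) (fhi flow gamma dc : R) (P : al_params R).

Let r := al_ratio P.
Let penalty_const : R := 2 * gamma + 8 * infeas_const fhi flow gamma + 4 * al_Lambda P.

(** From this index on the exponent [k * ln r / ln 2] is at least 1 and the tolerances are final.
    Here and below, truncation of a negative number gives 0, which only helps. *)
Definition final_index : nat := (Num.truncn (ln 2 / ln r)).+1.

(** So many multiplications by [r] lift [al_rho0 P] strictly above the largest penalty compatible
    with infeasibility. *)
Definition increase_index (e : R) : nat :=
  (Num.truncn (ln (penalty_const * e ^- 2 / al_rho0 P) / ln r)).+1.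

(** So many contractions by alpha bring the infeasibility from [dc] down to [e / 2]. *)
Definition contraction_index (e : R) : nat :=
  (Num.truncn (ln (2 * dc / e) / - ln (al_alpha P))).+1.

Definition increase_const : R :=
  (`|ln (penalty_const / al_rho0 P)| + 2) / ln r + 1.

Definition contraction_const : R :=
  (`|ln (2 * dc)| + 1) / - ln (al_alpha P) + 1.

Definition calls_const : R :=
  (increase_const + final_index%:R + 1) * (contraction_const + final_index%:R + 1) + 1.

Definition rho_const : R := r ^+ final_index.+1 * (al_rho0 P + penalty_const).

Definition descent_const : R :=
  2 * (fhi - auglag_low flow gamma (al_Lambda P) (al_rho0 P))
    / decrease_const (al_theta P) (al_eta P) + 2.

Definition lip_const (K : R) : R := auglag_lip m dc (al_Lambda P) K rho_const.

Definition kappa_const (K : R) : R :=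
  auglag_hess_bound m dc (al_Lambda P) K rho_const + 2.

Definition iter_const (K : R) : R := calls_const * descent_const * lip_const K ^+ 2.

Definition products_const (K : R) : R :=
  5 * (1 + subroutine_const (al_zeta P) (al_delta P) (kappa_const K)).

Definition total_const (K : R) : R := iter_const K * (1 + products_const K).

Hypotheses (gamma_gt0 : 0 < gamma) (dc_gt0 : 0 < dc) (Lam_gt0 : 0 < al_Lambda P).
Hypotheses (rho0_gt : 2 * gamma < al_rho0 P) (alpha01 : 0 < al_alpha P < 1).
Hypotheses (ratio_gt1 : 1 < al_ratio P).
Hypothesis A_ge0 : 0 <= infeas_const fhi flow gamma.

Let r0 : 0 < r. Proof. exact: lt_trans ratio_gt1. Qed.
Let lr : 0 < ln r. Proof. by rewrite ln_gt0. Qed.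
Let la : 0 < - ln (al_alpha P). Proof. by rewrite oppr_gt0 ln_lt0. Qed.
Let rho0_pos : 0 < al_rho0 P.
Proof. by apply: lt_trans rho0_gt; rewrite mulr_gt0. Qed.
Let penalty_gt0 : 0 < penalty_const.
Proof. by rewrite /penalty_const !ltr_wpDr ?mulr_gt0 ?mulr_ge0 // ltW. Qed.

Lemma final_indexP k : (final_index <= k)%N -> ln 2 <= k%:R * ln r.
Proof.
move=> h; rewrite -ler_pdivrMr //; apply: ltW; apply: lt_le_trans (truncnS_gt _) _.
by rewrite ler_nat.
Qed.

Lemma increase_indexP (e : R) : 0 < e < 1 ->
  penalty_const * e ^- 2 < al_rho0 P * r ^+ increase_index e.
Proof.
case/andP=> e0 e1; have q0 : 0 < penalty_const * e ^- 2 / al_rho0 P.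
  by rewrite divr_gt0 // mulr_gt0 // invr_gt0 exprn_gt0.
rewrite -ltr_pdivrMl // mulrC -ltr_ln ?posrE ?exprn_gt0 // lnXn // -mulr_natl.
by rewrite -ltr_pdivrMr //; exact: truncnS_gt.
Qed.

Lemma contraction_indexP (e : R) : 0 < e < 1 ->
  al_alpha P ^+ contraction_index e * dc <= e / 2.
Proof.
case/andP=> e0 e1; case/andP: (alpha01) => a0 a1.
have q0 : 0 < 2 * dc / e by rewrite divr_gt0 // mulr_gt0.
rewrite -ler_pdivlMr //.
have -> : e / 2 / dc = (2 * dc / e)^-1 by field; rewrite !gt_eqF.
rewrite -ler_ln ?posrE ?invr_gt0 ?exprn_gt0 // lnXn // lnV ?posrE //.
rewrite lerNr -(mulr_natl (ln (al_alpha P))) -mulrN -ler_pdivrMr //.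
by apply: ltW; exact: truncnS_gt.
Qed.

Lemma ln_inv_sqr (e : R) : 0 < e -> ln (e ^- 2) = 2 * ln e^-1.
Proof. by move=> e0; rewrite -exprVn lnXn ?invr_gt0 // mulr_natl. Qed.

Lemma increase_index_le (e l : R) : 0 < e < 1 -> 1 + ln e^-1 <= l ->
  (increase_index e)%:R <= increase_const * l.
Proof.
move=> h hl; have x0 := log_inv_ge0 h; case/andP: h => e0 e1.
rewrite /increase_index /increase_const -natr1.
have l1 : 1 <= l by apply: le_trans hl; rewrite lerDl.
rewrite [leRHS]mulrDl mul1r; apply: lerD => //.
apply: le_trans (truncn_le_norm _) _; rewrite normrM normfV (gtr0_norm lr) [leRHS]mulrAC.
rewrite ler_pM2r ?invr_gt0 //.
have q1 : 0 < penalty_const / al_rho0 P by rewrite divr_gt0.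
have -> : ln (penalty_const * e ^- 2 / al_rho0 P) = ln (penalty_const / al_rho0 P) + 2 * ln e^-1.
  by rewrite -ln_inv_sqr // -lnM ?posrE ?invr_gt0 ?exprn_gt0 // mulrAC.
apply: le_trans (ler_normD _ _) _; rewrite [leRHS]mulrDl; apply: lerD; first by rewrite ler_peMr.
by rewrite ger0_norm ?mulr_ge0 // ler_pM2l // (le_trans _ hl) // lerDr.
Qed.

Lemma contraction_index_le (e l : R) : 0 < e < 1 -> 1 + ln e^-1 <= l ->
  (contraction_index e)%:R <= contraction_const * l.
Proof.
move=> h hl; have x0 := log_inv_ge0 h; case/andP: h => e0 e1.
rewrite /contraction_index /contraction_const -natr1.
have l1 : 1 <= l by apply: le_trans hl; rewrite lerDl.
rewrite [leRHS]mulrDl mul1r; apply: lerD => //.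
apply: le_trans (truncn_le_norm _) _; rewrite normrM normfV (gtr0_norm la) [leRHS]mulrAC.
rewrite ler_pM2r ?invr_gt0 // lnM ?posrE ?mulr_gt0 ?invr_gt0 //.
apply: le_trans (ler_normD _ _) _; rewrite [leRHS]mulrDl mul1r; apply: lerD.
  by rewrite ler_peMr.
by rewrite ger0_norm // (le_trans _ hl) // lerDr.
Qed.

(** The successor in [increase_index] and the iterations before the final tolerances cost the factor
    [r ^+ final_index.+1]. The rest is [al_rho0 P] if the truncated logarithm is 0 by negativity,
    and at most [penalty_const * e ^- 2] otherwise; [rho_const] adds the two. *)
Lemma rho_max_le (e : R) : 0 < e < 1 ->
  al_rho0 P * r ^+ (increase_index e + final_index) <= rho_const * e ^- 2.
Proof.
move=> h; have q1 := inv_sqr_ge1 h; case/andP: h => e0 e1.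
have -> : al_rho0 P * r ^+ (increase_index e + final_index) =
  r ^+ final_index.+1 *
  (al_rho0 P * r ^+ Num.truncn (ln (penalty_const * e ^- 2 / al_rho0 P) / ln r)).
  by rewrite /increase_index addSnnS exprD mulrA mulrC.
rewrite /rho_const -[leRHS]mulrA ler_pM2l ?exprn_gt0 //.
set y := ln _ / _.
have p0 : 0 < penalty_const * e ^- 2 by rewrite mulr_gt0 // invr_gt0 exprn_gt0.
have [y0|y0] := leP 0 y; last first.
  have -> : Num.truncn y = 0%N by apply/eqP; rewrite -leqn0 truncn_le_nat (lt_trans y0).
  rewrite expr0 mulr1 mulrDl; apply: (@le_trans _ _ (al_rho0 P * e ^- 2)).
    by rewrite ler_peMr // ltW.
  by rewrite lerDl ltW.
apply: (@le_trans _ _ (penalty_const * e ^- 2)).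
  rewrite -ler_pdivlMl // mulrC -ler_ln ?posrE ?exprn_gt0 ?divr_gt0 ?exprn_gt0 //.
  by rewrite lnXn // -mulr_natl -ler_pdivlMr // truncn_le.
by rewrite ler_wpM2r ?invr_ge0 ?exprn_ge0 ?(ltW e0) // lerDr ltW.
Qed.

Lemma calls_le (e l : R) : 0 < e < 1 -> 1 + ln e^-1 <= l ->
  (((increase_index e + final_index - 0) * (contraction_index e + final_index).+1
    + ((contraction_index e + final_index).+1 - 0)).+1)%:R <= calls_const * l ^+ 2.
Proof.
move=> h hl; have hi := increase_index_le h hl; have hc := contraction_index_le h hl.
have l1 : 1 <= l by apply: le_trans hl; rewrite lerDl; exact: log_inv_ge0.
rewrite !subn0 addnC -mulSn -natr1 natrM /calls_const [leRHS]mulrDl mul1r.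
apply: lerD; last by rewrite exprn_ege1.
rewrite expr2 mulrACA; apply: ler_pM => //.
  rewrite -natr1 natrD (mulrDl (increase_const + _)) (mulrDl increase_const) mul1r.
  by apply: lerD => //; apply: lerD => //; rewrite ler_peMr.
rewrite -natr1 natrD (mulrDl (contraction_const + _)) (mulrDl contraction_const) mul1r.
by apply: lerD => //; apply: lerD => //; rewrite ler_peMr.
Qed.

Lemma rho_const_ge0 : 0 <= rho_const.
Proof. by apply: mulr_ge0; [rewrite exprn_ge0 // ltW|apply: addr_ge0; exact: ltW]. Qed.

Lemma calls_const_ge0 : 0 <= calls_const.
Proof.
have i0 : 0 <= increase_const.
  by apply: addr_ge0 => //; apply: divr_ge0; [exact: addr_ge0|exact: ltW].
have c0 : 0 <= contraction_const.
  by apply: addr_ge0 => //; apply: divr_ge0; [exact: addr_ge0|exact: ltW].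
by apply: addr_ge0 => //; apply: mulr_ge0; do 2! apply: addr_ge0 => //.
Qed.

Lemma products_const_ge0 K : 0 <= products_const K.
Proof. by apply: mulr_ge0 => //; apply: addr_ge0 => //; exact: subroutine_const_ge0. Qed.

(** [auglag_lip] is affine in [rho] with nonnegative coefficients, so scaling [rho] by [q >= 1]
    scales it by at most [q]. *)
Lemma lip_const_scale (K q : R) : 0 <= K -> 1 <= q ->
  auglag_lip m dc (al_Lambda P) K (rho_const * q) <= lip_const K * q.
Proof.
move=> K0 q1; rewrite /lip_const /auglag_lip; have r1 := rho_const_ge0.
have m0 : 0 <= m%:R :> R by [].
have -> : (1 + K + m%:R * ((al_Lambda P + rho_const * dc) * K
    + 3 * (rho_const * K ^+ 2))) * q = (1 + K + m%:R * (al_Lambda P * K)) * q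
  + m%:R * (rho_const * q * dc * K + 3 * (rho_const * q * K ^+ 2)) by ring.
have -> : 1 + K + m%:R * ((al_Lambda P + rho_const * q * dc) * K
    + 3 * (rho_const * q * K ^+ 2)) = (1 + K + m%:R * (al_Lambda P * K))
  + m%:R * (rho_const * q * dc * K + 3 * (rho_const * q * K ^+ 2)) by ring.
rewrite lerD2r ler_peMr //; apply: addr_ge0; first exact: addr_ge0.
by do 2! apply: mulr_ge0 => //; exact: ltW.
Qed.

Lemma kappa_const_scale (K q e2 : R) : 0 <= K -> 1 <= q -> 0 < e2 < 1 ->
  auglag_hess_bound m dc (al_Lambda P) K (rho_const * q) / e2 + 2
    <= kappa_const K * (q / e2).
Proof.
move=> K0 q1 /andP[e0 e1]; rewrite /kappa_const /auglag_hess_bound.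
have r1 := rho_const_ge0; have m0 : 0 <= m%:R :> R by [].
have -> : (K + m%:R * ((al_Lambda P + rho_const * dc) * K + rho_const * K ^+ 2) + 2)
    * (q / e2) = ((K + m%:R * (al_Lambda P * K)) * q
    + m%:R * (rho_const * q * dc * K + rho_const * q * K ^+ 2)) / e2
    + 2 * (q / e2) by ring.
apply: lerD.
  have -> : K + m%:R * ((al_Lambda P + rho_const * q * dc) * K + rho_const * q * K ^+ 2)
    = K + m%:R * (al_Lambda P * K)
      + m%:R * (rho_const * q * dc * K + rho_const * q * K ^+ 2) by ring.
  rewrite ler_pM2r ?invr_gt0 // lerD2r ler_peMr //; apply: addr_ge0 => //.
  by do 2! apply: mulr_ge0 => //; exact: ltW.
by rewrite ler_peMr // ler_pdivlMr // mul1r (le_trans (ltW e1)).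
Qed.

End Constants.

(** * Total complexity *)

Section Totals.
Context {R : realType} (n m : nat) (f : 'cV[R]_n -> R) (c : 'cV[R]_n -> 'cV[R]_m).
Variables (fhi flow gamma df dc K : R) (P : al_params R) (Omega : set 'cV[R]_n).
Variables (eps1 eps2 : R) (z : 'cV[R]_n).
Hypotheses (n_gt0 : (0 < n)%N) (gamma_gt0 : 0 < gamma) (dc_gt0 : 0 < dc).
Hypotheses (Lam_gt0 : 0 < al_Lambda P) (rho0_gt : 2 * gamma < al_rho0 P).
Hypotheses (alpha01 : 0 < al_alpha P < 1) (ratio_gt1 : 1 < al_ratio P).
Hypotheses (delta01 : 0 < al_delta P < 1) (theta01 : 0 < al_theta P < 1).
Hypotheses (zeta01 : 0 < al_zeta P < 1) (eta01 : 0 < al_eta P < 1).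
Hypothesis rho0_df : al_Lambda P ^+ 2 / (2 * al_rho0 P) <= df.
Hypothesis rho0_dc : Num.sqrt (2 * infeas_const fhi flow gamma / (al_rho0 P - 2 * gamma)
  + al_Lambda P ^+ 2 / (al_rho0 P - 2 * gamma) ^+ 2)
  + al_Lambda P / (al_rho0 P - 2 * gamma) <= dc.
Hypotheses (f_diff : twice_diff f) (c_diff : forall i, twice_diff (comp_fun c i)).
Hypothesis f_low : forall x, flow <= f x + gamma * enorm (c x) ^+ 2 / 2.
Hypothesis S_Omega : Sset f c fhi df dc `<=` Omega.
Hypothesis HK : derivative_bound f c (Sset f c fhi df dc) Omega K.
Hypotheses (eps1_01 : 0 < eps1 < 1) (eps2_01 : 0 < eps2 < 1).
Hypotheses (z_feas : enorm (c z) <= eps1 / 2) (z_hi : f z <= fhi).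

Let rhoM := rho_const fhi flow gamma P * eps1 ^- 2.
Let LC := lip_const m fhi flow gamma dc P K.
Let l := log_eps eps1 eps2.
Let ld := log_eps_dim n eps1 eps2.

Let K_ge0 : 0 <= K. Proof. by case: HK. Qed.

Let z_half : enorm (c z) <= 1 / 2.
Proof.
case/andP: eps1_01 => _ e1; apply: le_trans z_feas _.
by rewrite ler_pM2r ?invr_gt0 // ltW.
Qed.

Let A_ge0 : 0 <= infeas_const fhi flow gamma.
Proof. exact: infeas_const_ge0 gamma_gt0 f_low z_half z_hi. Qed.

Let q_ge1 : 1 <= eps1 ^- 2. Proof. exact: inv_sqr_ge1. Qed.
Let l_ge1 : 1 <= l. Proof. exact: log_eps_ge1. Qed.
Let l_le : 1 + ln eps1^-1 <= l. Proof. exact: log_inv_le. Qed.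
Let ld_ge : l <= ld. Proof. exact: log_eps_le_dim. Qed.
Let ib_ge1 : 1 <= iter_bound eps1 eps2. Proof. exact: iter_bound_ge1. Qed.
Let rc_ge0 : 0 <= rho_const fhi flow gamma P. Proof. exact: rho_const_ge0. Qed.
Let dc_pos : 0 <= dc. Proof. exact: ltW. Qed.
Let rho0_pos : 0 < al_rho0 P.
Proof. by apply: lt_trans rho0_gt; rewrite mulr_gt0. Qed.

Let hess_bound_ge0 (rho : R) : 0 <= rho ->
  0 <= auglag_hess_bound m dc (al_Lambda P) K rho.
Proof.
move=> r0; apply: addr_ge0 => //; apply: mulr_ge0 => //; apply: addr_ge0.
  apply: mulr_ge0 => //; apply: addr_ge0; [exact: ltW|exact: mulr_ge0].
by apply: mulr_ge0 => //; exact: sqr_ge0.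
Qed.

Let low_le : 0 <= fhi - auglag_low flow gamma (al_Lambda P) (al_rho0 P).
Proof.
rewrite subr_ge0; apply: le_trans z_hi.
(* At [z] the augmented Lagrangian with zero multiplier equals [f z], which lies above the lower
   bound and below [fhi]. *)
rewrite -(auglag_at_z f c z 0 (al_rho0 P)).
by apply: auglag_lower => //; rewrite enorm0 ltW.
Qed.

Let descent_const_ge0 : 0 <= descent_const fhi flow gamma P.
Proof.
apply: addr_ge0 => //; apply: divr_ge0; first exact: mulr_ge0.
by apply: ltW; exact: decrease_const_gt0.
Qed.

Let kappa_bound_ge2 : 2 <= kappa_bound m dc K P eps2 rhoM.
Proof.
have [e20 e21] := andP eps2_01.
rewrite /kappa_bound lerDr divr_ge0 ?(ltW e20) // hess_bound_ge0 //.
by rewrite mulr_ge0 // (le_trans _ q_ge1).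
Qed.

Lemma call_bound_le : call_bound n m dc K P eps2 rhoM <=
  products_const m fhi flow gamma dc P K * (mv_factor n eps1 eps2 * ld).
Proof.
rewrite /call_bound /products_const -mulrA ler_wpM2l //.
apply: subroutine_bound_le => //.
  by have := hess_bound_ge0 rc_ge0; rewrite /kappa_const; lra.
exact: (kappa_const_scale m dc gamma_gt0 Lam_gt0 rho0_gt ratio_gt1 A_ge0 K_ge0 q_ge1 eps2_01).
Qed.

Let levelS lam rho x : enorm lam <= al_Lambda P -> al_rho0 P <= rho ->
  auglag f c z lam rho x <= f z -> Sset f c fhi df dc x.
Proof.
move=> lamL rr.
exact: (level_Sset gamma_gt0 rho0_gt f_low z_half z_hi lamL rr rho0_df rho0_dc).
Qed.

Lemma general_hess_segment lam rho x d : enorm lam <= al_Lambda P ->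
  al_rho0 P <= rho <= rhoM ->
  (forall u : R, 0 <= u <= 1 -> auglag f c z lam rho (x + u *: d) <= f z) ->
  snorm (hess (auglag f c z lam rho) (x + d) - hess (auglag f c z lam rho) x)
    <= LC * eps1 ^- 2 * enorm d.
Proof.
move=> lamL /andP[rr rM] seg; have rpos : 0 < rho by exact: lt_le_trans rr.
have h := auglag_hess_segment n_gt0 f_diff c_diff lamL rpos
  (fun y => @levelS lam rho y lamL rr)
  (fun y => @level_ctilde_le R n m f c fhi flow gamma dc (al_Lambda P) (al_rho0 P) z
     gamma_gt0 rho0_gt f_low z_half z_hi lam rho lamL rr rho0_dc y)
  S_Omega HK seg.
apply: le_trans h _.
apply: ler_wpM2r; first exact: enorm_ge0.
apply: le_trans (lip_const_scale m dc gamma_gt0 Lam_gt0 rho0_gt ratio_gt1 A_ge0 K_ge0 q_ge1).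
rewrite /auglag_lip lerD2l ler_wpM2l //; apply: lerD.
  by rewrite ler_wpM2r // lerD2l ler_wpM2r.
by rewrite ler_wpM2l // ler_wpM2r // sqr_ge0.
Qed.

Lemma affine_case_hess_segment lam rho x d : affine_map c ->
  enorm lam <= al_Lambda P -> al_rho0 P <= rho <= rhoM ->
  (forall u : R, 0 <= u <= 1 -> auglag f c z lam rho (x + u *: d) <= f z) ->
  snorm (hess (auglag f c z lam rho) (x + d) - hess (auglag f c z lam rho) x)
    <= (1 + K) * enorm d.
Proof.
move=> aff lamL /andP[rr rM] seg.
exact: (affine_hess_segment f_diff c_diff (fun y => levelS lamL rr) S_Omega HK aff seg).
Qed.

Lemma lip_const_ge : 1 + K <= LC.
Proof.
rewrite /LC /lip_const /auglag_lip lerDl; apply: mulr_ge0 => //; apply: addr_ge0.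
  by apply: mulr_ge0 => //; apply: addr_ge0; [exact: ltW|exact: mulr_ge0].
by apply: mulr_ge0 => //; apply: mulr_ge0 => //; exact: sqr_ge0.
Qed.

Variables (Lb : R).
Hypothesis Lb_ge1 : 1 <= Lb.
Hypothesis Lb_lip : forall lam rho x d, enorm lam <= al_Lambda P ->
  al_rho0 P <= rho <= rhoM ->
  (forall u : R, 0 <= u <= 1 -> auglag f c z lam rho (x + u *: d) <= f z) ->
  snorm (hess (auglag f c z lam rho) (x + d) - hess (auglag f c z lam rho) x)
    <= Lb * enorm d.

Lemma inner_iterations_le : inner_iterations fhi flow gamma P eps1 eps2 Lb <=
  descent_const fhi flow gamma P * (Lb ^+ 2 * iter_bound eps1 eps2).
Proof.
rewrite /inner_iterations /descent_const; set DF := fhi - _; set cd := decrease_const _ _.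
have LI : 1 <= Lb ^+ 2 * iter_bound eps1 eps2.
  by rewrite -[1]mulr1 ler_pM // exprn_ege1.
have -> : 2 * DF * (Lb ^+ 2 / cd) * iter_bound eps1 eps2
  = 2 * DF / cd * (Lb ^+ 2 * iter_bound eps1 eps2) by ring.
move: (2 * DF / cd) (Lb ^+ 2 * _) LI => a b b1; lra.
Qed.

Lemma totals_le x0 lam0 N M : enorm lam0 <= al_Lambda P ->
  al_run f c P eps1 eps2 z 0 x0 lam0 (al_rho0 P) N M ->
  let T := calls_const fhi flow gamma dc P * l ^+ 2
    * (descent_const fhi flow gamma P * (Lb ^+ 2 * iter_bound eps1 eps2)) in
  N%:R <= T /\
  M%:R <= T * (products_const m fhi flow gamma dc P K * (mv_factor n eps1 eps2 * ld)).
Proof.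
move=> lam0L run T.
have [h1 h2] := al_run_bound n_gt0 gamma_gt0 Lam_gt0 rho0_gt alpha01 ratio_gt1 delta01
  theta01 zeta01 eta01 rho0_df rho0_dc f_diff c_diff f_low HK eps1_01 eps2_01
  z_feas z_hi Lb_ge1 Lb_lip
  (final_indexP ratio_gt1)
  (increase_indexP gamma_gt0 Lam_gt0 rho0_gt ratio_gt1 A_ge0 eps1_01)
  (contraction_indexP dc_gt0 alpha01 eps1_01)
  (rho_max_le gamma_gt0 Lam_gt0 rho0_gt ratio_gt1 A_ge0 eps1_01)
  run (i := 0) (s := 0) lam0L (esym (mulr1 _)) isT isT isT isT (fun h => False_ind _ (notF h)).
have cl := calls_le gamma_gt0 dc_gt0 Lam_gt0 rho0_gt alpha01 ratio_gt1 A_ge0 eps1_01 l_le.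
have ii := inner_iterations_le; have cb := call_bound_le.
have in0 : 0 <= inner_iterations fhi flow gamma P eps1 eps2 Lb.
  apply: addr_ge0 => //; apply: mulr_ge0; last exact: le_trans ib_ge1.
  apply: mulr_ge0; first exact: mulr_ge0.
  by apply: divr_ge0; [exact: sqr_ge0|apply: ltW; exact: decrease_const_gt0].
have NT : N%:R <= T.
  by apply: le_trans h1 _; apply: ler_pM.
split=> //; apply: le_trans h2 _.
have TT : 0 <= T by exact: le_trans NT.
have calls0 := calls_const_ge0 fhi flow gamma dc alpha01 ratio_gt1.
have mv0 : 0 <= mv_factor n eps1 eps2 * ld.
  apply: mulr_ge0; last by apply: le_trans ld_ge; exact: le_trans l_ge1.
  have [/ltW e10 _] := andP eps1_01.
  by rewrite le_min ler0n mulr_ge0 ?invr_ge0 ?sqrtr_ge0.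
have p0 := products_const_ge0 m fhi flow gamma dc P K.
apply: (@le_trans _ _ (T * call_bound n m dc K P eps2 rhoM)); last exact: ler_wpM2l.
apply: ler_wpM2r; last by apply: ler_pM.
by rewrite /call_bound mulr_ge0 // le_min ler0n subroutine_bound_ge0.
Qed.

(** [X] compares [Lb ^+ 2] with the square of [LC], which turns both cases into one statement.
    Products need a third logarithm; the iteration bound, which has two, is relaxed so that both
    share the exponent and the constant. *)
Lemma totals_order (X : R) x0 lam0 N M : enorm lam0 <= al_Lambda P ->
  al_run f c P eps1 eps2 z 0 x0 lam0 (al_rho0 P) N M ->
  Lb ^+ 2 <= LC ^+ 2 * X ->
  N%:R <= total_const m fhi flow gamma dc P K * (X * iter_bound eps1 eps2) * l ^+ 3 /\
  M%:R <= total_const m fhi flow gamma dc P K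
    * (X * iter_bound eps1 eps2 * mv_factor n eps1 eps2) * ld ^+ 3.
Proof.
move=> lam0L run LX; have [h1 h2] := totals_le lam0L run.
have calls0 := calls_const_ge0 fhi flow gamma dc alpha01 ratio_gt1.
have ib0 : 0 <= iter_bound eps1 eps2 by exact: le_trans ib_ge1.
have p0 := products_const_ge0 m fhi flow gamma dc P K.
have l0 : 0 <= l by exact: le_trans l_ge1.
have LC0 : 0 < LC.
  by apply: lt_le_trans lip_const_ge; apply: ltr_wpDr.
have X0 : 0 <= X.
  rewrite -(pmulr_rge0 X (exprn_gt0 2 LC0)).
  by apply: le_trans LX; exact: sqr_ge0.
have mv0 : 0 <= mv_factor n eps1 eps2.
  have [/ltW e10 _] := andP eps1_01.
  by rewrite le_min ler0n mulr_ge0 ?invr_ge0 ?sqrtr_ge0.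
set I := iter_const m fhi flow gamma dc P K.
have I0 : 0 <= I by apply: mulr_ge0; [exact: mulr_ge0|exact: sqr_ge0].
set p := products_const _ _ _ _ _ _ _ in h2 p0 *.
have -> : total_const m fhi flow gamma dc P K = I * (1 + p) by [].
have TI : calls_const fhi flow gamma dc P * l ^+ 2
    * (descent_const fhi flow gamma P * (Lb ^+ 2 * iter_bound eps1 eps2))
    <= I * (X * iter_bound eps1 eps2) * l ^+ 2.
  have -> : calls_const fhi flow gamma dc P * l ^+ 2
    * (descent_const fhi flow gamma P * (Lb ^+ 2 * iter_bound eps1 eps2)) =
    (calls_const fhi flow gamma dc P * descent_const fhi flow gamma P)
    * (l ^+ 2 * iter_bound eps1 eps2) * Lb ^+ 2 by ring.
  have -> : I * (X * iter_bound eps1 eps2) * l ^+ 2 =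
    (calls_const fhi flow gamma dc P * descent_const fhi flow gamma P)
    * (l ^+ 2 * iter_bound eps1 eps2) * (LC ^+ 2 * X) by rewrite /I /iter_const -/LC; ring.
  by apply: ler_wpM2l => //; apply: mulr_ge0; [exact: mulr_ge0|rewrite mulr_ge0 // exprn_ge0].
move: I I0 TI p p0 h2 => I I0 TI p p0 h2.
have J0 : 0 <= I * (X * iter_bound eps1 eps2) by rewrite !mulr_ge0.
split.
  apply: le_trans h1 _; apply: le_trans TI _.
  have -> : I * (1 + p) * (X * iter_bound eps1 eps2) * l ^+ 3 =
    I * (X * iter_bound eps1 eps2) * l ^+ 2 * ((1 + p) * l) by ring.
  rewrite ler_peMr ?mulr_ge0 ?exprn_ge0 // -[leLHS]mulr1; apply: ler_pM => //.
  by rewrite lerDl.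
apply: le_trans h2 _.
have -> : I * (1 + p) * (X * iter_bound eps1 eps2 * mv_factor n eps1 eps2) * ld ^+ 3 =
  I * (X * iter_bound eps1 eps2) * ld ^+ 2 * ((1 + p) * (mv_factor n eps1 eps2 * ld)) by ring.
have ld0 : 0 <= ld by exact: le_trans ld_ge.
have m0 : 0 <= mv_factor n eps1 eps2 * ld by exact: mulr_ge0.
apply: ler_pM.
- apply: mulr_ge0; first by rewrite mulr_ge0 // exprn_ge0.
  by apply: mulr_ge0 => //; rewrite mulr_ge0 // sqr_ge0.
- exact: mulr_ge0.
- apply: le_trans TI _; rewrite ler_wpM2l //.
  by rewrite lerXn2r.
- by rewrite ler_wpM2r // lerDr.
Qed.

End Totals.

Theorem theorem4p4 (R : realType) (m : nat)
    (fhi flow gamma df dc : R) (P : al_params R)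
    (gamma_gt0 : 0 < gamma) (df_gt0 : 0 < df) (dc_gt0 : 0 < dc)
    (Lambda_gt0 : 0 < al_Lambda P) (rho0_gt : 2 * gamma < al_rho0 P)
    (alpha01 : 0 < al_alpha P < 1) (ratio_gt1 : 1 < al_ratio P)
    (delta01 : 0 < al_delta P < 1) (theta01 : 0 < al_theta P < 1)
    (zeta01 : 0 < al_zeta P < 1) (eta01 : 0 < al_eta P < 1)
    (rho0_df : al_Lambda P ^+ 2 / (2 * al_rho0 P) <= df)
    (rho0_dc : Num.sqrt (2 * (fhi - flow + gamma) / (al_rho0 P - 2 * gamma)
                         + al_Lambda P ^+ 2 / (al_rho0 P - 2 * gamma) ^+ 2)
               + al_Lambda P / (al_rho0 P - 2 * gamma) <= dc) :
  exists (C : R -> R) (p : nat),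
  forall (n : nat) (f : 'cV[R]_n -> R) (c : 'cV[R]_n -> 'cV[R]_m)
    (Omega : set 'cV[R]_n),
  let S := Sset f c fhi df dc in
  let K := regularity_const f c S Omega in
  (0 < n)%N ->
  C2 f -> (forall i, C2 (comp_fun c i)) ->
  (exists xopt, c xopt = 0 /\ forall x, c x = 0 -> f xopt <= f x) ->
  (forall x, flow <= f x + gamma * enorm (c x) ^+ 2 / 2) ->
  compact S ->
  open Omega -> convex_in Omega -> S `<=` Omega ->
  (exists L, hess_lipschitz f Omega L) ->
  (forall i, exists L, hess_lipschitz (comp_fun c i) Omega L) ->
  forall (eps1 eps2 : R) (z x0 : 'cV[R]_n) (lam0 : 'cV[R]_m),
  0 < eps1 < 1 -> 0 < eps2 < 1 ->
  enorm (c z) <= eps1 / 2 -> f z <= fhi ->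
  eball (al_Lambda P) lam0 ->
  forall Niter Nmv : nat,
  al_run f c P eps1 eps2 z 0 x0 lam0 (al_rho0 P) Niter Nmv ->
  [/\ Niter%:R <= C K * (eps1 ^- 4 * iter_bound eps1 eps2)
                  * log_eps eps1 eps2 ^+ p,
      affine_map c ->
      Niter%:R <= C K * iter_bound eps1 eps2 * log_eps eps1 eps2 ^+ p,
      Nmv%:R <= C K * (eps1 ^- 4 * iter_bound eps1 eps2 * mv_factor n eps1 eps2)
                * log_eps_dim n eps1 eps2 ^+ p
    & affine_map c ->
      Nmv%:R <= C K * (iter_bound eps1 eps2 * mv_factor n eps1 eps2)
                * log_eps_dim n eps1 eps2 ^+ p].
Proof.
(* Introduced before [n], [f], [c] and [Omega], so only [K] can carry information about them. *)
exists (total_const m fhi flow gamma dc P), 3%N.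
move=> n f c Omega S K n0 Cf Cc _ f_low cS _ _ SO Lf Lc eps1 eps2 z x0 lam0.
move=> e1 e2 zf zh lam0L N M run.
have HK : derivative_bound f c S Omega K by exact: regularity_const_attained.
have fd := C2_twice_diff Cf.
have cd i : twice_diff (comp_fun c i) by exact: (C2_twice_diff (Cc i)).
have K0 : 0 <= K by case: HK.
have q1 := inv_sqr_ge1 e1.
have LK := lip_const_ge gamma_gt0 dc_gt0 Lambda_gt0 rho0_gt ratio_gt1 f_low HK e1 zf zh.
have L1 : 1 <= lip_const m fhi flow gamma dc P K by apply: le_trans LK; rewrite lerDl.
have gen : 1 <= lip_const m fhi flow gamma dc P K * eps1 ^- 2.
  by rewrite -[leLHS]mulr1; apply: ler_pM.
have genlip := general_hess_segment n0 gamma_gt0 dc_gt0 Lambda_gt0 rho0_gt ratio_gt1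
  rho0_df rho0_dc fd cd f_low SO HK e1 zf zh.
have order Lb := @totals_order R n m f c fhi flow gamma df dc K P Omega eps1 eps2 z
  n0 gamma_gt0 dc_gt0 Lambda_gt0 rho0_gt alpha01 ratio_gt1 delta01 theta01 zeta01 eta01
  rho0_df rho0_dc fd cd f_low HK e1 e2 zf zh Lb.
have sq : (lip_const m fhi flow gamma dc P K * eps1 ^- 2) ^+ 2 <=
    lip_const m fhi flow gamma dc P K ^+ 2 * eps1 ^- 4.
  by rewrite exprMn -exprVn -exprM exprVn.
have [g1 g2] := order _ gen genlip _ x0 lam0 N M lam0L run sq.
have aff (H : affine_map c) :
    N%:R <= total_const m fhi flow gamma dc P K * (1 * iter_bound eps1 eps2)
      * log_eps eps1 eps2 ^+ 3 /\
    M%:R <= total_const m fhi flow gamma dc P K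
      * (1 * iter_bound eps1 eps2 * mv_factor n eps1 eps2) * log_eps_dim n eps1 eps2 ^+ 3.
  have lip := affine_case_hess_segment gamma_gt0 rho0_gt rho0_df rho0_dc fd cd f_low
    SO HK e1 zf zh.
  (* Here [X = 1], because [1 + K] is below [lip_const]; the general case uses [X = eps1 ^- 4]. *)
  apply: (order (1 + K) _ _ 1 x0 lam0 N M lam0L run).
  - by rewrite lerDl.
  - by move=> lam rho x d; exact: lip.
  - rewrite mulr1 lerXn2r // nnegrE; last exact: (le_trans ler01 L1).
    exact: addr_ge0.
split=> // [/aff[]|/aff[]]; by rewrite mul1r.
Qed.
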